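(* Let $A(t)=(A_{\alpha\beta}\,x_{\alpha\beta}\,t^{d_{\alpha\beta}})$ be a $(2\times 2)$-type generic partitioned polynomial matrix and let $k$ be a nonnegative integer. The following three values (in $\mathbf{R}\cup\{\pm\infty\}$) are the same: (i) $\delta_k(A(t))$; (ii) $\sup\{\,w(M,I) : (M,I)\text{ is a matching-pair of size }k\,\}$; (iii) $\inf\{\,p(\mathcal{V})+kc : \mathcal{V}\text{ is a labeling},\ c\in\mathbf{R},\ p\text{ is a }c\text{-potential}\,\}$.
   Context: Matrix. Let $\mathbf{F}$ be a field and $\mu,\nu$ positive integers. $A(t)=(A_{\alpha\beta}x_{\alpha\beta}t^{d_{\alpha\beta}})$ is a $2\mu\times2\nu$ block matrix with $\alpha\in\{1,\dots,\mu\}$, $\beta\in\{1,\dots,\nu\}$, where $A_{\alpha\beta}$ is a $2\times2$ matrix over $\mathbf{F}$, the $x_{\alpha\beta}$ are distinct indeterminates, $d_{\alpha\beta}\in\mathbf{Z}$, and $t$ is another indeterminate; it is a matrix over $\mathbf{F}(x,t)$. Put $\delta_k(A(t)):=\sup\{\deg\det B(t): B(t)\ k\times k\text{ submatrix of }A(t)\}$ with $\deg$ the degree in $t$, $\deg0=-\infty$, $\sup\emptyset=-\infty$, $\delta_0(A(t)):=0$. Spaces and graph. Row-block indices $\alpha$ and column-block indices $\beta$ are regarded as disjoint sets of nodes; $\gamma$ denotes a node of either kind. $U_\alpha=\mathbf{F}^2$, $V_\beta=\mathbf{F}^2$, and $A_{\alpha\beta}(u,v):=u^\top A_{\alpha\beta}v$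 for $u\in U_\alpha$, $v\in V_\beta$; for subspaces $X\subseteq U_\alpha,Y\subseteq V_\beta$, $A_{\alpha\beta}(X,Y)$ is the set of values. $\ker_{\rm L}(A_{\alpha\beta})$, $\ker_{\rm R}(A_{\alpha\beta})$ are the left and right kernels. $\mathcal{M}_\gamma$ is the set of 1-dimensional subspaces of $U_\alpha$ (if $\gamma=\alpha$) or $V_\beta$ (if $\gamma=\beta$). $G$ is the bipartite graph on the nodes $\alpha$ and $\beta$ with edge set $E=\{\alpha\beta: A_{\alpha\beta}\neq O\}$. An edge $\alpha\beta$ is rank-$r$ ($r=1,2$) if $\operatorname{rank}A_{\alpha\beta}=r$. Labeling. A labeling $\mathcal{V}=(\{U_\alpha^+,U_\alpha^-\},\{V_\beta^+,V_\beta^-\})_{\alpha,\beta}$ assigns to each $\alpha$ two distinct elements $U_\alpha^+\ne U_\alpha^-$ of $\mathcal{M}_\alpha$ and to each $\beta$ two distinct elements $V_\beta^+\ne V_\beta^-$ of $\mathcal{M}_\beta$. Pseudo-matching. $M\subseteq E$ is a pseudo-matching if: (Deg) every node has degree at most $2$ in $M$ (so each connected component of $M$ is a path or a cycle; fix a proper 2-edge-colouring of $M$, calling the edges of the two colours $+$-edges and $-$-edges); (Cycle) each cycle component of $M$ has at least one rank-1 edge; (VL) $M$ admits a valid labeling, i.e. a labeling such that for each $\alpha\beta\in M$: $A_{\alpha\beta}(U_\alpha^+,V_\beta^-)=A_{\alpha\beta}(U_\alpha^-,V_\beta^+)=\{0\}$, and $(\ker_{\rm L}(A_{\alpha\beta}),\ker_{\rm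 R}(A_{\alpha\beta}))$ equals $(U_\alpha^+,V_\beta^+)$ if $\alpha\beta$ is a rank-1 $+$-edge and $(U_\alpha^-,V_\beta^-)$ if $\alpha\beta$ is a rank-1 $-$-edge. Matching-pair. An edge $\alpha\beta\in M$ is isolated if $\alpha$ and $\beta$ both have degree $1$ in $M$. A matching-pair is a pair $(M,I)$ with $M$ a pseudo-matching and $I$ a set of isolated rank-2 edges of $M$. Its size is $|M|+|I|$ and its weight is $w(M,I):=\sum_{\alpha\beta\in M}d_{\alpha\beta}+\sum_{\alpha\beta\in I}d_{\alpha\beta}$. Potential. For $c\in\mathbf{R}$, a function $p:\bigcup_\gamma\mathcal{M}_\gamma\to\mathbf{R}$ (the union over distinct nodes being disjoint) is a $c$-potential if $p(Z)\ge0$ for all $Z$, and $p(X)+p(Y)+c\ge d_{\alpha\beta}$ for all $\alpha\beta\in E$, $X\in\mathcal{M}_\alpha$, $Y\in\mathcal{M}_\beta$ with $A_{\alpha\beta}(X,Y)\ne\{0\}$. For a labeling $\mathcal{V}$, $p(\mathcal{V}):=\sum_\alpha(p(U_\alpha^+)+p(U_\alpha^-))+\sum_\beta(p(V_\beta^+)+p(V_\beta^-))$. *)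

(* Defs.v *)
From HB Require Import structures.
From mathcomp Require Import all_boot all_order all_algebra.
From mathcomp Require Import all_classical all_reals ereal.
(* The notations of [mpoly] clash with those of MathComp-Analysis. *)
From mathcomp Require Import -(notations) mpoly.

Set Implicit Arguments.
Unset Strict Implicit.
Unset Printing Implicit Defensive.

Import Order.TTheory GRing.Theory Num.Theory.
Local Open Scope ring_scope.
Local Open Scope classical_set_scope.

Local Notation "x %:F" := (@FracField.tofrac _ x).

Section Degree.
Variable K : fieldType.

(* The degree of a nonzero [f = p / q] in [K(t)] is [deg p - deg q]; as [size]
   is one more than the degree, it is also [size p - size q].  It is computed
   on the canonical representative of [f], but see [fracdeg_div]. *)
Definition fracdeg (f : {fraction {poly K}}) : int :=
  (size (repr f).1)%:Z - (size (repr f).2)%:Z.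

Lemma fracdeg_div (p q : {poly K}) : p != 0 -> q != 0 ->
  fracdeg (p%:F / q%:F) = (size p)%:Z - (size q)%:Z.
Proof.
move=> p0 q0; set f := _ / _; rewrite /fracdeg.
have b0 : (repr f).2 != 0 by exact: denom_ratioP.
have E : (repr f).1 * q = p * (repr f).2.
  have Ef : f = \pi_({fraction {poly K}})%qT (Ratio p q).
    rewrite /f; unlock FracField.tofrac.
    rewrite -[X in _ * X = _]FracField.pi_inv -[LHS]FracField.pi_mul.
    congr (\pi_({fraction {poly K}})%qT _).
    rewrite /FracField.mulf /FracField.invf !numden_Ratio ?oner_neq0 //.
    by rewrite mulr1 mul1r.
  have := FracField.equivf_l (Ratio p q).
  by rewrite -Ef !numden_Ratio // => ->; rewrite mulrC.
have a0 : (repr f).1 != 0.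
  have : (repr f).1 * q != 0 by rewrite E mulf_neq0.
  by rewrite mulf_eq0 negb_or => /andP[].
have /(congr1 (fun r : {poly K} => size r)) := E.
rewrite !size_mul // => S.
have := size_poly_eq0 q; have := size_poly_eq0 p.
have := size_poly_eq0 (repr f).1; have := size_poly_eq0 (repr f).2.
rewrite (negbTE a0) (negbTE b0) (negbTE p0) (negbTE q0).
move: S; case: (size (repr f).1) => // a; case: (size (repr f).2) => // b.
case: (size p) => // m; case: (size q) => // n.
rewrite !addnS !addSn /= => -[S] _ _ _ _.
apply/eqP; rewrite subr_eq addrAC eq_sym subr_eq -!PoszD !addnS !addSn.
by rewrite -S.
Qed.

Variable R : realType.

Definition tdeg (f : {fraction {poly K}}) : \bar R :=
  if f == 0 then -oo%E else ((fracdeg f)%:~R)%:E.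

Definition delta (m n k : nat) (B : 'M[{fraction {poly K}}]_(m, n)) : \bar R :=
  if k is 0 then 0%E else
  ereal_sup [set r | exists (f : 'I_k -> 'I_m) (g : 'I_k -> 'I_n),
    [/\ {homo f : i j / (i < j)%N}, {homo g : i j / (i < j)%N}
      & r = tdeg (\det (mxsub f g B))]].

End Degree.
Arguments delta {K} R {m n} k B.

Section PartitionedMatrix.
Variables (F : fieldType) (mu nu : nat).

(* [F(x)]; the indeterminate [x_ab] is numbered by [mxvec_index a b]. *)
Definition ratx : fieldType := {fraction (mpoly.mpoly (mu * nu) F)}.

Definition xvar (a : 'I_mu) (b : 'I_nu) : ratx :=
  (mpoly.mpolyX F (mpoly.mnm1 (mxvec_index a b)))%:F.

(* [F(x,t)] is represented as [F(x)(t)]. *)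
Definition ratxt : fieldType := {fraction {poly ratx}}.

Definition ratx_const (c : F) : ratx := (mpoly.mpolyC (mu * nu) c)%:F.

Definition ratxt_of (c : ratx) : ratxt := (c%:P)%:F.

Definition tvar : ratxt := ('X : {poly ratx})%:F.

Definition gpmatrix (A : 'I_mu -> 'I_nu -> 'M[F]_2)
    (d : 'I_mu -> 'I_nu -> int) :
    'M[ratxt]_(\sum_(a < mu) 2, \sum_(b < nu) 2) :=
  \mxblock_(a < mu, b < nu)
    ((ratxt_of (xvar a b) * tvar ^ d a b)
       *: map_mx (fun c => ratxt_of (ratx_const c)) (A a b)).

Definition line := {X : {vspace 'cV[F]_2} | \dim X == 1%N}.

(* [inl a] is a row-block node and [inr b] a column-block node. *)
Definition node := ('I_mu + 'I_nu)%type.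

Definition edge := ('I_mu * 'I_nu)%type.

Definition bilin (B : 'M[F]_2) (u v : 'cV[F]_2) : F := (u^T *m B *m v) 0 0.

Definition bilin_set (B : 'M[F]_2) (X Y : {vspace 'cV[F]_2}) : set F :=
  [set bilin B u v | u in [set` X] & v in [set` Y]].

Definition kerL (B : 'M[F]_2) : {vspace 'cV[F]_2} :=
  lker (linfun (fun u : 'cV[F]_2 => u^T *m B)).

Definition kerR (B : 'M[F]_2) : {vspace 'cV[F]_2} :=
  lker (linfun (fun v : 'cV[F]_2 => B *m v)).

Record labeling := Labeling {
  lpos : node -> line;
  lneg : node -> line;
  _ : forall g, lpos g != lneg g }.

Section Matching.
Variable A : 'I_mu -> 'I_nu -> 'M[F]_2.

Definition edges : {set edge} := [set e | A e.1 e.2 != 0].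

Definition incident (g : node) (e : edge) : bool :=
  match g with inl a => e.1 == a | inr b => e.2 == b end.

Definition degree (M : {set edge}) (g : node) : nat :=
  #|[set e in M | incident g e]|.

Definition adj (M : {set edge}) : rel node := fun g h =>
  match g, h with
  | inl a, inr b | inr b, inl a => (a, b) \in M
  | _, _ => false
  end.

(* [s] lists the nodes of a connected component of [M] along a cycle; the bound
   [2 < size s] excludes a single edge traversed back and forth. *)
Definition cycle_component (M : {set edge}) (s : seq node) : Prop :=
  [/\ ucycle (adj M) s, (2 < size s)%N
    & {in s, forall g, connect (adj M) g =i s}].

(* [sg e = true] means that [e] is a +-edge. *)
Definition proper_coloring (M : {set edge}) (sg : edge -> bool) : Prop :=
  forall g e e', e \in M -> e' \in M -> e != e' ->
    incident g e -> incident g e' -> sg e != sg e'.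

Definition valid_labeling (M : {set edge}) (sg : edge -> bool)
    (V : labeling) : Prop :=
  forall a b, (a, b) \in M ->
    [/\ bilin_set (A a b) (val (lpos V (inl a))) (val (lneg V (inr b)))
          = [set 0],
        bilin_set (A a b) (val (lneg V (inl a))) (val (lpos V (inr b)))
          = [set 0]
      & \rank (A a b) = 1%N ->
        (kerL (A a b), kerR (A a b)) =
          if sg (a, b) then (val (lpos V (inl a)), val (lpos V (inr b)))
          else (val (lneg V (inl a)), val (lneg V (inr b)))].

(* Once every degree is at most 2, a proper 2-colouring exists and is unique up
   to exchanging the colours on components; exchanging [lpos] and [lneg] there
   preserves validity, so the choice of [sg] does not matter. *)
Definition pseudo_matching (M : {set edge}) : Prop :=
  [/\ M \subset edges,
      forall g, (degree M g <= 2)%N,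
      forall s, cycle_component M s ->
        exists2 e, e \in M & inl e.1 \in s /\ \rank (A e.1 e.2) = 1%N
    & exists2 sg, proper_coloring M sg & exists V, valid_labeling M sg V].

Definition isolated (M : {set edge}) (e : edge) : bool :=
  [&& e \in M, degree M (inl e.1) == 1%N & degree M (inr e.2) == 1%N].

Definition matching_pair (M I : {set edge}) : Prop :=
  pseudo_matching M /\
  (forall e, e \in I -> isolated M e /\ \rank (A e.1 e.2) = 2%N).

Variable d : 'I_mu -> 'I_nu -> int.

Definition weight (M I : {set edge}) : int :=
  \sum_(e in M) d e.1 e.2 + \sum_(e in I) d e.1 e.2.

Variable R : realType.

Definition potential (c : R) (p : node -> line -> R) : Prop :=
  (forall g Z, 0 <= p g Z) /\
  (forall a b (X Y : line), (a, b) \in edges ->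
     bilin_set (A a b) (val X) (val Y) <> [set 0] ->
     (d a b)%:~R <= p (inl a) X + p (inr b) Y + c).

Definition labeling_value (p : node -> line -> R) (V : labeling) : R :=
  \sum_(a < mu) (p (inl a) (lpos V (inl a)) + p (inl a) (lneg V (inl a))) +
  \sum_(b < nu) (p (inr b) (lpos V (inr b)) + p (inr b) (lneg V (inr b))).

Definition matching_sup (k : nat) : \bar R :=
  ereal_sup [set r | exists M I : {set edge},
    [/\ matching_pair M I, (#|M| + #|I|)%N = k
      & r = ((weight M I)%:~R)%:E]].

Definition potential_inf (k : nat) : \bar R :=
  ereal_inf [set r | exists (V : labeling) (c : R) (p : node -> line -> R),
    potential c p /\ r = (labeling_value p V + k%:R * c)%:E].

End Matching.
End PartitionedMatrix.

(* Main.v *)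
(* In a basis of each [U_a] and [V_b], the determinant of a minor is a polynomial in
   the [x_ab], and by Cauchy-Binet the monomials that occur in the minors of size [k]
   do not depend on the bases; as [x_ab] always comes with [t ^ d_ab], [delta_k] is
   the largest weight of such a monomial.  All three values are compared with it.

   - A monomial that occurs has, in every basis, a transversal of nonzero entries.
     This bounds its weight by any dual value.  It also forces its support to be a
     pseudo-matching: labels are propagated along the paths between rank-one edges,
     and two equal labels would contradict the existence of a transversal in the
     basis made of them.  A cycle of rank-two edges is replaced by one of its two
     perfect matchings, doubled.
   - The monomial of a matching-pair occurs, because in the basis of the labeling only
     one permutation produces it: any other one would flip a whole cycle of rank-two
     edges.
   - The dual values with integral data are attained or unbounded below.  At an
     optimum, the tight entries, bordered by generic rows and columns, satisfy Hall's
     condition for all subspaces that respect the potential, since a violation would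
     improve the dual.  A Halmos-Vaughan induction shows that the bordered matrix is
     then nonsingular: tight pairs of subspaces split it, a rank-one coefficient can
     be expanded, and if all coefficients have rank two a perfect matching of the
     block graph suffices.  This yields a monomial whose weight is the dual value. *)

Require Import Defs.
From mathcomp Require Import all_boot all_order all_algebra.
From mathcomp Require Import all_classical all_reals ereal.
From HB Require Import structures.
From mathcomp Require Import -(notations) mpoly.
From mathcomp Require Import fingroup perm zify ring.

Set Implicit Arguments.
Unset Strict Implicit.
Unset Printing Implicit Defensive.

Import Order.TTheory GRing.Theory Num.Theory.
Local Open Scope ring_scope.

(** * Hall's marriage theorem and minors *)

(** The entries of a block share one indeterminate, so a Hall condition on rows and columns alone is
    too weak: a large zero block may show only after a change of basis inside the nodes. The
    condition is therefore imposed in all bases. The dual is shaped for this, since a labeling is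
    itself a choice of bases: too large a zero block found in other bases yields a better dual
    solution. Basis changes must not mix slots of different potential, or tight entries would be
    mixed with others; hence the gradings. Potentials are never rounded. Weak duality holds for all
    real ones, strong duality is proved for integral ones, where a set of values bounded below has a
    minimum, and the two inequalities close the gap. On the way to matching-pairs a monomial is
    remembered only through its exponents and the transversals that they have in every basis.
    Whether the doubled monomial of a cycle occurs in a minor would involve cancellations, whereas
    its transversals can be written down. *)

Section Marriage.
Variables (A B : finType) (r : A -> B -> bool).

Definition neighbours (S : {set A}) : {set B} :=
  [set b | [exists a in S, r a b]].

Lemma neighboursU (S S' : {set A}) :
  neighbours (S :|: S') = neighbours S :|: neighbours S'.
Proof.
apply/setP => b; rewrite !inE; apply/existsP/orP.
- case=> a; rewrite inE => /andP[/orP[aS|aS] rab]; [left|right];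
  by apply/existsP; exists a; rewrite aS.
- by case=> /existsP[a /andP[aS rab]]; exists a; rewrite inE aS ?orbT.
Qed.

Lemma neighboursS (S S' : {set A}) : S \subset S' -> neighbours S \subset neighbours S'.
Proof. by move=> sSS; rewrite -(finset.setUidPr sSS) neighboursU finset.subsetUl. Qed.

(** Relative to [S] and [T] so that the induction can shrink both. A proper nonempty subset without
    slack is matched first, inside its own neighbours, and the rest avoids them; if every such
    subset has slack, any single pair can be matched and removed. [b0] is a default value that makes
    [f] total. *)
Lemma marriage_in (b0 : B) (S : {set A}) (T : {set B}) :
  (forall S' : {set A}, S' \subset S -> #|S'| <= #|T :&: neighbours S'|)%N ->
  exists f : A -> B, {in S &, injective f} /\
    {in S, forall a, f a \in T /\ r a (f a)}.
Proof.
have [n] := ubnP #|S|; elim: n S T => // n IHn S T ltSn hall.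
have [->|[a aS]] := set_0Vmem S.
  by exists (fun=> b0); split=> [x y|x]; rewrite inE.
case: (pickP (fun S' : {set A} => [&& S' \proper S, S' != finset.set0
   & #|T :&: neighbours S'| <= #|S'|]%N)) => [S1|noS].
  case/and3P => pS1 S1n0 leS1.
  have sS1 := proper_sub pS1.
  set T1 := T :&: neighbours S1.
  have [|S' sS'|f1 [f1i f1T]] := IHn S1 T1.
  - by rewrite -ltnS (leq_trans _ ltSn) // ltnS proper_card.
  - rewrite /T1 -finset.setIA (finset.setIidPr (neighboursS sS')).
    exact/hall/(fintype.subset_trans sS').
  have [|S' sS'|f2 [f2i f2T]] := IHn (S :\: S1) (T :\: T1).
  - rewrite -ltnS (leq_trans _ ltSn) // ltnS proper_card //.
    rewrite finset.properEneq subsetDl andbT; apply: contraNneq S1n0 => eS.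
    rewrite -finset.subset0 -(finset.setDv S) -{2}eS finset.setDDr finset.setDv finset.set0U.
    by rewrite finset.subsetI sS1 subxx.
  - have sS'S : S' \subset S by rewrite (fintype.subset_trans sS') ?subsetDl.
    have dS : [disjoint S' & S1].
      by move: sS'; rewrite subsetD => /andP[].
    have := hall (S' :|: S1); rewrite finset.subUset sS'S sS1 => /(_ isT).
    rewrite cardsU (_ : S' :&: S1 = finset.set0) ?cards0 ?subn0; last first.
      by apply/eqP; rewrite setI_eq0.
    rewrite neighboursU finset.setIUr => le1.
    have le2 : (#|T :&: neighbours S' :|: T1| <=
                #|(T :\: T1) :&: neighbours S'| + #|T1|)%N.
      apply: leq_trans (leq_card_setU _ _); apply: subset_leq_card.
      apply/fintype.subsetP => b; rewrite finset.in_setU finset.in_setU finset.in_setI finset.in_setI finset.in_setD.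
      by case: (b \in T1); rewrite ?orbT ?orbF.
    by rewrite -(leq_add2r #|S1|) (leq_trans (leq_trans le1 le2)) ?leq_add2l.
  exists (fun a => if a \in S1 then f1 a else f2 a); split=> [x y xS yS|x xS].
  - have [x1|x1] := boolP (x \in S1); have [y1|y1] := boolP (y \in S1).
    + exact: f1i.
    + have [+ _] := f1T _ x1; have [] := f2T y; first by rewrite inE y1.
      by rewrite inE => /andP[/negP n1 _] _ h1 e; case: n1; rewrite -e.
    + have [+ _] := f1T _ y1; have [] := f2T x; first by rewrite inE x1.
      by rewrite inE => /andP[/negP n1 _] _ h1 e; case: n1; rewrite e.
    + by apply: f2i; rewrite inE ?x1 ?y1.
  - case: ifPn => x1.
    + by have [] := f1T _ x1; rewrite inE => /andP[].
    + by have [] := f2T x; rewrite ?inE ?x1 // => /andP[].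
have [b] : exists b, b \in T :&: neighbours [set a].
  apply/set0Pn; rewrite -card_gt0 (leq_trans _ (hall [set a] _)) ?cards1 //.
  by rewrite finset.sub1set.
rewrite !inE => /andP[bT /existsP[a']]; rewrite inE => /andP[/eqP-> rab].
have [|S' sS'|f [fi fT]] := IHn (S :\ a) (T :\ b).
- by rewrite -ltnS (leq_trans _ ltSn) // ltnS (cardsD1 a S) aS.
- have [->|S'n0] := eqVneq S' finset.set0; first by rewrite cards0.
  have pS' : S' \proper S by rewrite (sub_proper_trans sS') ?properD1.
  have := noS S'; rewrite pS' S'n0 /= leqNgt => /negbFE lt.
  rewrite -ltnS (leq_trans lt) //.
  rewrite (cardsD1 b) -addn1 addnC leq_add ?leq_b1 //.
  by apply: subset_leq_card; apply/fintype.subsetP => x; rewrite !inE; case: (x == b).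
exists (fun x => if x == a then b else f x); split=> [x y xS yS|x xS].
- case: eqVneq => [->|nx]; case: eqVneq => [->|ny] // e.
  + by have [] := fT y; rewrite ?inE ?ny // -e eqxx.
  + by have [] := fT x; rewrite ?inE ?nx // e eqxx.
  + by apply: fi; rewrite // !inE ?nx ?ny.
- case: eqVneq => [->|nx] //.
  by have [] := fT x; rewrite ?inE ?nx // => /andP[].
Qed.

Lemma marriage (hall : forall S : {set A}, (#|S| <= #|neighbours S|)%N) :
  exists f : A -> B, injective f /\ forall a, r a (f a).
Proof.
have [a0 _|A0] := pickP (predT : pred A); last first.
  have F (a : A) : False by have := A0 a.
  by exists (fun a => False_rect B (F a)); split=> [a|a]; case: (F a).
have [b0] : exists b, b \in neighbours [set a0].
  by apply/set0Pn; rewrite -card_gt0 (leq_trans _ (hall _)) ?cards1.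
move=> _; have [S' _|f [fi fr]] := @marriage_in b0 finset.setT finset.setT.
  by rewrite finset.setTI.
exists f; split=> [x y|x]; first by apply: fi; rewrite inE.
by have [] := fr x; rewrite ?inE.
Qed.

End Marriage.

Section CauchyBinet.
Variables (R : comNzRingType) (k : nat).

(** A multilinear form of Cauchy-Binet: the sum runs over all functions, the noninjective ones
    contributing zero determinants, so that neither ordered subsets nor extra signs appear. *)
Lemma det_sum_rows (I : finType) (c : 'I_k -> I -> R) (M : I -> 'I_k -> R) :
  \det (\matrix_(i, j) \sum_x c i x * M x j) =
  \sum_(phi : {ffun 'I_k -> I})
    (\prod_i c i (phi i)) * \det (\matrix_(i, j) M (phi i) j).
Proof.
rewrite /determinant.
under eq_bigr => s _ do under eq_bigr => i _ do rewrite mxE.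
under eq_bigr => s _ do rewrite bigA_distr_bigA /= big_distrr /=.
rewrite exchange_big /=; apply: eq_bigr => phi _.
rewrite big_distrr /=; apply: eq_bigr => s _.
rewrite big_split /= mulrCA; congr (_ * (_ * _)).
by apply: eq_bigr => i _; rewrite mxE.
Qed.

Lemma det_sum_cols (J : finType) (c : J -> 'I_k -> R) (M : 'I_k -> J -> R) :
  \det (\matrix_(i, j) \sum_y M i y * c y j) =
  \sum_(psi : {ffun 'I_k -> J})
    (\prod_j c (psi j) j) * \det (\matrix_(i, j) M i (psi j)).
Proof.
rewrite -det_tr (_ : _^T =
    \matrix_(i, j) \sum_y c y i * M j y); last first.
  by apply/matrixP => i j; rewrite !mxE; apply: eq_bigr => y _; rewrite mulrC.
rewrite det_sum_rows; apply: eq_bigr => psi _; congr (_ * _).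
by rewrite -det_tr; congr (\det _); apply/matrixP => i j; rewrite !mxE.
Qed.

End CauchyBinet.

Section Nonsingular.
Variables (D : idomainType) (N1 N2 : nat).
Implicit Types (I : {set 'I_N1}) (J : {set 'I_N2}) (P : 'M[D]_(N1, N2)).

(* The submatrix of [P] on the rows [I] and columns [J] has independent rows;
   when [#|I| = #|J|] this says that its determinant is not zero. *)
Definition nonsing I J P := forall v : 'rV[D]_N1,
  (forall i, i \notin I -> v 0 i = 0) ->
  (forall j, j \in J -> (v *m P) 0 j = 0) -> v = 0.

Lemma nonsing_det n (f : 'I_n -> 'I_N1) (g : 'I_n -> 'I_N2) P :
  injective f -> injective g ->
  (\det (mxsub f g P) != 0) <-> nonsing [set f i | i in 'I_n] [set g i | i in 'I_n] P.
Proof.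
move=> fi gi; split=> [d0 v v0 vP|ns].
  set w : 'rV_n := \row_i v 0 (f i).
  have wP : w *m mxsub f g P = 0.
    apply/rowP => j; rewrite !mxE -[RHS](vP (g j)) ?imset_f // mxE.
    rewrite (bigID (mem [set f i | i in 'I_n])) /= [X in _ = _ + X]big1 ?addr0.
      rewrite big_imset /=; last by move=> x y _ _; apply: fi.
      by apply: eq_bigr => i _; rewrite !mxE.
    by move=> i ?; rewrite v0 ?mul0r.
  have w0 : w = 0.
    by apply/eqP; apply: contraNT d0 => nw; apply/det0P; exists w.
  apply/rowP => i; rewrite mxE; case: (boolP (i \in [set f i | i in 'I_n])).
    by case/imsetP => j _ ->; move/rowP/(_ j): w0; rewrite !mxE.
  exact: v0.
apply/negP => /det0P[w w0 wP].
pose v : 'rV_N1 := \row_i \sum_(j | f j == i) w 0 j.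
have vf j : v 0 (f j) = w 0 j.
  by rewrite mxE (big_pred1 j) // => x; rewrite /= (inj_eq fi).
have vn i : i \notin [set f i | i in 'I_n] -> v 0 i = 0.
  move=> ni; rewrite mxE big_pred0 // => j; apply: contraNF ni => /eqP <-.
  exact: imset_f.
have /rowP v0 : v = 0.
  apply: ns => // j /imsetP[j' _ ->]; rewrite mxE.
  rewrite (bigID (mem [set f i | i in 'I_n])) /= [X in _ + X]big1 ?addr0.
    rewrite big_imset /=; last by move=> x y _ _; apply: fi.
    move/rowP/(_ j'): wP; rewrite !mxE => wP; rewrite -[RHS]wP.
    by apply: eq_bigr => i _; rewrite vf mxE.
  by move=> i ?; rewrite vn ?mul0r.
case/eqP: w0; apply/rowP => i; rewrite mxE -vf v0 mxE //.
Qed.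

End Nonsingular.

Lemma enum_set_ord N (I : {set 'I_N}) n : #|I| = n ->
  exists f : 'I_n -> 'I_N, injective f /\ [set f i | i in 'I_n] = I.
Proof.
move=> <-; exists (fun i => enum_val i); split; first exact: enum_val_inj.
apply/setP => x; apply/imsetP/idP => [[i _ ->]|xI]; first exact: enum_valP.
by exists (enum_rank_in xI x); rewrite // enum_rankK_in.
Qed.

(** * Generic matrices with graded blocks *)

Section Allowed.
Variables (F : fieldType) (N : nat) (T : eqType).
Variables (nd : 'I_N -> T) (gr : 'I_N -> int).
Implicit Types (I : {set 'I_N}) (S : 'M[F]_N).

(** Basis changes inside the nodes that mix only indices of equal grade and move only those in [I].
    They encode subspaces: a subspace of a node that respects the grading is spanned by basis
    vectors after such a change. *)
Definition graded_change I S :=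
  [/\ S \in unitmx,
      forall r r', S r r' != 0 -> nd r = nd r' /\ gr r = gr r'
    & forall r r', ~~ ((r \in I) && (r' \in I)) -> S r r' = (r == r')%:R].

Lemma graded_change1 I : graded_change I 1%:M.
Proof.
split=> [|r r'|r r' _]; rewrite ?unitmx1 ?mxE //.
by case: (r =P r') => [->//|_]; rewrite eqxx.
Qed.

Lemma graded_changeM I S S' :
  graded_change I S -> graded_change I S' -> graded_change I (S *m S').
Proof.
move=> [uS hS iS] [uS' hS' iS']; split=> [|r r'|r r' nI].
- by rewrite unitmx_mul uS.
- rewrite mxE => /negP n0; have [x] : exists x, S r x * S' x r' != 0.
    apply/existsP; apply: contra_notT n0 => /existsPn z.
    by rewrite big1 // => x _; apply/eqP; have := z x; rewrite negbK.
  rewrite mulf_eq0 negb_or => /andP[/hS[-> ->] /hS'[-> ->]] //.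
- rewrite mxE; case: (boolP (r \in I)) nI => rI /= nI.
  + rewrite (bigD1 r') //= (iS' r' r') ?(negbTE nI) // eqxx mulr1.
    rewrite big1 ?addr0 => [|x xr]; first by rewrite iS // rI (negbTE nI).
    by rewrite iS' ?(negbTE nI) ?andbF // (negbTE xr) mulr0.
  + rewrite (bigD1 r) //= (iS r r) ?(negbTE rI) // eqxx mul1r.
    rewrite big1 ?addr0 => [|x xr]; first by rewrite iS' // (negbTE rI).
    by rewrite iS ?(negbTE rI) // eq_sym (negbTE xr) mul0r.
Qed.

Lemma graded_changeS I I' S :
  I \subset I' -> graded_change I S -> graded_change I' S.
Proof.
move=> sI [uS hS iS]; split=> // r r' nI'; apply: iS; apply: contra nI'.
by case/andP => /(fintype.subsetP sI)-> /(fintype.subsetP sI)->.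
Qed.

(** A transvection, which subtracts [u r] times row [i] from row [r]. As [u i = 0], the subtracted
    matrix [U] has square zero, so [1 - U] has the inverse [1 + U]. *)
Lemma graded_change_col I (i : 'I_N) (u : 'I_N -> F) :
  i \in I -> u i = 0 -> (forall r, u r != 0 -> [/\ r \in I, nd r = nd i & gr r = gr i]) ->
  graded_change I (1%:M - (\col_r u r) *m delta_mx 0 i).
Proof.
move=> iI ui uP; set U := _ *m _.
have UE r r' : U r r' = u r * (r' == i)%:R.
  by rewrite /U mxE big_ord1 !mxE.
split=> [|r r'|r r' nI].
- have UU : U *m U = 0.
    apply/matrixP => r r'; rewrite mxE [RHS]mxE big1 // => s _.
    rewrite !UE; case: (s =P i) => [->|_]; rewrite ?mulr0 ?mul0r //.
    by rewrite ui mul0r mulr0.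
  have := @mulmx1_unit _ _ (1%:M - U) (1%:M + U).
  by rewrite mulmxDr mulmx1 mulmxBl mul1mx UU subr0 subrK => /(_ erefl)[].
- rewrite !mxE big_ord1 !mxE; case: (r =P r') => [->//|nr]; rewrite sub0r oppr_eq0.
  case: (r' =P i) => [->|_]; last by rewrite mulr0 eqxx.
  by rewrite mulr1 => /uP[].
- rewrite !mxE big_ord1 !mxE; case: (r' =P i) nI => [->|_] nI; last by rewrite mulr0 subr0.
  rewrite mulr1; have [->|/uP[rI _ _]] := eqVneq (u r) 0; first by rewrite subr0.
  by rewrite iI rI in nI.
Qed.

Lemma graded_change_row I (i : 'I_N) (u : 'I_N -> F) :
  i \in I -> u i = 0 -> (forall r, u r != 0 -> [/\ r \in I, nd r = nd i & gr r = gr i]) ->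
  graded_change I (1%:M - delta_mx i 0 *m (\row_r u r)).
Proof.
move=> iI ui uP; have := graded_change_col iI ui uP.
set S := 1%:M - _ => -[uS hS iS].
have -> : 1%:M - delta_mx i 0 *m (\row_r u r) = S^T.
  rewrite /S linearB /= tr_scalar_mx trmx_mul trmx_delta; congr (_ - _ *m _).
  by apply/rowP => r; rewrite !mxE.
split=> [|r r'|r r' nI]; rewrite ?unitmx_tr // mxE.
- by case/hS.
- by rewrite andbC in nI; rewrite iS // eq_sym.
Qed.

(** Being the identity outside [I], the change maps the row vectors supported on [I] onto
    themselves. *)
Lemma nonsing_change (D : idomainType) (io : {rmorphism F -> D}) N2
    (I : {set 'I_N}) (J : {set 'I_N2}) S (P : 'M[D]_(N, N2)) :
  graded_change I S -> nonsing I J (map_mx io S *m P) -> nonsing I J P.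
Proof.
move=> [uS hS iS] ns v v0 vP.
have uS' : map_mx io S \in unitmx by rewrite map_unitmx.
have [v' v'S] : exists v', v' *m map_mx io S = v.
  by exists (v *m invmx (map_mx io S)); rewrite mulmxKV.
suff v'0 : v' = 0 by rewrite -v'S v'0 mul0mx.
apply: ns => [r rI|j jJ]; last by rewrite mulmxA v'S vP.
have := v0 r rI; rewrite -v'S mxE (bigD1 r) //= mxE iS ?(negbTE rI) //.
rewrite eqxx rmorph1 mulr1 big1 ?addr0 // => s sr.
by rewrite mxE iS ?(negbTE rI) ?andbF // (negbTE sr) rmorph0 mulr0.
Qed.

Lemma nonsing_change_col (D : idomainType) (io : {rmorphism F -> D}) N1
    (I : {set 'I_N1}) (J : {set 'I_N}) S (P : 'M[D]_(N1, N)) :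
  graded_change J S -> nonsing I J (P *m map_mx io S) -> nonsing I J P.
Proof.
move=> [uS hS iS] ns v v0 vP; apply: ns => // j jJ.
rewrite mulmxA mxE big1 // => c _; case: (boolP (c \in J)) => cJ.
  by rewrite vP ?mul0r.
rewrite [X in _ * X]mxE iS ?(negbTE cJ) //.
by case: (c =P j) cJ => [->|_ _]; rewrite ?jJ // rmorph0 mulr0.
Qed.

End Allowed.

Section SumFibers.
Variables (A B : finType) (f : A -> B) (X : {set A}).

Lemma card_preimset_sum (S : {set B}) :
  #|[set a in X | f a \in S]| = (\sum_(b in S) #|[set a in X | f a == b]|)%N.
Proof.
rewrite -sum1_card (partition_big f (mem S)) /=; last first.
  by move=> a; rewrite inE => /andP[].
apply: eq_bigr => b bS; rewrite -sum1_card; apply: eq_bigl => a.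
by rewrite !inE -andbA; case: eqP => [->|]; rewrite ?bS ?andbF.
Qed.
End SumFibers.

(** * A Hall criterion in all graded bases for generic block matrices *)

Section LocalTheorem.
Variables (F : fieldType) (D : idomainType) (io : {rmorphism F -> D}).
Variables (E : finType) (x : E -> D).
(** The indeterminates are accessed only through substitutions: endomorphisms isolate the part of a
    determinant that contains one [x e], and evaluations in [F] certify that a determinant is not
    zero. *)
Hypothesis x_subst : forall h : E -> D, exists phi : {rmorphism D -> D},
  (forall c, phi (io c) = io c) /\ (forall e, phi (x e) = h e).
Hypothesis x_eval : forall h : E -> F, exists phi : {rmorphism D -> F},
  (forall c, phi (io c) = c) /\ (forall e, phi (x e) = h e).
Variables (N1 N2 : nat) (Tr Tc : finType).
Variables (rn : 'I_N1 -> Tr) (cn : 'I_N2 -> Tc).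
Variables (gr : 'I_N1 -> int) (gc : 'I_N2 -> int).
Variables (src : E -> Tr) (tgt : E -> Tc) (w : E -> int).
Hypothesis rn_fiber : forall a, (#|[set r | rn r == a]| <= 2)%N.
Hypothesis cn_fiber : forall b, (#|[set c | cn c == b]| <= 2)%N.
Implicit Types (B : E -> 'M[F]_(N1, N2)) (I : {set 'I_N1}) (J : {set 'I_N2}).

Definition generic B : 'M[D]_(N1, N2) := \sum_e x e *: map_mx io (B e).

(** Each coefficient lives in the block of one pair of nodes, between grades of a fixed sum. Hence
    two nonzero entries in one column of [B e] lie in rows of the same node and grade, and pivoting
    inside a coefficient is a graded change. *)
Definition homogeneous B := forall e r c, B e r c != 0 ->
  [/\ rn r = src e, cn c = tgt e & gr r + gc c = w e].

(** Frobenius' form of Hall's condition, bounding the zero blocks common to all coefficients, in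
    every graded basis. *)
Definition hall B I J := forall S T (I' : {set 'I_N1}) (J' : {set 'I_N2}),
  graded_change rn gr I S -> graded_change cn gc J T ->
  I' \subset I -> J' \subset J ->
  (forall e r c, r \in I' -> c \in J' -> (S *m B e *m T) r c = 0) ->
  (#|I'| + #|J'| <= #|I|)%N.

Lemma genericE B r c : generic B r c = \sum_e x e * io (B e r c).
Proof. by rewrite /generic summxE; apply: eq_bigr => e _; rewrite !mxE. Qed.

Lemma generic_mul B S T :
  generic (fun e => S *m B e *m T) = map_mx io S *m generic B *m map_mx io T.
Proof.
rewrite /generic mulmx_sumr mulmx_suml; apply: eq_bigr => e _.
by rewrite !map_mxM -scalemxAr -scalemxAl.
Qed.

Lemma homogeneous_mul B I J S T : homogeneous B ->
  graded_change rn gr I S -> graded_change cn gc J T ->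
  homogeneous (fun e => S *m B e *m T).
Proof.
move=> hB [_ hS _] [_ hT _] e r c; rewrite mxE => /negP n0.
have [y] : exists y, (S *m B e) r y * T y c != 0.
  apply/existsP; apply: contra_notT n0 => /existsPn z.
  by rewrite big1 // => y _; apply/eqP; have := z y; rewrite negbK.
rewrite mulf_eq0 negb_or mxE => /andP[/negP n1 /hT[<- <-]].
have [z] : exists z, S r z * B e z y != 0.
  apply/existsP; apply: contra_notT n1 => /existsPn z.
  by rewrite big1 // => k _; apply/eqP; have := z k; rewrite negbK.
by rewrite mulf_eq0 negb_or => /andP[/hS[-> ->] /hB].
Qed.

Lemma generic_zero B I J :
  (forall e r c, r \in I -> c \in J -> B e r c = 0) ->
  forall r c, r \in I -> c \in J -> generic B r c = 0.
Proof.
by move=> z r c rI cJ; rewrite genericE big1 // => e _; rewrite z // rmorph0 mulr0.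
Qed.

(** The matrix is block triangular: the columns in [J'] kill [v] outside [I'], then the other
    columns kill it on [I']. *)
Lemma nonsing_split (P : 'M[D]_(N1, N2)) (I I' : {set 'I_N1}) (J J' : {set 'I_N2}) :
  I' \subset I -> J' \subset J ->
  (forall r c, r \in I' -> c \in J' -> P r c = 0) ->
  nonsing I' (J :\: J') P -> nonsing (I :\: I') J' P -> nonsing I J P.
Proof.
move=> sI sJ z ns1 ns2 v v0 vP.
pose v2 : 'rV_N1 := \row_r (if r \in I' then 0 else v 0 r).
have v20 : v2 = 0.
  apply: ns2 => [r|c cJ'].
    by rewrite !inE mxE; case: (r \in I') => //= /v0.
  rewrite -[RHS](vP c) ?(fintype.subsetP sJ) // !mxE; apply: eq_bigr => r _.
  by rewrite mxE; case: ifP => // rI; rewrite z ?mulr0 // mul0r.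
apply: ns1 => [r rI'|c]; last by rewrite inE => /andP[_ /vP].
by move/rowP/(_ r): v20; rewrite !mxE (negbTE rI').
Qed.

(** A zero block of the first diagonal block stays zero when the columns [J'] are added to it;
    tightness turns the bound for the whole matrix into the one for [I']. *)
Lemma hall_sub1 B I J S T (I' : {set 'I_N1}) (J' : {set 'I_N2}) :
  hall B I J -> graded_change rn gr I S -> graded_change cn gc J T ->
  I' \subset I -> J' \subset J -> (#|I'| + #|J'| = #|I|)%N ->
  (forall e r c, r \in I' -> c \in J' -> (S *m B e *m T) r c = 0) ->
  hall (fun e => S *m B e *m T) I' (J :\: J').
Proof.
move=> hB aS aT sI sJ eI z S2 T2 I2 J2 aS2 aT2 sI2 sJ2 z2.
have := hB (S2 *m S) (T *m T2) I2 (J2 :|: J').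
rewrite cardsU (_ : J2 :&: J' = finset.set0); last first.
  by apply/eqP; rewrite setI_eq0; move: sJ2; rewrite subsetD => /andP[].
rewrite cards0 subn0 -eI addnA leq_add2r; apply.
- by apply: graded_changeM => //; apply: graded_changeS aS2.
- by apply: graded_changeM => //; apply: graded_changeS aT2; apply: subsetDl.
- exact: fintype.subset_trans sI.
- by rewrite finset.subUset sJ (fintype.subset_trans sJ2) ?subsetDl.
move=> e r c rI2; rewrite -mulmxA mulmxA mulmxA.
rewrite -(mulmxA _ T T2) (mulmxA _ T T2) -(mulmxA S2 S) -(mulmxA S2 _ T).
rewrite inE => /orP[cJ2|cJ']; first exact: z2.
case: aT2 => _ _ iT2; rewrite mxE big1 // => c' _.
case: (c' =P c) => [->|/eqP nc]; last first.
  by rewrite iT2 ?inE ?cJ' ?andbF // (negbTE nc) mulr0.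
rewrite [X in X * _]mxE big1 ?mul0r // => r' _.
case: aS2 => _ _ iS2; case: (boolP (r' \in I')) => rI'.
  by rewrite z ?mulr0.
rewrite iS2 ?(negbTE rI') ?andbF //; case: (r =P r') => [e0|]; last by rewrite mul0r.
by case/negP: rI'; rewrite -e0 (fintype.subsetP sI2).
Qed.

(** Dually, the rows [I'] are added to the zero block, and their number is subtracted from both
    sides of the bound. *)
Lemma hall_sub2 B I J S T (I' : {set 'I_N1}) (J' : {set 'I_N2}) :
  hall B I J -> graded_change rn gr I S -> graded_change cn gc J T ->
  I' \subset I -> J' \subset J ->
  (forall e r c, r \in I' -> c \in J' -> (S *m B e *m T) r c = 0) ->
  hall (fun e => S *m B e *m T) (I :\: I') J'.
Proof.
move=> hB aS aT sI sJ z S2 T2 I2 J2 aS2 aT2 sI2 sJ2 z2.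
have := hB (S2 *m S) (T *m T2) (I2 :|: I') J2.
rewrite cardsU (_ : I2 :&: I' = finset.set0); last first.
  by apply/eqP; rewrite setI_eq0; move: sI2; rewrite subsetD => /andP[].
rewrite cards0 subn0 cardsD (finset.setIidPr sI) => h.
rewrite leq_subRL ?subset_leq_card // addnCA addnA h //.
- by apply: graded_changeM => //; apply: graded_changeS aS2; apply: subsetDl.
- by apply: graded_changeM => //; apply: graded_changeS aT2.
- by rewrite finset.subUset sI (fintype.subset_trans sI2) ?subsetDl.
- exact: fintype.subset_trans sJ.
move=> e r c; rewrite -mulmxA mulmxA mulmxA.
rewrite -(mulmxA _ T T2) (mulmxA _ T T2) -(mulmxA S2 S) -(mulmxA S2 _ T).
rewrite inE => /orP[rI2|rI'] cJ2; first exact: z2.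
case: aT2 => _ _ iT2; rewrite mxE big1 // => c' _.
case: (boolP (c' \in J')) => cJ'; last first.
  rewrite iT2 ?(negbTE cJ') //; case: (c' =P c) => [e0|]; last by rewrite mulr0.
  by case/negP: cJ'; rewrite e0 (fintype.subsetP sJ2).
rewrite [X in X * _]mxE big1 ?mul0r // => r' _.
case: aS2 => _ _ iS2; rewrite iS2 ?inE ?rI' //.
by case: (r =P r') => [<-|]; rewrite ?mul0r // z ?mulr0.
Qed.

(** [f] enumerates [i] first, so that the cofactor at [(ord0, ord0)] of a matrix enumerated in this
    way is a minor on [I :\ i]. *)
Lemma enum_set_cons N (I : {set 'I_N}) n i : i \in I -> #|I| = n.+1 ->
  exists (f0 : 'I_n -> 'I_N) (f : 'I_n.+1 -> 'I_N),
  [/\ injective f0, injective f, [set f0 k | k in 'I_n] = I :\ i,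
      [set f k | k in 'I_n.+1] = I & f ord0 = i /\ forall k, f (lift ord0 k) = f0 k].
Proof.
move=> iI cI; have [f0 [f0i imf0]] : exists f : 'I_n -> 'I_N,
    injective f /\ [set f k | k in 'I_n] = I :\ i.
  by apply: enum_set_ord; move: cI; rewrite (cardsD1 i) iI => -[].
exists f0, (fun k => if unlift ord0 k is Some k' then f0 k' else i).
have ni k : f0 k != i.
  have : f0 k \in I :\ i by rewrite -imf0 imset_f.
  by rewrite !inE => /andP[].
split=> //.
- move=> k k'; case: unliftP => [j ->|->]; case: unliftP => [j' ->|->] //.
  + by move/f0i=> ->.
  + by move/eqP; rewrite (negbTE (ni j)).
  + by move/esym/eqP; rewrite (negbTE (ni j')).
- apply/setP => r; apply/imsetP/idP => [[k _ ->]|rI].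
    case: unliftP => [j _|_] //.
    have : f0 j \in I :\ i by rewrite -imf0 imset_f.
    by rewrite inE => /andP[].
  case: (r =P i) => [->|/eqP ri]; first by exists ord0; rewrite ?unlift_none.
  have : r \in I :\ i by rewrite !inE ri.
  by rewrite -imf0 => /imsetP[k _ ->]; exists (lift ord0 k); rewrite ?liftK.
- by split=> [|k]; rewrite ?unlift_none ?liftK.
Qed.

(** The determinant is affine in [x e], with slope [B e i j] times the minor without row [i] and
    column [j]. The slope is the difference of the values at [x e = 1] and [x e = 0], given by [p1]
    and [p0], so it would vanish together with the determinant. *)
Lemma nonsing_generic_entry B I J e i j :
  #|I| = #|J| -> i \in I -> j \in J -> B e i j != 0 ->
  (forall r c, r \in I -> c \in J -> (r, c) != (i, j) -> B e r c = 0) ->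
  nonsing (I :\ i) (J :\ j) (generic B) -> nonsing I J (generic B).
Proof.
move=> cIJ iI jJ b0 z; case cI : #|I| cIJ => [|n] cJ.
  by move: iI; rewrite (cards0_eq cI) inE.
have [f0 [f [f0i fi imf0 imf [fz fl]]]] := enum_set_cons iI cI.
have [g0 [g [g0i gi img0 img [gz gl]]]] := enum_set_cons jJ (esym cJ).
rewrite -imf0 -img0 -imf -img => /(nonsing_det _ f0i g0i) d0.
apply/(nonsing_det _ fi gi); apply: contraNneq d0 => dM.
set M := mxsub f g _ in dM.
have fI k : f k \in I by rewrite -imf imset_f.
have gJ k : g k \in J by rewrite -img imset_f.
have zl k l : (k, l) != (ord0, ord0) -> B e (f k) (g l) = 0.
  move=> kl; rewrite z //; apply: contraNneq kl => -[ek el].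
  by apply/eqP; congr (_, _); [apply: fi|apply: gi]; rewrite ?fz ?gz.
have [p1 [p1c p1x]] := x_subst (fun e' => if e' == e then 1 else x e').
have [p0 [p0c p0x]] := x_subst (fun e' => if e' == e then 0 else x e').
have E1 k l : (k, l) != (ord0, ord0) -> p1 (M k l) = M k l.
  move=> kl; rewrite mxE genericE rmorph_sum; apply: eq_bigr => e' _.
  rewrite rmorphM /= p1c p1x; case: eqP => [->|//].
  by rewrite zl // rmorph0 !mulr0.
have E0 k l : (k, l) != (ord0, ord0) -> p0 (M k l) = M k l.
  move=> kl; rewrite mxE genericE rmorph_sum; apply: eq_bigr => e' _.
  rewrite rmorphM /= p0c p0x; case: eqP => [->|//].
  by rewrite zl // rmorph0 !mulr0.
have E10 : p1 (M ord0 ord0) = io (B e i j) + p0 (M ord0 ord0).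
  rewrite mxE fz gz genericE !rmorph_sum (bigD1 e) //= [in RHS](bigD1 e) //=.
  rewrite !rmorphM /= p1c p1x p0c p0x eqxx mul1r mul0r add0r; congr (_ + _).
  apply: eq_bigr => e' ne; rewrite !rmorphM /= p1c p1x p0c p0x.
  by rewrite (negbTE ne).
have cof (p : {rmorphism D -> D}) l :
    (forall k l, (k, l) != (ord0, ord0) -> p (M k l) = M k l) ->
    cofactor (map_mx p M) ord0 l = cofactor M ord0 l.
  move=> Ep; congr (_ * \det _); apply/matrixP => k l'.
  by rewrite ![row' _ _ _ _]mxE ![col' _ _ _ _]mxE [map_mx _ _ _ _]mxE Ep.
have mE (p : {rmorphism D -> D}) k l : map_mx p M k l = p (M k l).
  by rewrite mxE.
have /eqP := congr1 p1 dM; have /eqP := congr1 p0 dM.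
rewrite !rmorph0 -!det_map_mx (expand_det_row _ ord0) (expand_det_row _ ord0).
rewrite !big_ord_recl /= => /eqP e0 /eqP e1.
have : io (B e i j) * cofactor M ord0 ord0 = 0.
  apply: etrans e1; rewrite -[LHS]addr0 -[X in _ + X = _]e0 !cof // !mE E10 mulrDl -addrA.
  congr (_ + (_ + _)); apply: eq_bigr => l _.
  have nl : (ord0, lift ord0 l) != (ord0 : 'I_n.+1, ord0 : 'I_n.+1).
    by [].
  by rewrite !cof // !mE E1 ?E0.
move/eqP; rewrite mulf_eq0 fmorph_eq0 (negbTE b0) /= /cofactor mulf_eq0 signr_eq0.
rewrite /= => /eqP <-; apply/eqP; congr (\det _).
by apply/matrixP => k l; rewrite [LHS]mxE [RHS]mxE [RHS]mxE [RHS]mxE fl gl.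
Qed.


Definition rank_one_on B I J e := exists i j,
  [/\ i \in I, j \in J, B e i j != 0 &
      forall r c, r \in I -> c \in J -> B e r c * B e i j = B e r j * B e i c].

(** Elimination around the pivot [(i, j)]. Homogeneity makes it graded, and rank one leaves nothing
    but the pivot on [I] and [J]. *)
Lemma rank_one_reduce B I J e : homogeneous B -> rank_one_on B I J e ->
  exists S T i j, [/\ graded_change rn gr I S, graded_change cn gc J T,
    i \in I, j \in J & (S *m B e *m T) i j != 0 /\
    forall r c, r \in I -> c \in J -> (r, c) != (i, j) ->
      (S *m B e *m T) r c = 0].
Proof.
move=> hB [i [j [iI jJ b0 rk1]]].
pose u r := if (r \in I) && (r != i) then B e r j / B e i j else 0.
pose v c := if (c \in J) && (c != j) then B e i c / B e i j else 0.
have [hi hj hij] := hB _ _ _ b0.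
exists (1%:M - (\col_r u r) *m delta_mx 0 i),
       (1%:M - delta_mx j 0 *m (\row_c v c)), i, j.
have SE r c : ((1%:M - (\col_r u r) *m delta_mx 0 i) *m B e) r c =
    B e r c - u r * B e i c.
  rewrite mulmxBl mul1mx -mulmxA -rowE.
  by rewrite !mxE big_ord1 !mxE.
have STE r c : ((1%:M - (\col_r u r) *m delta_mx 0 i) *m B e *m
      (1%:M - delta_mx j 0 *m (\row_c v c))) r c =
    B e r c - u r * B e i c - (B e r j - u r * B e i j) * v c.
  rewrite mulmxBr mulmx1 (mulmxA _ (delta_mx j 0)) -colE.
  by rewrite [LHS]mxE SE; congr (_ + _); rewrite mxE [X in - X]mxE big_ord1 [col _ _ _ _]mxE SE mxE.
split=> //.
- apply: graded_change_col => // [|r]; first by rewrite /u eqxx andbF.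
  rewrite /u; case: ifP => [/andP[rI _]|_]; last by rewrite eqxx.
  rewrite mulf_eq0 negb_or => /andP[/hB[h1 h2 h3] _]; split=> //.
    by rewrite h1.
  by apply: (addIr (gc j)); rewrite h3.
- apply: graded_change_row => // [|r]; first by rewrite /v eqxx andbF.
  rewrite /v; case: ifP => [/andP[rI _]|_]; last by rewrite eqxx.
  rewrite mulf_eq0 negb_or => /andP[/hB[h1 h2 h3] _]; split=> //.
    by rewrite h2.
  by apply: (addrI (gr i)); rewrite h3.
split=> [|r c rI cJ]; rewrite STE /u /v.
  by rewrite !eqxx !andbF mul0r subr0 mulr0 subr0.
rewrite rI cJ /= xpair_eqE negb_and.
case: (r =P i) => [->|_]; case: (c =P j) => [->|_] //= _.
- by field.
- by field.
- by have := rk1 _ _ rI cJ => e1; rewrite divfK // subrr mul0r subr0;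
     apply: (mulIf b0); rewrite mul0r mulrBl e1; field.
Qed.

(** A nonzero coefficient that is not of rank one has a nonsingular 2 by 2 submatrix. Nodes have at
    most two indices, so this submatrix fills both nodes. *)
Lemma rank_two_kernel B I J e : homogeneous B -> ~ rank_one_on B I J e ->
  (exists i j, [/\ i \in I, j \in J & B e i j != 0]) ->
  [/\ #|[set r in I | rn r == src e]| = 2%N,
      #|[set c in J | cn c == tgt e]| = 2%N
    & forall v : 'rV[F]_N1, (forall r, r \notin I -> v 0 r = 0) ->
        (forall c, c \in J -> cn c = tgt e -> (v *m B e) 0 c = 0) ->
        forall r, r \in I -> rn r = src e -> v 0 r = 0].
Proof.
move=> hB nrk [i [j [iI jJ b0]]].
have [hi hj _] := hB _ _ _ b0.
have [r [c [rI cJ d0]]] : exists r c, [/\ r \in I, c \in J &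
    B e r c * B e i j != B e r j * B e i c].
  apply: boolp.contra_notP nrk => nex; exists i, j; split=> // r c rI cJ.
  by apply/eqP/negPn/negP => ne; apply: nex; exists r, c.
have ri : r != i by apply: contraNneq d0 => ->; rewrite mulrC.
have cj : c != j by apply: contraNneq d0 => ->.
have hr : rn r = src e.
  have [z|/hB[]//] := eqVneq (B e r j) 0.
  have [z'|/hB[]//] := eqVneq (B e r c) 0.
  by move: d0; rewrite z z' !mul0r eqxx.
have hc : cn c = tgt e.
  have [z|/hB[]//] := eqVneq (B e i c) 0.
  have [z'|/hB[]//] := eqVneq (B e r c) 0.
  by move: d0; rewrite z z' mulr0 mul0r eqxx.
have sr : [set i; r] \subset [set x in I | rn x == src e].
  by apply/fintype.subsetP => y; rewrite !inE => /orP[]/eqP->; rewrite ?iI ?rI ?hi ?hr eqxx.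
have sc : [set j; c] \subset [set x in J | cn x == tgt e].
  by apply/fintype.subsetP => y; rewrite !inE => /orP[]/eqP->; rewrite ?jJ ?cJ ?hj ?hc eqxx.
have fr : [set i; r] = [set x | rn x == src e].
  apply/eqP; rewrite eqEcard cards2 eq_sym ri rn_fiber andbT.
  apply: fintype.subset_trans sr _; apply/fintype.subsetP => y; rewrite !inE.
  by case/andP.
have fc : [set j; c] = [set x | cn x == tgt e].
  apply/eqP; rewrite eqEcard cards2 eq_sym cj cn_fiber andbT.
  apply: fintype.subset_trans sc _; apply/fintype.subsetP => y; rewrite !inE.
  by case/andP.
split.
- apply/eqP; rewrite eqn_leq; apply/andP; split.
    apply: leq_trans (rn_fiber (src e)); apply: subset_leq_card.
    by apply/fintype.subsetP => y; rewrite !inE => /andP[].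
  by have := subset_leq_card sr; rewrite cards2 eq_sym ri.
- apply/eqP; rewrite eqn_leq; apply/andP; split.
    apply: leq_trans (cn_fiber (tgt e)); apply: subset_leq_card.
    by apply/fintype.subsetP => y; rewrite !inE => /andP[].
  by have := subset_leq_card sc; rewrite cards2 eq_sym cj.
move=> v v0 vB.
have vBE k : (v *m B e) 0 k = v 0 i * B e i k + v 0 r * B e r k.
  rewrite mxE (bigD1 i) //= (bigD1 r) //= big1 ?addr0 // => y /andP[yi yr].
  have [->|/hB[hy _ _]] := eqVneq (B e y k) 0; first by rewrite mulr0.
  have : y \in [set i; r] by rewrite fr inE hy.
  by rewrite !inE (negbTE yi) (negbTE yr).
have := vB j jJ hj; have := vB c cJ hc; rewrite !vBE => e1 e2.
have d1 : B e r c * B e i j - B e r j * B e i c != 0 by rewrite subr_eq0.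
have vi : v 0 i = 0.
  apply: (mulIf d1); rewrite mul0r.
  have -> : v 0 i * (B e r c * B e i j - B e r j * B e i c) =
     (v 0 i * B e i j + v 0 r * B e r j) * B e r c -
     (v 0 i * B e i c + v 0 r * B e r c) * B e r j by ring.
  by rewrite e1 e2 !mul0r subr0.
have vr : v 0 r = 0.
  apply: (mulIf d1); rewrite mul0r.
  have -> : v 0 r * (B e r c * B e i j - B e r j * B e i c) =
     (v 0 i * B e i c + v 0 r * B e r c) * B e i j -
     (v 0 i * B e i j + v 0 r * B e r j) * B e i c by ring.
  by rewrite e1 e2 !mul0r subr0.
move=> y yI hy; have : y \in [set i; r] by rewrite fr inE hy.
by rewrite !inE => /orP[]/eqP->.
Qed.

Lemma nonsing_rank_two B I J : #|I| = #|J| -> homogeneous B -> hall B I J ->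
  (forall e, ~ rank_one_on B I J e) -> nonsing I J (generic B).
Proof.
move=> cIJ hB hall_ nrk.
pose active e := [exists i in I, exists j in J, B e i j != 0].
have activeP e : active e -> exists i j, [/\ i \in I, j \in J & B e i j != 0].
  by case/existsP => i /andP[iI /existsP[j /andP[jJ b0]]]; exists i, j.
have [I0|[i0 i0I]] := set_0Vmem I.
  by move=> v v0 _; apply/rowP => i; rewrite v0 ?mxE // I0 inE.
have [b0 _] : exists b : Tc, true.
  have : (0 < #|J|)%N by rewrite -cIJ card_gt0; apply/set0Pn; exists i0.
  by rewrite card_gt0 => /set0Pn[j _]; exists (cn j).
pose adj (a : Tr) (b : Tc) := [exists e, [&& active e, src e == a & tgt e == b]].
(* In the given bases, the rows at [S'] and the columns away from its neighbours form a zero block.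
   This is Hall's condition with nodes counted by their indices. *)
have hallI (S' : {set Tr}) : (#|[set r in I | rn r \in S']| <=
    #|[set c in J | cn c \in neighbours adj S']|)%N.
  have := @hall_ 1%:M 1%:M [set r in I | rn r \in S']
    [set c in J | cn c \notin neighbours adj S']
    (graded_change1 _ _ _ _) (graded_change1 _ _ _ _).
  rewrite cIJ -(cardsID [set c in J | cn c \in neighbours adj S'] J).
  rewrite (finset.setIidPr _); last by apply/fintype.subsetP => c; rewrite inE => /andP[].
  rewrite (_ : J :\: _ = [set c in J | cn c \notin neighbours adj S']); last first.
    by apply/setP => c; rewrite !inE; case: (c \in J); rewrite ?andbT ?andbF.
  rewrite leq_add2r; apply.
  - by apply/fintype.subsetP => c; rewrite inE => /andP[].
  - by apply/fintype.subsetP => c; rewrite inE => /andP[].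
  move=> e r c; rewrite mul1mx mulmx1 !inE => /andP[rI rS] /andP[cJ nc].
  apply/eqP; apply: contraNT nc => nz; have [h1 h2 _] := hB _ _ _ nz.
  apply/existsP; exists (rn r); rewrite rS /=; apply/existsP; exists e.
  rewrite h1 h2 !eqxx !andbT; apply/existsP; exists r; rewrite rI.
  by apply/existsP; exists c; rewrite cJ.
(* No row of [I] vanishes, so its node carries an active coefficient, which has rank two and needs
   both rows. Column nodes have at most two indices, so halving the count gives Hall's condition for
   nodes. *)
have row2 a : a \in rn @: I -> #|[set r in I | rn r == a]| = 2%N.
  case/imsetP => i iI ->.
  have pos : (0 < #|[set r in I | rn r \in [set rn i]]|)%N.
    by rewrite card_gt0; apply/set0Pn; exists i; rewrite !inE iI eqxx.
  have := leq_trans pos (hallI _); rewrite card_gt0 => /set0Pn[c].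
  rewrite !inE => /andP[_ /existsP[a']]; rewrite inE => /andP[/eqP->].
  case/existsP => e /and3P[/activeP ae /eqP<- _].
  by have [] := rank_two_kernel hB (nrk e) ae.
have [S' sS'|f [fi fadj]] := @marriage_in _ _ adj b0 (rn @: I) finset.setT.
  rewrite finset.setTI -(leq_pmul2r (isT : (0 < 2)%N)).
  have := hallI S'; rewrite !card_preimset_sum.
  rewrite (eq_bigr (fun=> 2%N)); last by move=> a /(fintype.subsetP sS')/row2.
  rewrite sum_nat_const => h; apply: (leq_trans h).
  rewrite -sum_nat_const; apply: leq_sum => b _.
  apply: leq_trans (cn_fiber b); apply: subset_leq_card.
  by apply/fintype.subsetP => y; rewrite !inE => /andP[].
(* Several coefficients may join the same two nodes; one is kept for each matched pair. *)
pose psi a := [pick e | [&& active e, src e == a & tgt e == f a]].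
have psiP a : a \in rn @: I -> exists e, [/\ psi a = Some e, active e, src e = a & tgt e = f a].
  move=> /fadj[_ /existsP[e he]]; rewrite /psi; case: pickP => [e'|/(_ e)].
    by case/and3P => ? /eqP ? /eqP ?; exists e'.
  by rewrite he.
(* At this point every matched pair of nodes keeps one invertible block and all other blocks vanish,
   so the determinant is not zero there. *)
pose h e : F := ((src e \in rn @: I) && (psi (src e) == Some e))%:R.
have [p [pc px]] := x_eval h.
have nsF : nonsing I J (map_mx p (generic B)).
  move=> v v0 vQ; apply/rowP => r; rewrite [RHS]mxE.
  case: (boolP (r \in I)) => rI; last exact: v0.
  have aS : rn r \in rn @: I by apply: imset_f.
  have [e [pe ae se te]] := psiP _ aS.
  have [_ _ ker] := rank_two_kernel hB (nrk e) (activeP _ ae).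
  apply: ker => // c cJ hc; rewrite -[RHS](vQ c cJ) !mxE.
  apply: eq_bigr => y _; congr (_ * _); rewrite mxE genericE rmorph_sum.
  rewrite (bigD1 e) //= rmorphM /= pc px /h se aS pe eqxx mul1r big1 ?addr0 //.
  move=> e' ne; rewrite rmorphM /= pc px /h.
  have [->|/hB[_ h2 _]] := eqVneq (B e' y c) 0; first by rewrite mulr0.
  case: andP => [[sS /eqP pe']|_]; last by rewrite mul0r.
  have [e2 [pe2 _ _ te2]] := psiP _ sS.
  move: pe2; rewrite pe' => -[e2E]; rewrite -e2E in te2.
  have : src e' = rn r by apply: fi => //; rewrite -te2 -h2 hc te.
  by move=> sE; move: pe'; rewrite sE pe => -[eE]; rewrite eE eqxx in ne.
have [f1 [f1i f1I]] := enum_set_ord (erefl #|I|).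
have [g1 [g1i g1J]] := enum_set_ord (esym cIJ).
move: nsF; rewrite -f1I -g1J => /(nonsing_det _ f1i g1i) d0.
apply/(nonsing_det _ f1i g1i); apply: contraNneq d0 => d0.
by rewrite -map_mxsub det_map_mx d0 rmorph0.
Qed.

(* Halmos and Vaughan's induction for Hall's theorem: a tight pair splits the
   matrix, and otherwise an entry of a rank-one coefficient can be removed. *)
Theorem nonsing_generic B I J :
  #|I| = #|J| -> homogeneous B -> hall B I J -> nonsing I J (generic B).
Proof.
have [n] := ubnP #|I|; elim: n B I J => // n IHn B I J ltIn cIJ hB hallB.
have [[S [T [I' [J' [aS aT sI sJ z]]]]]|notight] := boolp.pselect (exists S T I' J',
  [/\ graded_change rn gr I S, graded_change cn gc J T, I' \subset I, J' \subset J
   & [/\ forall e r c, r \in I' -> c \in J' -> (S *m B e *m T) r c = 0,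
     (#|I'| + #|J'|)%N = #|I|, (0 < #|I'|)%N & (0 < #|J'|)%N]]).
  case: z => z cI' I'0 J'0.
  apply: (nonsing_change (io := io) aS); apply: (nonsing_change_col (io := io) aT).
  rewrite -generic_mul; have hB' := homogeneous_mul hB aS aT.
  apply: (nonsing_split sI sJ).
  - exact: (@generic_zero (fun e => S *m B e *m T) I' J' z).
  - apply: IHn => //; last exact: (hall_sub1 hallB aS aT sI sJ cI' z).
    + by lia.
    + by rewrite cardsD (finset.setIidPr sJ) -cIJ -cI' addnK.
  - apply: IHn => //; last exact: (hall_sub2 hallB aS aT sI sJ z).
    + by rewrite cardsD (finset.setIidPr sI); lia.
    + by rewrite cardsD (finset.setIidPr sI) -cI' addKn.
have [[e rk1]|nrk] := boolp.pselect (exists e, rank_one_on B I J e); last first.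
  by apply: nonsing_rank_two => // e rk1; apply: nrk; exists e.
have [S [T [i [j [aS aT iI jJ [n0 z]]]]]] := rank_one_reduce hB rk1.
apply: (nonsing_change (io := io) aS); apply: (nonsing_change_col (io := io) aT).
rewrite -generic_mul; have hB' := homogeneous_mul hB aS aT.
apply: (nonsing_generic_entry cIJ iI jJ n0 z).
have cI : #|I| = #|I :\ i|.+1 by rewrite (cardsD1 i) iI.
have cJ : #|J| = #|J :\ j|.+1 by rewrite (cardsD1 j) jJ.
apply: IHn => //.
- by rewrite -ltnS -cI.
- by apply/eqP; rewrite -eqSS -cI -cJ cIJ.
move=> S2 T2 I2 J2 aS2 aT2 sI2 sJ2 z2.
have sI : I2 \subset I by rewrite (fintype.subset_trans sI2) ?subD1set.
have sJ : J2 \subset J by rewrite (fintype.subset_trans sJ2) ?subD1set.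
have leI := subset_leq_card sI2; have leJ := subset_leq_card sJ2.
have aSS : graded_change rn gr I (S2 *m S).
  by apply: graded_changeM => //; apply: graded_changeS aS2; apply: subD1set.
have aTT : graded_change cn gc J (T *m T2).
  by apply: graded_changeM => //; apply: graded_changeS aT2; apply: subD1set.
have zz e' r c : r \in I2 -> c \in J2 -> (S2 *m S *m B e' *m (T *m T2)) r c = 0.
  move=> rI2 cJ2; have := z2 e' r c rI2 cJ2.
  by rewrite !mulmxA.
(* A pair with an empty side is bounded by its cardinality. Any other pair is not tight, so its
   inequality in [hallB] is strict, which pays for the removed row. *)
have [I20|I2n0] := posnP #|I2|.
  by rewrite I20 add0n (leq_trans leJ) // -ltnS -cJ -cIJ cI.
have [J20|J2n0] := posnP #|J2|; first by rewrite J20 addn0.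
rewrite -ltnS -cI ltn_neqAle (hallB _ _ _ _ aSS aTT sI sJ zz) andbT.
apply/eqP => eI; apply: notight.
by exists (S2 *m S), (T *m T2), I2, J2.
Qed.

End LocalTheorem.

(** * Monomials of the minors *)

Section Plane.
Variable F : fieldType.
Implicit Types (u v w : 'cV[F]_2) (B : 'M[F]_2).

Definition det2 u v : F := u 0 0 * v 1 0 - u 1 0 * v 0 0.

Lemma det2C u v : det2 v u = - det2 u v.
Proof. by rewrite /det2; ring. Qed.

Lemma cV2P u v : u 0 0 = v 0 0 -> u 1 0 = v 1 0 -> u = v.
Proof.
move=> h0 h1; apply/colP => i; case: (unliftP 0 i) => [j ->|->] //.
by rewrite [j]ord1 (_ : lift 0 0 = 1) //; apply: val_inj.
Qed.

Lemma det2_expand u v w : det2 u v != 0 ->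
  w = (det2 w v / det2 u v) *: u + (det2 u w / det2 u v) *: v.
Proof.
move=> d; apply: cV2P; rewrite !mxE; apply: (mulfI d); rewrite /det2 in d *; field.
  exact: d.
exact: d.
Qed.

Lemma bilinE B u v : bilin B u v =
  u 0 0 * (B 0 0 * v 0 0 + B 0 1 * v 1 0) +
  u 1 0 * (B 1 0 * v 0 0 + B 1 1 * v 1 0).
Proof.
rewrite /bilin mxE !big_ord_recl big_ord0 !mxE !big_ord_recl !big_ord0 !mxE.
rewrite (_ : lift 0 0 = 1); last exact: val_inj.
ring.
Qed.

Lemma bilinDl B u u' v a b : bilin B (a *: u + b *: u') v = a * bilin B u v + b * bilin B u' v.
Proof. by rewrite !bilinE !mxE; ring. Qed.

Lemma bilinDr B u v v' a b : bilin B u (a *: v + b *: v') = a * bilin B u v + b * bilin B u v'.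
Proof. by rewrite !bilinE !mxE; ring. Qed.

Lemma bilin_eq0 B u u' v v' : det2 u u' != 0 -> det2 v v' != 0 ->
  bilin B u v = 0 -> bilin B u v' = 0 -> bilin B u' v = 0 -> bilin B u' v' = 0 -> B = 0.
Proof.
move=> du dv h1 h2 h3 h4.
have z w w' : bilin B w w' = 0.
  rewrite (det2_expand w du) (det2_expand w' dv) bilinDl !bilinDr h1 h2 h3 h4.
  by rewrite !mulr0 !addr0 !mulr0 !addr0.
apply/matrixP => i j; rewrite [RHS]mxE -[RHS](z (delta_mx i 0) (delta_mx j 0)).
by rewrite /bilin trmx_delta -rowE -colE !mxE.
Qed.

End Plane.

Section Minors.
Variables (F : fieldType) (mu nu : nat) (A : 'I_mu -> 'I_nu -> 'M[F]_2).

Definition frame N (U : 'I_N -> bool -> 'cV[F]_2) :=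
  forall a, det2 (U a true) (U a false) != 0.

Definition slot N := ('I_N * bool)%type.

Local Notation pol := (mpoly (mu * nu) F).
Local Notation mon := (multinom (mu * nu)).

Definition xmon (a : 'I_mu) (b : 'I_nu) : mon := mnm1 (mxvec_index a b).

Definition entry U V (i : slot mu) (j : slot nu) : F :=
  bilin (A i.1 j.1) (U i.1 i.2) (V j.1 j.2).

Definition poly_entry (h : slot mu -> slot nu -> F) i j : pol :=
  mpolyC _ (h i j) * mpolyX F (xmon i.1 j.1).

Definition minor h k (f : 'I_k -> slot mu) (g : 'I_k -> slot nu) : pol :=
  \det (\matrix_(i, j) poly_entry h (f i) (g j)).

Lemma mem_msupp_sum (I : finType) (p : I -> pol) m :
  m \in msupp (\sum_i p i) -> exists i, m \in msupp (p i).
Proof.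
rewrite mcoeff_msupp raddf_sum => /negP n0; apply/existsP.
apply: contra_notT n0 => /existsPn z; rewrite big1 // => i _.
by apply/eqP; rewrite mcoeff_eq0.
Qed.

Lemma mem_msuppCM c (p : pol) m : m \in msupp (mpolyC _ c * p) -> m \in msupp p.
Proof.
by rewrite !mcoeff_msupp mcoeffCM; apply: contraNneq => ->; rewrite mulr0.
Qed.

(** The old basis vectors are combinations of the new ones with coefficients in [F], so a monomial
    of the old minor occurs in one of the new minors of the multilinear expansion. *)
Lemma minor_change_rows U U' V k (f : 'I_k -> slot mu) g m : frame U' ->
  m \in msupp (minor (entry U V) f g) -> exists f', m \in msupp (minor (entry U' V) f' g).
Proof.
move=> fU.
pose c (i i' : slot mu) : F := if i.1 == i'.1 then
  (if i'.2 then det2 (U i.1 i.2) (U' i.1 false) else det2 (U' i.1 true) (U i.1 i.2))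
   / det2 (U' i.1 true) (U' i.1 false) else 0.
have cE i j : poly_entry (entry U V) i j = \sum_i' mpolyC _ (c i i') * poly_entry (entry U' V) i' j.
  rewrite (eq_bigr (fun i' => mpolyC _ (c i i' * entry U' V i' j) *
     mpolyX F (xmon i.1 j.1))); last first.
    move=> i' _; rewrite /poly_entry mulrA -mpolyCM /c.
    by case: eqP => [->|]; rewrite // !mul0r.
  rewrite -mulr_suml -rmorph_sum /=; congr (mpolyC _ _ * _).
  case: i => a s; rewrite -(pair_bigA _ (fun a' s' => c (a, s) (a', s') * entry U' V (a', s') j)) /=.
  rewrite (bigD1 a) //= [X in _ = _ + X]big1 ?addr0; last first.
    move=> a' aa'; rewrite big1 // => s' _; rewrite /c /= eq_sym (negbTE aa').
    by rewrite mul0r.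
  rewrite big_bool /c /entry /= eqxx [in LHS](det2_expand (U a s) (fU a)).
  by rewrite bilinDl.
rewrite /minor (_ : \matrix_(_, _) _ = \matrix_(n, j) \sum_i' mpolyC _ (c (f n) i') *
   poly_entry (entry U' V) i' (g j)); last by apply/matrixP => n j; rewrite !mxE cE.
rewrite det_sum_rows => /mem_msupp_sum[phi].
by rewrite -rmorph_prod => /mem_msuppCM h; exists phi.
Qed.

Lemma minor_change_cols U V V' k f (g : 'I_k -> slot nu) m : frame V' ->
  m \in msupp (minor (entry U V) f g) -> exists g', m \in msupp (minor (entry U V') f g').
Proof.
move=> fV.
pose c (j j' : slot nu) : F := if j.1 == j'.1 then
  (if j'.2 then det2 (V j.1 j.2) (V' j.1 false) else det2 (V' j.1 true) (V j.1 j.2))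
   / det2 (V' j.1 true) (V' j.1 false) else 0.
have cE i j : poly_entry (entry U V) i j = \sum_j' poly_entry (entry U V') i j' * mpolyC _ (c j j').
  rewrite (eq_bigr (fun j' => mpolyC _ (c j j' * entry U V' i j') *
     mpolyX F (xmon i.1 j.1))); last first.
    move=> j' _; rewrite /poly_entry mulrC mulrA -mpolyCM /c.
    by case: eqP => [->|]; rewrite // !mul0r.
  rewrite -mulr_suml -rmorph_sum /=; congr (mpolyC _ _ * _).
  case: j => b t; rewrite -(pair_bigA _ (fun b' t' => c (b, t) (b', t') * entry U V' i (b', t'))) /=.
  rewrite (bigD1 b) //= [X in _ = _ + X]big1 ?addr0; last first.
    move=> b' bb'; rewrite big1 // => s' _; rewrite /c /= eq_sym (negbTE bb').
    by rewrite mul0r.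
  rewrite big_bool /c /entry /= eqxx [in LHS](det2_expand (V b t) (fV b)).
  by rewrite bilinDr.
rewrite /minor (_ : \matrix_(_, _) _ = \matrix_(n, j) \sum_j' poly_entry (entry U V') (f n) j' *
   mpolyC _ (c (g j) j')); last by apply/matrixP => n j; rewrite !mxE cE.
rewrite det_sum_cols => /mem_msupp_sum[phi].
by rewrite -rmorph_prod => /mem_msuppCM h; exists phi.
Qed.

Definition in_minor U V k m := exists (f : 'I_k -> slot mu) (g : 'I_k -> slot nu),
  m \in msupp (minor (entry U V) f g).

Lemma in_minor_change U V U' V' k m : frame U' -> frame V' ->
  in_minor U V k m -> in_minor U' V' k m.
Proof.
move=> fU fV [f [g /(minor_change_rows fU)[f' /(minor_change_cols fV)[g' h]]]].
by exists f', g'.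
Qed.

Definition perm_mon k (f : 'I_k -> slot mu) (g : 'I_k -> slot nu) (s : {perm 'I_k}) : mon :=
  (\big[@mnm_add _/@mnm0 _]_i xmon (f i).1 (g (s i)).1)%R.

Lemma perm_monE k (f : 'I_k -> slot mu) (g : 'I_k -> slot nu) s a b :
  perm_mon f g s (mxvec_index a b) = #|[set i | ((f i).1, (g (s i)).1) == (a, b)]|.
Proof.
rewrite /perm_mon mnm_sumE -sum1_card [RHS]big_mkcond /=.
apply: eq_bigr => i _; rewrite inE mnm1E.
have -> : (mxvec_index (f i).1 (g (s i)).1 == mxvec_index a b) =
          (((f i).1, (g (s i)).1) == (a, b)).
  apply/eqP/eqP => [|[-> ->] //].
  by move/cast_ord_inj/enum_rank_inj.
by case: eqP.
Qed.

Lemma perm_mon_sum (T : zmodType) k (f : 'I_k -> slot mu) (g : 'I_k -> slot nu) s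
    (w : 'I_mu -> 'I_nu -> T) :
  \sum_a \sum_b w a b *+ perm_mon f g s (mxvec_index a b) =
  \sum_i w (f i).1 (g (s i)).1.
Proof.
rewrite [RHS](partition_big (fun i => ((f i).1, (g (s i)).1)) predT) //=.
rewrite pair_bigA /=; apply: eq_bigr => -[a b] _ /=.
rewrite perm_monE -sumr_const; apply: eq_big => i; rewrite inE //.
by move/eqP => -[-> ->].
Qed.

Lemma mcoeff_minor h k (f : 'I_k -> slot mu) (g : 'I_k -> slot nu) m :
  mcoeff m (minor h f g) = \sum_(s : {perm 'I_k})
    (-1) ^+ s * (\prod_i h (f i) (g (s i))) * (perm_mon f g s == m)%:R.
Proof.
rewrite /minor /determinant raddf_sum; apply: eq_bigr => s _ /=.
under eq_bigr => i _ do rewrite mxE.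
rewrite /poly_entry big_split /= -rmorph_prod.
have -> : \prod_i mpolyX F (xmon (f i).1 (g (s i)).1) = mpolyX F (perm_mon f g s).
  rewrite /perm_mon; elim/big_rec2: _ => [|i y1 y2 _ ->]; first by rewrite mpolyX0.
  by rewrite mpolyXD.
have -> : (-1) ^+ s = mpolyC _ ((-1) ^+ s) :> pol by rewrite rmorph_sign.
by rewrite mulrA -mpolyCM mcoeffCM mcoeffX.
Qed.


(* [N] is a nonzero transversal in the bases [U], [V] that uses [m a b] entries of
   the block [(a, b)]. *)
Definition slot_transversal U V (m : 'I_mu -> 'I_nu -> nat) (N : {set slot mu * slot nu}) :=
  [/\ {in N &, injective fst}, {in N &, injective snd},
      {in N, forall p, entry U V p.1 p.2 != 0}
    & forall a b, #|[set p in N | (p.1.1, p.2.1) == (a, b)]| = m a b].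

(** Necessary for a monomial to occur, and free of signs and cancellations; [doubled_good] verifies
    it by exhibiting transversals. *)
Definition good m := forall U V, frame U -> frame V -> exists N, slot_transversal U V m N.

Definition std_frame N (a : 'I_N) (s : bool) : 'cV[F]_2 := delta_mx (if s then 0 else 1) 0.

Lemma std_frameP N : frame (@std_frame N).
Proof. by move=> a; rewrite /det2 !mxE /= mulr1 mulr0 subr0 oner_neq0. Qed.

Lemma minor_inj h k (f : 'I_k -> slot mu) (g : 'I_k -> slot nu) :
  minor h f g != 0 -> injective f /\ injective g.
Proof.
move=> d0; split=> i j e; apply/eqP/negPn/negP => ij; case/eqP: d0.
- by apply: (determinant_alternate ij) => l; rewrite !mxE e.
- rewrite /minor -det_tr; apply: (determinant_alternate ij) => l.
  by rewrite !mxE e.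
Qed.

Lemma mem_minor_perm h k (f : 'I_k -> slot mu) (g : 'I_k -> slot nu) m :
  m \in msupp (minor h f g) -> exists s : {perm 'I_k},
    perm_mon f g s = m /\ forall i, h (f i) (g (s i)) != 0.
Proof.
rewrite mcoeff_msupp mcoeff_minor => /negP n0.
have [s] : exists s : {perm 'I_k}, (-1) ^+ s * (\prod_i h (f i) (g (s i))) *
    (perm_mon f g s == m)%:R != 0.
  apply/existsP; apply: contra_notT n0 => /existsPn z; rewrite big1 // => s _.
  by apply/eqP; have := z s; rewrite negbK.
rewrite !mulf_eq0 !negb_or => /andP[/andP[_ p0]].
case: (perm_mon f g s =P m) => [e _|_]; last by rewrite eqxx.
exists s; split=> // i; apply: contraNneq p0 => z.
by rewrite (bigD1 i) //= z mul0r.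
Qed.

Lemma in_minor_good U V k m : frame U -> frame V -> in_minor U V k m ->
  good (fun a b => m (mxvec_index a b)) /\
  \sum_a \sum_b m (mxvec_index a b) = k :> nat.
Proof.
move=> fU fV inm; split=> [U' V' fU' fV'|].
  have [f [g h]] := in_minor_change fU' fV' inm.
  have [s [ms nz]] := mem_minor_perm h.
  have [fi gi] : injective f /\ injective g.
    apply: (@minor_inj (entry U' V')).
    by apply: contraTneq h => ->; rewrite mcoeff_msupp mcoeff0 eqxx.
  pose h' i := (f i, g (s i)).
  exists [set h' i | i in 'I_k]; split.
  - by move=> _ _ /imsetP[i _ ->] /imsetP[j _ ->] /= /fi ->.
  - by move=> _ _ /imsetP[i _ ->] /imsetP[j _ ->] /= /gi/perm_inj ->.
  - by move=> _ /imsetP[i _ ->] /=; apply: nz.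
  - move=> a b; rewrite -ms perm_monE.
    have h'i : injective h' by move=> i j [/fi].
    rewrite -(card_imset _ h'i); apply: eq_card => p; rewrite inE.
    apply/andP/imsetP => [[/imsetP[i _ ->] e]|[i]].
      by exists i; rewrite // inE.
    by rewrite inE => e ->; split=> //; apply: imset_f.
case: inm => f [g /mem_minor_perm[s [<- _]]].
rewrite pair_bigA /= -[RHS]card_ord -[RHS]cardsT.
transitivity (\sum_(p in [set: 'I_mu * 'I_nu])
    #|[set i in [set: 'I_k] | ((f i).1, (g (s i)).1) == p]|)%N.
  apply: eq_big => [p|[a b] _]; rewrite ?inE //= perm_monE.
  by apply: eq_card => i; rewrite !inE.
by rewrite -card_preimset_sum; apply: eq_card => i; rewrite !inE.
Qed.


Lemma transversal_sum (T : zmodType) U V m N (w : 'I_mu -> 'I_nu -> T) :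
  slot_transversal U V m N ->
  \sum_a \sum_b w a b *+ m a b = \sum_(p in N) w p.1.1 p.2.1.
Proof.
case=> _ _ _ cN; rewrite (partition_big (fun p => (p.1.1, p.2.1)) predT) //=.
rewrite pair_bigA /=; apply: eq_bigr => -[a b] _ /=; rewrite -cN -sumr_const.
by rewrite big_mkcond [RHS]big_mkcond; apply: eq_bigr => p _; rewrite inE;
   case: ifP => // /andP[_ /eqP[-> ->]].
Qed.

Lemma transversal_card U V m N :
  slot_transversal U V m N -> #|N| = (\sum_a \sum_b m a b)%N.
Proof.
case=> _ _ _ cN; rewrite -sum1_card (partition_big (fun p => (p.1.1, p.2.1)) predT) //=.
rewrite pair_bigA /=; apply: eq_bigr => -[a b] _ /=; rewrite -cN -sum1_card.
by apply: eq_bigl => p; rewrite inE.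
Qed.

Lemma sum_inj_le (R : realDomainType) (I J : finType) (N : {set I}) (f : I -> J) (p : J -> R) :
  {in N &, injective f} -> (forall j, 0 <= p j) -> \sum_(i in N) p (f i) <= \sum_j p j.
Proof.
move=> fi p0; rewrite -(big_imset (fun j => p j) fi) /= [leRHS](bigID (mem (f @: N))) /=.
by rewrite lerDl sumr_ge0.
Qed.

Lemma transversal_weight (R : realDomainType) U V m N (d : 'I_mu -> 'I_nu -> R)
    (p : slot mu -> R) (q : slot nu -> R) c :
  slot_transversal U V m N -> (forall i, 0 <= p i) -> (forall j, 0 <= q j) ->
  (forall i j, entry U V i j != 0 -> d i.1 j.1 <= p i + q j + c) ->
  \sum_a \sum_b d a b *+ m a b <=
    \sum_i p i + \sum_j q j + (\sum_a \sum_b m a b)%:R * c.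
Proof.
move=> tN p0 q0 dpq; rewrite (transversal_sum d tN) -(transversal_card tN).
case: tN => i1 i2 nz _.
apply: le_trans (_ : \sum_(x in N) (p x.1 + q x.2 + c) <= _).
  by apply: ler_sum => x xN; apply/dpq/nz.
rewrite !big_split /= sumr_const mulr_natl lerD2r.
by apply: lerD; apply: sum_inj_le.
Qed.

End Minors.

(** * The dual optimum *)

Section PaddedSide.
Variables (F : fieldType) (n l : nat) (p : slot n -> int).

(** Slots together with [l] dummy indices. Each dummy is a node of its own, of grade zero, on which
    a graded change can only act by a scalar. *)
Definition padded : finType := (slot n + 'I_l)%type.
Definition prank (x : padded) : 'I_#|padded| := enum_rank x.

Definition pnode (i : 'I_#|padded|) : 'I_n + 'I_l :=
  match enum_val i with inl s => inl s.1 | inr y => inr y end.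

Definition pgrade (i : 'I_#|padded|) : int :=
  if enum_val i is inl s then p s else 0.

Lemma pnode_rank x :
  pnode (prank x) = match x with inl s => inl s.1 | inr y => inr y end.
Proof. by rewrite /pnode /prank enum_rankK. Qed.

Lemma pgrade_rank x : pgrade (prank x) = if x is inl s then p s else 0.
Proof. by rewrite /pgrade /prank enum_rankK. Qed.

Lemma pnode_fiber a : (#|[set i | pnode i == a]| <= 2)%N.
Proof.
pose f (i : 'I_#|padded|) := if enum_val i is inl s then s.2 else true.
have fi : {in [set i | pnode i == a] &, injective f}.
  move=> i j; rewrite !inE => /eqP <- /eqP; rewrite /pnode /f.
  move=> e1 e2; apply: enum_val_inj; move: e1 e2.
  by case: (enum_val i) => [[b s]|y]; case: (enum_val j) => [[b' s']|y'] //= [->] // ->.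
by rewrite -(card_in_imset fi) (leq_trans (max_card _)) ?card_bool.
Qed.

Variable S : 'M[F]_#|padded|.
Hypothesis aS : graded_change pnode pgrade [set: 'I_#|padded|] S.

Lemma padded_sum (V : nmodType) (G : 'I_#|padded| -> V) :
  \sum_i G i = \sum_s G (prank (inl s)) + \sum_y G (prank (inr y)).
Proof.
transitivity (\sum_(x : slot n + 'I_l) G (prank x)); last by rewrite big_sumType.
by rewrite (reindex prank) //; apply: onW_bij; exists enum_val;
  [exact: enum_rankK|exact: enum_valK].
Qed.

Lemma graded_change_row_sum a s (G : 'I_#|padded| -> F) :
  \sum_i S (prank (inl (a, s))) i * G i =
  \sum_s' S (prank (inl (a, s))) (prank (inl (a, s'))) * G (prank (inl (a, s'))).
Proof.
case: aS => _ hS _; rewrite padded_sum [X in _ + X]big1 ?addr0; last first.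
  move=> y _; have [->|/hS[]] := eqVneq (S (prank (inl (a, s))) (prank (inr y))) 0.
    by rewrite mul0r.
  by rewrite !pnode_rank.
transitivity (\sum_a' \sum_s' S (prank (inl (a, s))) (prank (inl (a', s'))) *
    G (prank (inl (a', s')))); first by rewrite pair_bigA; apply: eq_bigr => -[].
rewrite (bigD1 a) //= [X in _ + X]big1 ?addr0 // => a' aa'.
rewrite big1 // => s' _.
have [->|/hS[+ _]] := eqVneq (S (prank (inl (a, s))) (prank (inl (a', s')))) 0.
  by rewrite mul0r.
by rewrite !pnode_rank /= => -[e]; rewrite e eqxx in aa'.
Qed.

Lemma graded_change_nz i : exists i', S i i' != 0.
Proof.
case: aS => uS _ _; case: (pickP (fun i' => S i i' != 0)) => [i' nz|z].
  by exists i'.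
have := mulmxV uS => /matrixP/(_ i i); rewrite !mxE eqxx big1.
  by move/esym/eqP; rewrite oner_eq0.
by move=> k _; have /negbFE/eqP -> := z k; rewrite mul0r.
Qed.

Lemma graded_change_slot a s : exists s',
  S (prank (inl (a, s))) (prank (inl (a, s'))) != 0 /\ p (a, s') = p (a, s).
Proof.
case: aS => _ hS _; have [i' nz] := graded_change_nz (prank (inl (a, s))).
have [+ +] := hS _ _ nz; rewrite -(enum_valK i') -/(prank _) in nz *.
rewrite !pnode_rank !pgrade_rank; case: (enum_val i') nz => [[a' s']|y] //= nz.
by move=> [e1] e2; rewrite -e1 in nz e2; exists s'.
Qed.

Lemma graded_change_dummy y i' : S (prank (inr y)) i' != 0 -> i' = prank (inr y).
Proof.
case: aS => _ hS _ /hS[+ _]; rewrite -(enum_valK i') -/(prank _) !pnode_rank.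
by case: (enum_val i') => [[a' s']|y'] //= [->].
Qed.

Lemma graded_change_dummy_nz y : S (prank (inr y)) (prank (inr y)) != 0.
Proof.
have [i' nz] := graded_change_nz (prank (inr y)).
by have := nz; rewrite (graded_change_dummy nz).
Qed.

Variable U : 'I_n -> bool -> 'cV[F]_2.

Definition change_frame a s : 'cV[F]_2 :=
  \sum_s' S (prank (inl (a, s))) (prank (inl (a, s'))) *: U a s'.

(** In the rows of a node, [S] vanishes outside its two slots, so [S *m invmx S = 1] restricts to
    the 2 by 2 block of the node and its determinant is not zero. *)
Lemma change_frameP : frame U -> frame change_frame.
Proof.
move=> fU a; rewrite /change_frame !big_bool /=.
set x1 := S _ _; set x2 := S _ _; set x3 := S _ _; set x4 := S _ _.
have -> : det2 (x1 *: U a true + x2 *: U a false) (x3 *: U a true + x4 *: U a false) =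
    (x1 * x4 - x2 * x3) * det2 (U a true) (U a false).
  by rewrite /det2 !mxE; ring.
rewrite mulf_neq0 //; apply/eqP => d0; case: (aS) => uS _ _.
have E s s' : \sum_t S (prank (inl (a, s))) (prank (inl (a, t))) *
     invmx S (prank (inl (a, t))) (prank (inl (a, s'))) = (s == s')%:R.
  rewrite -(graded_change_row_sum a s (fun i => invmx S i (prank (inl (a, s'))))).
  have := mulmxV uS => /matrixP/(_ (prank (inl (a, s))) (prank (inl (a, s')))).
  by rewrite !mxE (inj_eq enum_rank_inj) => ->; rewrite /eq_op /= xpair_eqE eqxx.
have := E true true; have := E true false; have := E false true; have := E false false.
rewrite !big_bool /= -/x1 -/x2 -/x3 -/x4.
set y1 := invmx S _ _; set y2 := invmx S _ _; set y3 := invmx S _ _; set y4 := invmx S _ _.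
move=> e1 e2 e3 e4; have /eqP := oner_neq0 F; apply.
have -> : (1 : F) = 1%:R * 1%:R - 0%:R * 0%:R by rewrite mulr0 subr0 mulr1.
rewrite -{1}e1 -{1}e4 -{1}e2 -e3.
transitivity ((x1 * x4 - x2 * x3) * (y3 * y2 - y4 * y1)); last by rewrite d0 mul0r.
by ring.
Qed.

End PaddedSide.

Lemma graded_change_tr (F : fieldType) N (T : eqType) (nd : 'I_N -> T) gr I (S : 'M[F]_N) :
  graded_change nd gr I S -> graded_change nd gr I S^T.
Proof.
move=> [uS hS iS]; split=> [|r r'|r r' nI]; rewrite ?unitmx_tr // mxE.
- by case/hS.
- by rewrite andbC in nI; rewrite iS // eq_sym.
Qed.

Lemma mulmx3E (R : comNzRingType) m1 m2 m3 m4 (S : 'M[R]_(m1, m2)) (B : 'M_(m2, m3))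
    (T : 'M_(m3, m4)) i j :
  (S *m B *m T) i j = \sum_i' S i i' * \sum_j' T^T j j' * B i' j'.
Proof.
rewrite -mulmxA mxE; apply: eq_bigr => i' _; rewrite mxE; congr (_ * _).
by apply: eq_bigr => j' _; rewrite mxE mulrC.
Qed.

Lemma sumr_neq0 (V : nmodType) (I : finType) (G : I -> V) :
  \sum_i G i != 0 -> exists i, G i != 0.
Proof.
move=> /negP n0; apply/existsP; apply: contra_notT n0 => /existsPn z.
by rewrite big1 // => i _; apply/eqP; have := z i; rewrite negbK.
Qed.

Lemma sum_mem_card (I : finType) (X : {set I}) :
  \sum_i (i \in X)%:Z = #|X|%:Z.
Proof.
rewrite -[#|X|]sum1_card -natz natr_sum [RHS]big_mkcond /=.
by apply: eq_bigr => i _; case: ifP.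
Qed.

Section Duality.
Variables (F : fieldType) (mu nu : nat) (A : 'I_mu -> 'I_nu -> 'M[F]_2).
Variables (d : 'I_mu -> 'I_nu -> int) (k : nat).

Definition feasible U V (p : slot mu -> int) (q : slot nu -> int) c :=
  [/\ frame U, frame V, forall i, 0 <= p i, forall j, 0 <= q j &
      forall i j, entry A U V i j != 0 -> d i.1 j.1 <= p i + q j + c].

Definition dual_value (p : slot mu -> int) (q : slot nu -> int) (c : int) : int :=
  \sum_i p i + \sum_j q j + k%:Z * c.

Local Notation lr := (nu * 2 - k)%N.
Local Notation lc := (mu * 2 - k)%N.

Definition padded_edge : finType :=
  ('I_mu * 'I_nu + (slot mu * 'I_lc + slot nu * 'I_lr))%type.

Section Optimum.
Variables (U : 'I_mu -> bool -> 'cV[F]_2) (V : 'I_nu -> bool -> 'cV[F]_2).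
Variables (p : slot mu -> int) (q : slot nu -> int) (c : int).
Hypothesis feas : feasible U V p q c.
Hypothesis opt : forall U' V' p' q' c', feasible U' V' p' q' c' ->
  dual_value p q c <= dual_value p' q' c'.

Definition tight_entry (s : slot mu) (t : slot nu) : F :=
  if d s.1 t.1 == p s + q t + c then entry A U V s t else 0.

(* The tight entries, bordered by [lr] rows and [lc] columns that are generic on the
   slots of zero potential: a perfect transversal of the bordered matrix leaves
   [k] rows and columns, among them all those of positive potential. *)
Definition padded_coef (e : padded_edge) (x : padded mu lr) (y : padded nu lc) : F :=
  match e, x, y with
  | inl ab, inl s, inl t => if (s.1, t.1) == ab then tight_entry s t else 0
  | inr (inl sl), inl s, inr l => ((s, l) == sl)%:R * (p s == 0)%:R
  | inr (inr tl), inr l, inl t => ((t, l) == tl)%:R * (q t == 0)%:R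
  | _, _, _ => 0
  end.

Definition padded_src (e : padded_edge) : 'I_mu + 'I_lr :=
  match e with
  | inl ab => inl ab.1 | inr (inl sl) => inl sl.1.1 | inr (inr tl) => inr tl.2
  end.
Definition padded_tgt (e : padded_edge) : 'I_nu + 'I_lc :=
  match e with
  | inl ab => inl ab.2 | inr (inl sl) => inr sl.2 | inr (inr tl) => inl tl.1.1
  end.
Definition padded_weight (e : padded_edge) : int :=
  if e is inl ab then d ab.1 ab.2 - c else 0.

Definition padded_mx (e : padded_edge) : 'M[F]_(#|padded mu lr|, #|padded nu lc|) :=
  \matrix_(i, j) padded_coef e (enum_val i) (enum_val j).

Lemma padded_mxE e x y : padded_mx e (prank x) (prank y) = padded_coef e x y.
Proof. by rewrite mxE !enum_rankK. Qed.

Lemma padded_homogeneous : homogeneous (@pnode mu lr) (@pnode nu lc)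
  (pgrade p) (pgrade q) padded_src padded_tgt padded_weight padded_mx.
Proof.
move=> e i j; rewrite mxE /pnode /pgrade.
case: e => [[a b]|[[s0 l0]|[t0 l0]]]; case: (enum_val i) => [s|l];
  case: (enum_val j) => [t|l'] //=; rewrite ?eqxx //.
- rewrite /tight_entry; case: ((s.1, t.1) =P _) => [[<- <-]|]; last by rewrite eqxx.
  case: (d s.1 t.1 =P _) => [->|_]; last by rewrite eqxx.
  by move=> _; split=> //; rewrite addrK.
- case: ((s, l') =P _) => [[<- <-]|]; last by rewrite mul0r eqxx.
  by case: (p s =P 0) => [->|_]; rewrite ?mulr0 ?eqxx // addr0.
- case: ((t, l) =P _) => [[<- <-]|]; last by rewrite mul0r eqxx.
  by case: (q t =P 0) => [->|_]; rewrite ?mulr0 ?eqxx // addr0.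
Qed.

Lemma card_slot n : #|{: slot n}| = (n * 2)%N.
Proof. by rewrite card_prod card_ord card_bool. Qed.

Lemma sum_slot_const n (z : int) : \sum_(s : slot n) z = z * (n * 2)%:Z.
Proof. by rewrite sumr_const card_slot -mulr_natr natz. Qed.

Lemma shift_feasible (zr zc : bool) :
  feasible U V (fun s => p s + zr%:Z) (fun t => q t + zc%:Z) (c - zr%:Z - zc%:Z).
Proof.
case: feas => fU fV p0 q0 dpq; split=> // [i|j|i j nz].
- by have := p0 i; lia.
- by have := q0 j; lia.
- by have := dpq i j nz; lia.
Qed.

(** Raising all row potentials by one while lowering [c] by one changes the dual value by
    [mu * 2 - k], which cannot be negative at an optimum; similarly for columns. *)
Lemma optimum_size : (k <= mu * 2)%N /\ (k <= nu * 2)%N.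
Proof.
split.
- have := opt (shift_feasible true false); rewrite /dual_value /= !big_split /=.
  rewrite !sum_slot_const !mulrBr mul1r mul0r mulr1 mulr0.
  by move: (\sum_i p i) (\sum_j q j) (k%:Z * c) => x y z; lia.
- have := opt (shift_feasible false true); rewrite /dual_value /= !big_split /=.
  rewrite !sum_slot_const !mulrBr mul1r mul0r mulr1 mulr0.
  by move: (\sum_i p i) (\sum_j q j) (k%:Z * c) => x y z; lia.
Qed.

Lemma card_padded n l : #|padded n l| = (n * 2 + l)%N.
Proof. by rewrite card_sum card_slot card_ord. Qed.

Lemma card_padded_set n l (X : {set 'I_#|padded n l|}) :
  #|X| = (#|[set s | prank (inl s) \in X]| + #|[set y | prank (inr y) \in X]|)%N.
Proof.
rewrite -!sum1_card (reindex (@prank n l)) /=; last first.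
  by apply: onW_bij; exists enum_val; [exact: enum_rankK|exact: enum_valK].
by rewrite big_sumType /=; congr (_ + _)%N; apply: eq_bigl => i; rewrite inE.
Qed.

Lemma entry_change (S : 'M[F]_#|padded mu lr|) (T : 'M[F]_#|padded nu lc|) a s b t :
  entry A (change_frame S U) (change_frame T V) (a, s) (b, t) =
  \sum_s' S (prank (inl (a, s))) (prank (inl (a, s'))) *
    \sum_t' T (prank (inl (b, t))) (prank (inl (b, t'))) *
      entry A U V (a, s') (b, t').
Proof.
rewrite /entry /change_frame /= !big_bool /= bilinDl !bilinDr.
by ring.
Qed.


(** In the bases of the zero block, lower the potentials of its slots by one and raise [c] by one.
    Only constraints with both slots in the block get stronger, and there no nonzero entry is tight.
    Optimality of the old solution then bounds the size of the block. *)
Lemma padded_hall : hall (@pnode mu lr) (@pnode nu lc) (pgrade p) (pgrade q)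
  padded_mx [set: 'I_#|padded mu lr|] [set: 'I_#|padded nu lc|].
Proof.
move=> S T I J aS /graded_change_tr aT _ _ z.
have {z}z e i j : i \in I -> j \in J ->
    \sum_i' S i i' * \sum_j' T^T j j' * padded_mx e i' j' = 0.
  by move=> iI jJ; rewrite -mulmx3E z.
set T' := T^T in aT z.
case: feas => fU fV p0 q0 dpq.
pose Ir := [set s : slot mu | prank (inl s) \in I].
pose Jc := [set t : slot nu | prank (inl t) \in J].
pose Id := [set y | prank (inr y) \in I].
pose Jd := [set y | prank (inr y) \in J].
pose zr := [exists s in Ir, p s == 0].
pose zc := [exists t in Jc, q t == 0].
have [_ hS _] := aS; have [_ hT _] := aT.
(* A row slot of potential zero meets each dummy column through an indeterminate of its own, so the
   block contains no dummy column. *)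
have Jd0 : zr -> Jd = finset.set0.
  case/existsP => -[a s]; rewrite inE => /andP[sI /eqP ps].
  apply/setP => y; rewrite !inE; apply/negP => yJ.
  have [s' [nS ps']] := graded_change_slot aS a s.
  have := z (inr (inl ((a, s'), y))) _ _ sI yJ.
  rewrite (graded_change_row_sum aS a s).
  rewrite (bigD1 s') //= [X in _ + X]big1 ?addr0 => [|s2 ns2]; last first.
    rewrite big1 ?mulr0 // => j' _; rewrite -(enum_valK j') -/(prank _) padded_mxE /=.
    case: (enum_val j') => [t|y']; rewrite ?mulr0 //.
    by rewrite !xpair_eqE (negbTE ns2) andbF mul0r mulr0.
  rewrite (bigD1 (prank (inr y))) //= [X in _ + X]big1 ?addr0 => [|j' nj]; last first.
    have [->|/(graded_change_dummy aT) ej] := eqVneq (T' (prank (inr y)) j') 0.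
      by rewrite mul0r.
    by rewrite ej eqxx in nj.
  rewrite padded_mxE /= !eqxx ps' ps eqxx !mulr1 => /eqP.
  by rewrite mulf_eq0 (negbTE nS) (negbTE (graded_change_dummy_nz aT y)).
have Id0 : zc -> Id = finset.set0.
  case/existsP => -[b t]; rewrite inE => /andP[tJ /eqP qt].
  apply/setP => y; rewrite !inE; apply/negP => yI.
  have [t' [nT qt']] := graded_change_slot aT b t.
  have := z (inr (inr ((b, t'), y))) _ _ yI tJ.
  rewrite (bigD1 (prank (inr y))) //= [X in _ + X]big1 ?addr0 => [|j' nj]; last first.
    have [->|/(graded_change_dummy aS) ej] := eqVneq (S (prank (inr y)) j') 0.
      by rewrite mul0r.
    by rewrite ej eqxx in nj.
  rewrite (graded_change_row_sum aT b t).
  rewrite (bigD1 t') //= [X in _ + X]big1 ?addr0 => [|t2 nt2]; last first.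
    by rewrite padded_mxE /= !xpair_eqE (negbTE nt2) andbF mul0r mulr0.
  rewrite padded_mxE /= !eqxx qt' qt eqxx !mulr1 => /eqP.
  by rewrite mulf_eq0 (negbTE nT) (negbTE (graded_change_dummy_nz aS y)).
(* When the block contains a slot of potential zero, its whole side is raised by one and [c] lowered
   by one, which restores nonnegativity and leaves the sums unchanged. *)
have feas' : feasible (change_frame S U) (change_frame T' V)
    (fun s => p s + (zr%:Z - (s \in Ir)%:Z)) (fun t => q t + (zc%:Z - (t \in Jc)%:Z))
    (c + 1 - zr%:Z - zc%:Z).
  split; [exact: (change_frameP aS)|exact: (change_frameP aT)| | |].
  - move=> s; have := p0 s; case: (boolP (s \in Ir)) => sI; last by lia.
    have [zrT|] := boolP zr; first by lia.
    by move/existsPn/(_ s); rewrite sI /=; lia.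
  - move=> t; have := q0 t; case: (boolP (t \in Jc)) => tJ; last by lia.
    have [zcT|] := boolP zc; first by lia.
    by move/existsPn/(_ t); rewrite tJ /=; lia.
  move=> [a s] [b t] nz /=.
  have := nz; rewrite entry_change => /sumr_neq0[s'].
  rewrite mulf_eq0 negb_or => /andP[nS /sumr_neq0[t']].
  rewrite mulf_eq0 negb_or => /andP[nT /dpq /= le].
  have pE s2 : S (prank (inl (a, s))) (prank (inl (a, s2))) != 0 -> p (a, s2) = p (a, s).
    by move=> /hS[_]; rewrite !pgrade_rank.
  have qE t2 : T' (prank (inl (b, t))) (prank (inl (b, t2))) != 0 -> q (b, t2) = q (b, t).
    by move=> /hT[_]; rewrite !pgrade_rank.
  rewrite (pE _ nS) (qE _ nT) in le.
  have [/andP[sI tJ]|] := boolP (((a, s) \in Ir) && ((b, t) \in Jc)); last by lia.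
  suff : d a b != p (a, s) + q (b, t) + c by rewrite sI tJ; lia.
  apply: contraNneq nz => dE; rewrite entry_change.
  rewrite !inE in sI tJ; rewrite -[X in _ == X](z (inl (a, b)) _ _ sI tJ).
  rewrite (graded_change_row_sum aS a s); apply/eqP; apply: eq_bigr => s2 _.
  have [->|nS2] := eqVneq (S (prank (inl (a, s))) (prank (inl (a, s2)))) 0.
    by rewrite !mul0r.
  congr (_ * _); rewrite (graded_change_row_sum aT b t); apply: eq_bigr => t2 _.
  have [->|nT2] := eqVneq (T' (prank (inl (b, t))) (prank (inl (b, t2)))) 0.
    by rewrite !mul0r.
  by rewrite padded_mxE /= eqxx /tight_entry /= (pE _ nS2) (qE _ nT2) dE eqxx.
(* On each side either all dummies may belong to the block, or there are none and the dual value has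
   gained just as much from the raise, [lc] for rows and [lr] for columns. All four cases add up to
   the number of rows. *)
have := opt feas'; rewrite /dual_value !big_split /= !sumrN !sum_slot_const !sum_mem_card.
have cT : #|[set: 'I_#|padded mu lr|]| = (mu * 2 + (nu * 2 - k))%N.
  by rewrite cardsT card_ord card_padded.
rewrite cT (card_padded_set I) (card_padded_set J) -/Ir -/Id -/Jc -/Jd.
have hId : (#|Id| <= if zc then 0 else lr)%N.
  case: ifP => [/Id0 ->|_]; first by rewrite cards0.
  by rewrite (leq_trans (max_card _)) ?card_ord.
have hJd : (#|Jd| <= if zr then 0 else lc)%N.
  case: ifP => [/Jd0 ->|_]; first by rewrite cards0.
  by rewrite (leq_trans (max_card _)) ?card_ord.
have [k1 k2] := optimum_size.
move: hId hJd.
move: (#|Ir|) (#|Id|) (#|Jc|) (#|Jd|) => n1 n2 n3 n4.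
rewrite !mulrDr !mulrN !mulr1.
move: (\sum_i p i) (\sum_j q j) (k%:Z * c) => x1 x2 x3.
by case: (zr); case: (zc) => /=; rewrite ?mulr0 ?mul0r ?mul1r ?mulr1; lia.
Qed.

End Optimum.
End Duality.

Section Variables.
Variables (F : fieldType) (E : finType).

Definition evar (e : E) : mpoly #|E| F := mpolyX F (mnm1 (enum_rank e)).

Lemma evar_subst (h : E -> mpoly #|E| F) :
  exists phi : {rmorphism mpoly #|E| F -> mpoly #|E| F},
  (forall c, phi (mpolyC _ c) = mpolyC _ c) /\ (forall e, phi (evar e) = h e).
Proof.
exists (mmap (@mpolyC #|E| F) (fun i => h (enum_val i))); split=> [c|e].
  exact: mmapC.
by rewrite /= mmapX mmap1U enum_rankK.
Qed.

Lemma evar_eval (h : E -> F) :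
  exists phi : {rmorphism mpoly #|E| F -> F},
  (forall c, phi (mpolyC _ c) = c) /\ (forall e, phi (evar e) = h e).
Proof.
exists (mmap idfun (fun i => h (enum_val i))); split=> [c|e].
  exact: mmapC.
by rewrite /= mmapX mmap1U enum_rankK.
Qed.

End Variables.

(** * From the bordered determinant to a minor of size [k] *)

Section Border.
Variables (D : idomainType) (mu nu k : nat).
Hypotheses (k_mu : (k <= mu * 2)%N) (k_nu : (k <= nu * 2)%N).
Local Notation lr := (nu * 2 - k)%N.
Local Notation lc := (mu * 2 - k)%N.
Variables (a : slot mu -> slot nu -> D).
Variables (y : slot mu -> 'I_lc -> D) (z : 'I_lr -> slot nu -> D).

Definition border (r : padded mu lr) (c : padded nu lc) : D :=
  match r, c with
  | inl s, inl t => a s t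
  | inl s, inr l => y s l
  | inr l, inl t => z l t
  | inr _, inr _ => 0
  end.

Local Notation full := (slot mu + slot nu)%type.
(** The matrix [a] bordered by identities, one extra column per row slot and one extra row per
    column slot. The generic border arises from it by multiplication on both sides. *)
Let G (r : full) (c : slot nu + slot mu) : D :=
  match r, c with
  | inl s, inl t => a s t
  | inl s, inr s' => (s == s')%:R
  | inr t, inl t' => (t == t')%:R
  | inr _, inr _ => 0
  end.

Lemma sum_delta_l (I : finType) (x : I) (H : I -> D) : \sum_x' (x == x')%:R * H x' = H x.
Proof.
rewrite (bigD1 x) //= eqxx mul1r big1 ?addr0 // => x' nx.
by rewrite eq_sym (negbTE nx) mul0r.
Qed.

Lemma sum_delta_r (I : finType) (x : I) (H : I -> D) : \sum_x' H x' * (x' == x)%:R = H x.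
Proof.
rewrite (bigD1 x) //= eqxx mulr1 big1 ?addr0 // => x' nx.
by rewrite (negbTE nx) mulr0.
Qed.

Lemma sum_image_sum (I S T : finType) (phi : I -> S + T) (H : S + T -> D) :
  injective phi -> (forall s, exists i, phi i = inl s) ->
  \sum_i H (phi i) = \sum_s H (inl s) + \sum_(t | inr t \in codom phi) H (inr t).
Proof.
move=> ip sp; rewrite -(big_imset H (in2W ip)) /= big_mkcond big_sumType /=.
congr (_ + _).
  apply: eq_bigr => s _; have [i <-] := sp s; by rewrite imset_f.
rewrite [RHS]big_mkcond /=; apply: eq_bigr => t _.
rewrite (_ : (inr t \in [set phi i | i in I]) = (inr t \in codom phi)) //.
apply/imsetP/codomP => [[i _ ->]|[i ->]]; by exists i.
Qed.

Lemma card_image_sum (I S T : finType) (phi : I -> S + T) :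
  injective phi -> (forall s, exists i, phi i = inl s) ->
  #|I| = (#|S| + #|[set t | inr t \in codom phi]|)%N.
Proof.
move=> ip sp; rewrite -(card_codom ip) -!sum1_card big_mkcond big_sumType /=.
congr (_ + _)%N.
  by rewrite sum1_card -sum1_card; apply: eq_bigr => s _; have [i <-] := sp s; rewrite codom_f.
by rewrite [RHS]big_mkcond /=; apply: eq_bigr => t _; rewrite inE.
Qed.

(** As [border] factors as [L *m G *m K], expanding twice gives a nonzero minor of [G]. Each
    identity row or column in it deletes a slot, and [k] slots remain on either side. The nonzero
    factors from [L] and [K] are the entries of [z] and [y] at the deleted slots. *)
Lemma border_minor n (row : 'I_n -> padded mu lr) (col : 'I_n -> padded nu lc) :
  bijective row -> bijective col -> \det (\matrix_(i, j) border (row i) (col j)) != 0 ->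
  exists (f : 'I_k -> slot mu) (g : 'I_k -> slot nu),
  [/\ injective f, injective g, \det (\matrix_(i, j) a (f i) (g j)) != 0,
      forall s, s \notin codom f -> exists l, y s l != 0
    & forall t, t \notin codom g -> exists l, z l t != 0].
Proof.
move=> br bc d0.
pose L (r : padded mu lr) (r' : full) : D :=
  match r, r' with
  | inl s, inl s' => (s == s')%:R
  | inr l, inr t => z l t
  | _, _ => 0
  end.
pose K (c' : slot nu + slot mu) (c : padded nu lc) : D :=
  match c', c with
  | inl t, inl t' => (t == t')%:R
  | inr s, inr l => y s l
  | _, _ => 0
  end.
pose M1 (r' : full) (c : padded nu lc) : D :=
  match r', c with
  | inl s, c => border (inl s) c
  | inr t, inl t' => (t == t')%:R
  | inr _, inr _ => 0
  end.
have E1 r c : border r c = \sum_r' L r r' * M1 r' c.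
  rewrite big_sumType /=; case: r => [s|l] /=.
    by rewrite sum_delta_l [X in _ + X]big1 ?addr0 // => t _; rewrite mul0r.
  rewrite big1 ?add0r => [|s _]; last by rewrite mul0r.
  case: c => [t|l'] /=; first by rewrite sum_delta_r.
  by rewrite big1 // => t _; rewrite mulr0.
have E2 r c : M1 r c = \sum_c' G r c' * K c' c.
  rewrite big_sumType /=; case: r => [s|t]; case: c => [t'|l] /=.
  - by rewrite sum_delta_r [X in _ + X]big1 ?addr0 // => t _; rewrite mulr0.
  - by rewrite big1 ?add0r ?sum_delta_l // => t _; rewrite mulr0.
  - by rewrite sum_delta_r [X in _ + X]big1 ?addr0 // => s _; rewrite mulr0.
  - by rewrite !big1 ?addr0 // => s _; rewrite ?mul0r ?mulr0.
have : \det (\matrix_(i, j) \sum_r' L (row i) r' * M1 r' (col j)) != 0.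
  by apply: contraNneq d0 => d0; rewrite -[X in _ == X]d0; apply/eqP; congr (\det _);
     apply/matrixP => i j; rewrite !mxE E1.
rewrite (det_sum_rows (fun i => L (row i)) (fun r' j => M1 r' (col j))).
move=> /sumr_neq0[phi]; rewrite mulf_eq0 negb_or => /andP[Lphi].
rewrite (_ : \matrix_(_, _) _ = \matrix_(i, j) \sum_c' G (phi i) c' * K c' (col j)); last first.
  by apply/matrixP => i j; rewrite !mxE E2.
rewrite (det_sum_cols (fun c' j => K c' (col j)) (fun i c' => G (phi i) c')).
move=> /sumr_neq0[psi]; rewrite mulf_eq0 negb_or => /andP[Kpsi dG].
have phiP i : match row i with inl s => phi i = inl s
    | inr l => exists t, phi i = inr t /\ z l t != 0 end.
  have : L (row i) (phi i) != 0.
    by apply: contraNneq Lphi => h; rewrite (bigD1 i) //= h mul0r.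
  case: (row i) => [s|l]; case: (phi i) => [s'|t] /=; rewrite ?eqxx //.
    by case: (s =P s') => [->//|_]; rewrite eqxx.
  by exists t.
have psiP j : match col j with inl t => psi j = inl t
    | inr l => exists s, psi j = inr s /\ y s l != 0 end.
  have : K (psi j) (col j) != 0.
    by apply: contraNneq Kpsi => h; rewrite (bigD1 j) //= h mul0r.
  case: (col j) => [t|l]; case: (psi j) => [t'|s] /=; rewrite ?eqxx //.
    by case: (t' =P t) => [->//|_]; rewrite eqxx.
  by exists s.
have phi_inj : injective phi.
  move=> i i' e; apply/eqP/negPn/negP => ne; case/eqP: dG.
  by apply: (determinant_alternate ne) => l; rewrite !mxE e.
have psi_inj : injective psi.
  move=> i i' e; apply/eqP/negPn/negP => ne; case/eqP: dG.
  by rewrite -det_tr; apply: (determinant_alternate ne) => l; rewrite !mxE e.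
have phi_sur s : exists i, phi i = inl s.
  have [row' rowK row'K] := br; exists (row' (inl s)).
  by have := phiP (row' (inl s)); rewrite row'K.
have psi_sur t : exists i, psi i = inl t.
  have [col' colK col'K] := bc; exists (col' (inl t)).
  by have := psiP (col' (inl t)); rewrite col'K.
have cn1 : n = (mu * 2 + lr)%N by rewrite -(card_padded mu) -(bij_eq_card br) card_ord.
have cn2 : n = (nu * 2 + lc)%N by rewrite -(card_padded nu) -(bij_eq_card bc) card_ord.
pose J0 := [set t | inr t \notin codom phi].
pose I0 := [set s | inr s \notin codom psi].
have cJ0 : #|J0| = k.
  have := card_image_sum phi_inj phi_sur; rewrite card_ord card_slot => h.
  have e2 : #|[set t : slot nu | inr t \in codom phi]| = lr := addnI (etrans (esym h) cn1).
  have := cardsC [set t : slot nu | inr t \in codom phi]; rewrite card_slot e2.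
  rewrite (_ : ~: _ = J0); last by apply/setP => t; rewrite !inE.
  by move: (#|J0|) => x; lia.
have cI0 : #|I0| = k.
  have := card_image_sum psi_inj psi_sur; rewrite card_ord card_slot => h.
  have e2 : #|[set t : slot mu | inr t \in codom psi]| = lc := addnI (etrans (esym h) cn2).
  have := cardsC [set t : slot mu | inr t \in codom psi]; rewrite card_slot e2.
  rewrite (_ : ~: _ = I0); last by apply/setP => t; rewrite !inE.
  by move: (#|I0|) => x; lia.
pose f (i : 'I_k) : slot mu := enum_val (cast_ord (esym cI0) i).
pose g (j : 'I_k) : slot nu := enum_val (cast_ord (esym cJ0) j).
have fi : injective f by move=> i j /enum_val_inj/cast_ord_inj.
have gi : injective g by move=> i j /enum_val_inj/cast_ord_inj.
have fI i : f i \in I0 by exact: enum_valP.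
have gP t : inr t \notin codom phi -> exists j, t = g j.
  move=> tJ; have tJ0 : t \in J0 by rewrite inE.
  exists (cast_ord cJ0 (enum_rank_in tJ0 t)).
  by rewrite /g cast_ord_comp cast_ord_id enum_rankK_in.
have fP s : inr s \notin codom psi -> exists j, s = f j.
  move=> sI; have sI0 : s \in I0 by rewrite inE.
  exists (cast_ord cI0 (enum_rank_in sI0 s)).
  by rewrite /f cast_ord_comp cast_ord_id enum_rankK_in.
exists f, g; split=> // [|s sf|t tg].
(* A left kernel vector of the minor of [a] extends to one of the minor of [G]: by zero on the
   deleted row slots, and by the negated product with [a] on the identity rows. *)
- apply/negP => /det0P[v nv va].
  pose vs s := \sum_(i | f i == s) v 0 i.
  have vsf i : vs (f i) = v 0 i.
    by rewrite /vs (big_pred1 i) // => i'; rewrite /= (inj_eq fi).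
  pose H c (x : full) : D := match x with
    | inl s => vs s * G (inl s) c
    | inr t => - (\sum_s vs s * a s t) * G (inr t) c end.
  pose w : 'rV[D]_n := \row_i match phi i with
    | inl s => vs s | inr t => - (\sum_s vs s * a s t) end.
  case/negP: dG; apply/det0P; exists w.
    apply: contraNneq nv => w0; apply/eqP/rowP => i; rewrite mxE -vsf.
    have [i' ei'] := phi_sur (f i); move/rowP/(_ i'): w0.
    by rewrite !mxE ei'.
  apply/rowP => j; rewrite !mxE.
  transitivity (\sum_i H (psi j) (phi i)).
    by apply: eq_bigr => i _; rewrite !mxE /H; case: (phi i).
  rewrite sum_image_sum // /H; case ej: (psi j) => [t|s] /=.
    have [tphi|tphi] := boolP (inr t \in codom phi).
      rewrite (bigD1 t) //= eqxx mulr1 [X in _ + (_ + X)]big1 ?addr0 ?subrr //.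
      by move=> t' /andP[_ nt]; rewrite (negbTE nt) mulr0.
    rewrite [X in _ + X]big1 ?addr0 => [|t' t'phi]; last first.
      case: (t' =P t) => [tt|_]; last by rewrite mulr0.
      by rewrite -tt t'phi in tphi.
    have [j' ->] := gP _ tphi; move/rowP/(_ j'): va; rewrite !mxE => va.
    rewrite -[RHS]va (bigID (mem (codom f))) /= [X in _ + X]big1 ?addr0; last first.
      move=> s ns; rewrite /vs big_pred0 ?mul0r // => i; apply: contraNF ns => /eqP <-.
      exact: codom_f.
    rewrite (eq_bigl (mem [set f i | i in 'I_k])); last first.
      move=> s; apply/codomP/imsetP => [[i ->]|[i _ ->]]; by exists i.
    rewrite (big_imset _ (in2W fi)) /=.
    by apply: eq_bigr => i _; rewrite vsf mxE.
  rewrite [X in _ + X]big1 ?addr0 => [|t _]; last by rewrite mulr0.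
  rewrite sum_delta_r /vs big_pred0 // => i; apply/eqP => fs.
  by have := fI i; rewrite inE fs -ej codom_f.
- have : inr s \in codom psi by apply: contraNT sf => /fP[i ->]; apply: codom_f.
  case/codomP => j ej; have := psiP j; case: (col j) => [t|l]; rewrite -ej //.
  by case=> s' [[->] nz]; exists l.
- have : inr t \in codom phi by apply: contraNT tg => /gP[i ->]; apply: codom_f.
  case/codomP => i ei; have := phiP i; case: (row i) => [s|l]; rewrite -ei //.
  by case=> t' [[->] nz]; exists l.
Qed.

End Border.

(** * Strong duality for integral data *)

Section StrongDuality.
Variables (F : fieldType) (mu nu : nat) (A : 'I_mu -> 'I_nu -> 'M[F]_2).
Variables (d : 'I_mu -> 'I_nu -> int) (k : nat).

Definition mxvec_unindex (i : 'I_(mu * nu)) : 'I_mu * 'I_nu :=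
  enum_val (cast_ord (esym (mxvec_cast mu nu)) i).

Lemma mxvec_indexK a b : mxvec_unindex (mxvec_index a b) = (a, b).
Proof. by rewrite /mxvec_unindex /mxvec_index cast_ord_comp cast_ord_id enum_rankK. Qed.

Definition mon_weight (m : multinom (mu * nu)) : int :=
  \sum_a \sum_b d a b *+ m (mxvec_index a b).

Section Optimum.
Variables (U : 'I_mu -> bool -> 'cV[F]_2) (V : 'I_nu -> bool -> 'cV[F]_2).
Variables (p : slot mu -> int) (q : slot nu -> int) (c : int).
Hypothesis feas : feasible A d U V p q c.
Hypothesis opt : forall U' V' p' q' c', feasible A d U' V' p' q' c' ->
  dual_value k p q c <= dual_value k p' q' c'.

Local Notation tight := (tight_entry A d U V p q c).

Lemma tight_minor : exists (f : 'I_k -> slot mu) (g : 'I_k -> slot nu),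
  [/\ injective f, injective g, minor tight f g != 0,
      forall s, s \notin codom f -> p s = 0 & forall t, t \notin codom g -> q t = 0].
Proof.
have [k1 k2] := optimum_size feas opt.
set E := padded_edge mu nu k.
pose D := mpoly #|E| F.
pose io : {rmorphism F -> D} := @mpolyC #|E| F.
pose N1 := #|padded mu (nu * 2 - k)|; pose N2 := #|padded nu (mu * 2 - k)|.
have N12 : N1 = N2 by rewrite /N1 /N2 !card_padded; lia.
have ns : nonsing [set: 'I_N1] [set: 'I_N2]
    (generic io (@evar F E) (padded_mx A d U V p q c)).
  have := nonsing_generic (io := io) (@evar_subst F E) (@evar_eval F E)
    (@pnode_fiber _ _) (@pnode_fiber _ _) _
    (@padded_homogeneous F mu nu A d k U V p q c) (padded_hall feas opt).
  apply.
  by rewrite [LHS]cardsT [RHS]cardsT !card_ord.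
have : \det (mxsub id (cast_ord N12) (generic io (@evar F E) (padded_mx A d U V p q c))) != 0.
  apply/(nonsing_det _ (@inj_id _) (@cast_ord_inj _ _ N12)).
  move: ns; congr (nonsing _ _ _); apply/setP => i; rewrite inE; apply/esym/imsetP.
    by exists i.
  by exists (cast_ord (esym N12) i); rewrite // cast_ord_comp cast_ord_id.
pose a s t : D := mpolyC _ (tight s t) * evar F (inl (s.1, t.1) : E).
pose y s l : D := (p s == 0)%:R * evar F (inr (inl (s, l)) : E).
pose z l t : D := (q t == 0)%:R * evar F (inr (inr (t, l)) : E).
rewrite (_ : mxsub _ _ _ = \matrix_(i, j) border a y z (enum_val i)
    (enum_val (cast_ord N12 j))); last first.
  apply/matrixP => i j; rewrite !mxE genericE.
  rewrite (eq_bigr (fun e => mpolyC _ (padded_coef A d U V p q c e (enum_val i)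
     (enum_val (cast_ord N12 j))) * evar F e)); last first.
    by move=> e _; rewrite mxE mulrC.
  case: (enum_val i) => [s|l]; case: (enum_val _) => [t|l'] /=.
  - rewrite (bigD1 (inl (s.1, t.1))) //= eqxx big1 ?addr0 // => -[ab|[]] //= ne.
      by case: ((s.1, t.1) =P ab) ne => [<-|]; rewrite ?eqxx // mpolyC0 mul0r.
    by rewrite mpolyC0 mul0r.
    by rewrite mpolyC0 mul0r.
  - rewrite (bigD1 (inr (inl (s, l')))) //= eqxx mul1r big1 ?addr0.
      by rewrite /y mpolyC_nat.
    move=> -[ab|[sl|]] //= ne; rewrite ?mpolyC0 ?mul0r //.
    by case: ((s, l') =P sl) ne => [<-|]; rewrite ?eqxx // !mul0r ?mpolyC0 ?mul0r.
  - rewrite (bigD1 (inr (inr (t, l)))) //= eqxx mul1r big1 ?addr0.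
      by rewrite /z mpolyC_nat.
    move=> -[ab|[|tl]] //= ne; rewrite ?mpolyC0 ?mul0r //.
    by case: ((t, l) =P tl) ne => [<-|]; rewrite ?eqxx // !mul0r ?mpolyC0 ?mul0r.
  - by rewrite big1 // => -[ab|[]] *; rewrite /= mpolyC0 mul0r.
case/(border_minor k1 k2).
- exact: enum_val_bij.
- exists (fun x => cast_ord (esym N12) (enum_rank x)) => x.
    by rewrite enum_valK cast_ord_comp cast_ord_id.
  by rewrite cast_ord_comp cast_ord_id enum_rankK.
move=> f [g [fi gi d0 pf qg]]; exists f, g; split=> //.
(* [chi] sends [x_ab] to the indeterminate of the padded edge [(a, b)], so the minor is nonzero
   because its image is. *)
- pose chi : {rmorphism mpoly (mu * nu) F -> D} :=
    mmap (@mpolyC #|E| F) (fun i => evar F (inl (mxvec_unindex i) : E)).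
  apply: contraNneq d0 => m0; have := congr1 chi m0; rewrite rmorph0 /minor -det_map_mx.
  move=> <-; apply/eqP; congr (\det _); apply/matrixP => i j; rewrite !mxE /poly_entry.
  by rewrite rmorphM /= mmapC mmapX mmap1U mxvec_indexK.
- move=> s /pf[l]; rewrite /y; case: (p s =P 0) => [//|_].
  by rewrite mul0r eqxx.
- move=> t /qg[l]; rewrite /z; case: (q t =P 0) => [//|_].
  by rewrite mul0r eqxx.
Qed.

Lemma sum_codom_zero n N (f : 'I_n -> slot N) (r : slot N -> int) : injective f ->
  (forall s, s \notin codom f -> r s = 0) -> \sum_i r (f i) = \sum_s r s.
Proof.
move=> fi r0; rewrite [RHS](bigID (mem (codom f))) /= [X in _ + X]big1 ?addr0 //.
rewrite (eq_bigl (mem [set f i | i in 'I_n])).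
  by rewrite (big_imset _ (in2W fi)).
by move=> s; apply/codomP/imsetP => [[i ->]|[i _ ->]]; exists i.
Qed.

(** A permutation of nonzero entries whose weight equals the dual value has tight entries only,
    since every nonzero entry obeys the dual constraint. Hence [m] has the same coefficient in the
    full minor as in the tight one. *)
Lemma optimum_in_minor :
  exists2 m, in_minor A U V k m & mon_weight m = dual_value k p q c.
Proof.
have [f [g [fi gi d0 pf qg]]] := tight_minor.
have [m mT] : exists m, m \in msupp (minor tight f g).
  by exists (mlead (minor tight f g)); apply: mlead_supp.
case: feas => _ _ p0 q0 dpq.
have sumE (s : {perm 'I_k}) : \sum_i (p (f i) + q (g (s i)) + c) = dual_value k p q c.
  rewrite !big_split /= sumr_const card_ord (sum_codom_zero fi pf).
  rewrite (sum_codom_zero (f := g \o s)) /dual_value; first last.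
  - move=> t tg; apply: qg; apply: contra tg => /codomP[i ->].
    by apply/codomP; exists ((s^-1)%g i); rewrite /= permKV.
  - by move=> i j /gi/perm_inj.
  by congr (_ + _); rewrite -mulr_natl natz.
have [s0 [ms0 nz0]] := mem_minor_perm mT.
have wm : mon_weight m = dual_value k p q c.
  rewrite /mon_weight -ms0 perm_mon_sum -(sumE s0); apply: eq_bigr => i _.
  by have := nz0 i; rewrite /tight_entry; case: (d _ _ =P _) => // _; rewrite eqxx.
exists m => //; exists f, g; rewrite mcoeff_msupp.
rewrite (_ : mcoeff m _ = mcoeff m (minor tight f g)) -?mcoeff_msupp //.
rewrite !mcoeff_minor; apply: eq_bigr => s _.
have [ms|_] := eqVneq (perm_mon f g s) m; last by rewrite !mulr0.
congr (_ * _ * _).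
have [/existsP[i /eqP z]|/existsPn nz] :=
    boolP [exists i, entry A U V (f i) (g (s i)) == 0].
  rewrite (bigD1 i) //= z mul0r [RHS](bigD1 i) //= /tight_entry z.
  by rewrite if_same mul0r.
apply: eq_bigr => i _; rewrite /tight_entry.
have le j : d (f j).1 (g (s j)).1 <= p (f j) + q (g (s j)) + c by apply/dpq/nz.
have eqs : \sum_j d (f j).1 (g (s j)).1 = \sum_j (p (f j) + q (g (s j)) + c).
  by rewrite sumE -wm /mon_weight -ms perm_mon_sum.
have := lt_neqAle (d (f i).1 (g (s i)).1) (p (f i) + q (g (s i)) + c).
rewrite le andbT; case: eqP => //= _ lt.
suff : \sum_j d (f j).1 (g (s j)).1 < \sum_j (p (f j) + q (g (s j)) + c).
  by rewrite eqs ltxx.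
rewrite (bigD1 i) //= [ltRHS](bigD1 i) //=; apply: ltr_leD => //.
by apply: ler_sum => j _.
Qed.

End Optimum.

Lemma int_min (P : int -> Prop) L : (exists v, P v) -> (forall v, P v -> L <= v) ->
  exists2 v, P v & forall v', P v' -> v <= v'.
Proof.
move=> [v0 Pv0] lb.
have ex : exists n : nat, `[< P (L + n%:Z) >].
  exists `|v0 - L|%N; apply/asboolP; have le := lb _ Pv0.
  by rewrite (_ : L + _ = v0) //; lia.
case: (ex_minnP ex) => n /asboolP Pn min; exists (L + n%:Z) => // v Pv.
have := min `|v - L|%N; have le := lb _ Pv.
rewrite (_ : L + _ = v); last by lia.
by move=> /(_ (asboolT Pv)); lia.
Qed.

Lemma feasible_exists : exists U V p q c, feasible A d U V p q c.
Proof.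
exists (@std_frame F mu), (@std_frame F nu), (fun=> 0), (fun=> 0), (\sum_a \sum_b `|d a b|).
split=> //; [exact: std_frameP|exact: std_frameP|].
move=> i j _; rewrite !add0r (bigD1 i.1) //= (bigD1 j.1) //=.
rewrite -addrA (le_trans (ler_norm _)) // lerDl addr_ge0 //; first exact: sumr_ge0.
by apply: sumr_ge0 => a _; apply: sumr_ge0.
Qed.

Theorem strong_duality L :
  (forall U V p q c, feasible A d U V p q c -> L <= dual_value k p q c) ->
  exists U V p q c m, [/\ feasible A d U V p q c, in_minor A U V k m
    & mon_weight m = dual_value k p q c].
Proof.
move=> lb.
have [|v|v [U [V [p [q [c [feas ->]]]]]] min] := @int_min (fun v => exists U V p q c,
    feasible A d U V p q c /\ v = dual_value k p q c) L.
- by have [U [V [p [q [c fe]]]]] := feasible_exists; exists (dual_value k p q c), U, V, p, q, c.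
- by case=> U [V [p [q [c [fe ->]]]]]; exact: lb fe.
have [|m im wm] := @optimum_in_minor U V p q c feas.
  by move=> U' V' p' q' c' fe; apply: min; exists U', V', p', q', c'.
by exists U, V, p, q, c, m.
Qed.

End StrongDuality.

(** * From monomials to matching-pairs *)

Section PlaneVectors.
Variable F : fieldType.
Implicit Types (u v w : 'cV[F]_2) (B : 'M[F]_2).

Definition vec2 (x y : F) : 'cV[F]_2 := \col_i (if i == 0 then x else y).

Lemma vec2_0 x y : vec2 x y 0 0 = x. Proof. by rewrite mxE. Qed.
Lemma vec2_1 x y : vec2 x y 1 0 = y. Proof. by rewrite mxE. Qed.
Definition vec2E := (vec2_0, vec2_1).

Lemma cV2_neq0 v : v != 0 -> (v 0 0 != 0) || (v 1 0 != 0).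
Proof.
move=> nv; rewrite -negb_and; apply: contra nv => /andP[/eqP h0 /eqP h1].
by apply/eqP/cV2P; rewrite mxE.
Qed.

Lemma det2_neq0l u v : det2 u v != 0 -> u != 0.
Proof. by apply: contraNneq => ->; rewrite /det2 !mxE !mul0r subrr. Qed.

Lemma det_mx2 B : \det B = B 0 0 * B 1 1 - B 0 1 * B 1 0.
Proof.
rewrite (expand_det_row _ 0) !big_ord_recl big_ord0 addr0 /cofactor !det_mx11 !mxE /=.
have -> : lift 0 0 = 1 :> 'I_2 by exact: val_inj.
have -> : lift 1 0 = 0 :> 'I_2 by exact: val_inj.
by rewrite expr0 mul1r expr1 mulN1r mulrN.
Qed.

Definition other v := if v 0 0 == 0 then vec2 1 0 else vec2 0 1.

Lemma otherP v : v != 0 -> det2 v (other v) != 0.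
Proof.
move/cV2_neq0; rewrite /other /det2; case: eqP => [-> /=|/eqP nz _].
  by rewrite !vec2E mul0r mulr1 sub0r oppr_eq0.
by rewrite !vec2E mulr1 mulr0 subr0.
Qed.

(** The vector [B *m v] turned by a right angle; for invertible [B] and nonzero [v] it spans the
    left vectors that [B] pairs to zero with [v]. *)
Definition perp B v := vec2 (B 1 0 * v 0 0 + B 1 1 * v 1 0)
                            (- (B 0 0 * v 0 0 + B 0 1 * v 1 0)).

Lemma bilin_perp B v : bilin B (perp B v) v = 0.
Proof. by rewrite bilinE !vec2E; ring. Qed.

Lemma det2_perp B u v : det2 (perp B v) u = bilin B u v.
Proof. by rewrite bilinE /det2 !vec2E; ring. Qed.

Lemma bilin_tr B u v : bilin B^T v u = bilin B u v.
Proof. by rewrite !bilinE !mxE; ring. Qed.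

Lemma perp_neq0 B v : \det B != 0 -> v != 0 -> perp B v != 0.
Proof.
move=> dB; apply: contraNneq => p0.
have h0 : B 0 0 * v 0 0 + B 0 1 * v 1 0 = 0.
  have := congr1 (fun w : 'cV[F]_2 => w 1 0) p0; rewrite /perp vec2_1 mxE => /eqP.
  by rewrite oppr_eq0 => /eqP.
have h1 : B 1 0 * v 0 0 + B 1 1 * v 1 0 = 0.
  by have := congr1 (fun w : 'cV[F]_2 => w 0 0) p0; rewrite /perp vec2_0 mxE.
apply/eqP; apply: cV2P; rewrite mxE; apply: (mulfI dB); rewrite mulr0 det_mx2.
  transitivity (B 1 1 * (B 0 0 * v 0 0 + B 0 1 * v 1 0) -
                B 0 1 * (B 1 0 * v 0 0 + B 1 1 * v 1 0)); first by ring.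
  by rewrite h0 h1 !mulr0 subr0.
transitivity (B 0 0 * (B 1 0 * v 0 0 + B 1 1 * v 1 0) -
              B 1 0 * (B 0 0 * v 0 0 + B 0 1 * v 1 0)); first by ring.
by rewrite h0 h1 !mulr0 subr0.
Qed.

Definition left_ker B :=
  if (B 0 0 == 0) && (B 1 0 == 0) then vec2 (B 1 1) (- B 0 1)
  else vec2 (B 1 0) (- B 0 0).

Lemma left_ker_neq0 B : B != 0 -> left_ker B != 0.
Proof.
move=> nB; apply: contraNneq nB => k0.
have h0 : left_ker B 0 0 = 0 by rewrite k0 mxE.
have h1 : left_ker B 1 0 = 0 by rewrite k0 mxE.
have E : (B 0 0 = 0 /\ B 1 0 = 0) /\ (B 0 1 = 0 /\ B 1 1 = 0).
  move: h0 h1; rewrite /left_ker; case: ifP => [/andP[/eqP-> /eqP->]|].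
    by rewrite !vec2E => -> /eqP; rewrite oppr_eq0 => /eqP.
  rewrite !vec2E => + b10 /eqP; rewrite b10 oppr_eq0 => + b00.
  by rewrite b00 eqxx.
case: E => -[h00 h10] [h01 h11]; apply/eqP/matrixP => i j; rewrite mxE.
have l01 : lift 0 0 = 1 :> 'I_2 by exact: val_inj.
by case: (unliftP 0 i) => [i' ->|->]; case: (unliftP 0 j) => [j' ->|->];
  rewrite ?[i']ord1 ?[j']ord1 ?l01.
Qed.

Lemma left_kerP B w : \det B = 0 -> bilin B (left_ker B) w = 0.
Proof.
rewrite det_mx2 bilinE /left_ker => d0; case: ifP => [/andP[/eqP h0 /eqP h1]|_]; rewrite !vec2E.
  by rewrite h0 h1; ring.
transitivity (- (B 0 0 * B 1 1 - B 0 1 * B 1 0) * w 1 0); first by ring.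
by rewrite d0 oppr0 mul0r.
Qed.

Lemma det2_eq0 u v : u != 0 -> det2 u v = 0 -> exists c, v = c *: u.
Proof.
move=> /cV2_neq0/orP[nz|nz] /eqP; rewrite subr_eq0 => /eqP e.
  exists (v 0 0 / u 0 0); apply: cV2P; rewrite mxE; first by rewrite divfK.
  by apply: (mulfI nz); rewrite e; field.
exists (v 1 0 / u 1 0); apply: cV2P; rewrite mxE; last by rewrite divfK.
by apply: (mulfI nz); rewrite -e; field.
Qed.

End PlaneVectors.

(** * Labels propagated along paths *)

Section Labels.
Variables (F : fieldType) (T : finType) (e : rel T) (side : T -> bool).
Variables (mat : T -> T -> 'M[F]_2) (cl : T -> T -> bool).
Hypothesis e_sym : ssrbool.symmetric e.
Hypothesis e_side : forall x y, e x y -> side y = ~~ side x.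
Hypothesis mat_sym : forall x y, mat y x = (mat x y)^T.
Hypothesis mat_neq0 : forall x y, e x y -> mat x y != 0.
Hypothesis cl_sym : forall x y, cl y x = cl x y.
Hypothesis cl_proper : forall x y z, e x y -> e x z -> cl x y = cl x z -> y = z.
(** With proper colours, a full set is a union of cycles of rank-two edges. This is the case settled
    by doubling. *)
Hypothesis no_full_set : forall Y : {set T}, Y != finset.set0 ->
  ~ (forall x s, x \in Y ->
       exists y, [/\ y \in Y, e x y, cl x y = s & \det (mat x y) != 0]).

(** An edge of colour [s] ties the label [s] at one end to the label [~~ s] at the other, so labels
    depend on each other along alternating paths. If [P] failed somewhere, the failures would have
    an injective, hence bijective, successor map [nxt]; successors and predecessors supply edges of
    both colours, which makes a full set. *)
Lemma chain_ind (P : T -> bool -> Prop) :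
  (forall x s, (forall y, e x y -> cl x y = s -> \det (mat x y) != 0 -> P y (~~ s)) -> P x s) ->
  forall x s, P x s.
Proof.
move=> step x0 s0; apply/not_notP => nP0.
pose Z := [set z : T * bool | ~~ `[< P z.1 z.2 >]].
have ZP x s : (x, s) \in Z -> exists y, [/\ (y, ~~ s) \in Z, e x y, cl x y = s
    & \det (mat x y) != 0].
  rewrite inE /= => /asboolPn nP; apply/not_existsP => nex; apply: nP.
  apply: step => y exy clxy dxy; apply/not_notP => nPy.
  by apply: (nex y); split=> //; rewrite inE /=; apply/asboolPn.
pose nxt (z : T * bool) := odflt z
  [pick z' in Z | [&& z'.2 == ~~ z.2, e z.1 z'.1, cl z.1 z'.1 == z.2
                    & \det (mat z.1 z'.1) != 0]].
have nxtP z : z \in Z -> [/\ nxt z \in Z, (nxt z).2 = ~~ z.2, e z.1 (nxt z).1,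
    cl z.1 (nxt z).1 = z.2 & \det (mat z.1 (nxt z).1) != 0].
  case: z => x s zZ; rewrite /nxt; case: pickP => [z'|] /=.
    by case/andP => ? /and4P[/eqP ? ? /eqP ? ?].
  have [y [yZ exy clxy dxy]] := ZP _ _ zZ.
  by move/(_ (y, ~~ s)); rewrite yZ exy clxy dxy !eqxx.
have nxt_inj : {in Z &, injective nxt}.
  move=> z z' zZ z'Z E; have [_ h1 h2 h3 _] := nxtP _ zZ.
  have [_ h1' h2' h3' _] := nxtP _ z'Z; rewrite -E in h1' h2' h3'.
  have es : z.2 = z'.2 by apply: negb_inj; rewrite -h1 -h1'.
  have ex : z.1 = z'.1.
    apply: (@cl_proper (nxt z).1); rewrite 1?e_sym //.
    by rewrite -cl_sym h3 -cl_sym h3' es.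
  by rewrite [z]surjective_pairing [z']surjective_pairing ex es.
have nxtZ : nxt @: Z = Z.
  apply/eqP; rewrite eqEcard (card_in_imset nxt_inj) leqnn andbT.
  by apply/fintype.subsetP => _ /imsetP[z /nxtP[+ _ _ _ _] ->].
pose Y := [set z.1 | z in Z].
apply: (@no_full_set Y).
  by apply/set0Pn; exists x0; apply/imsetP; exists (x0, s0); rewrite // inE; apply/asboolPn.
move=> x s /imsetP[[x' s'] zZ /= ->].
have [<-|ns] := eqVneq s' s.
  have [h0 _ h2 h3 h4] := nxtP _ zZ.
  by exists (nxt (x', s')).1; split=> //; apply: imset_f.
have := zZ; rewrite -{1}nxtZ => /imsetP[z' z'Z E].
have [_ h1 h2 h3 h4] := nxtP _ z'Z; rewrite -E /= in h1 h2 h3 h4.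
exists z'.1; split.
- exact: imset_f.
- by rewrite e_sym.
- by rewrite cl_sym h3; move: ns; rewrite h1; case: (z'.2); case: (s).
- by rewrite mat_sym det_tr.
Qed.

Definition chain_step (free : T -> bool -> 'cV[F]_2) (G : T -> bool -> 'cV[F]_2) x s :=
  if [pick y | e x y && (cl x y == s)] is Some y then
    if \det (mat x y) == 0 then left_ker (mat x y) else perp (mat x y) (G y (~~ s))
  else free x s.

Lemma chain_step_edge free G x y s : e x y -> cl x y = s ->
  chain_step free G x s =
    if \det (mat x y) == 0 then left_ker (mat x y) else perp (mat x y) (G y (~~ s)).
Proof.
move=> exy clxy; rewrite /chain_step; case: pickP => [z /andP[exz /eqP clxz]|/(_ y)].
  by rewrite (cl_proper exz exy) // clxz clxy.
by rewrite exy clxy eqxx.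
Qed.

Lemma chain_step_free free G x s : (forall y, e x y -> cl x y <> s) ->
  chain_step free G x s = free x s.
Proof.
move=> no; rewrite /chain_step; case: pickP => // y /andP[exy /eqP].
by move/(no y exy).
Qed.

(** Iteration stabilises at each pair by [chain_ind], hence everywhere after finitely many steps.
    The argument [free] supplies the label where a path has no edge of the required colour. *)
Lemma chain_fix free : exists G, forall x s, G x s = chain_step free G x s.
Proof.
pose Gn := fix Gn n := if n is n'.+1 then chain_step free (Gn n') else free.
have st x s : exists n, forall k, (n <= k)%N -> Gn k x s = Gn n x s.
  apply: (chain_ind (P := fun x s => exists n, forall k, (n <= k)%N -> Gn k x s = Gn n x s)) => {}x {}s IH.
  case: (pickP (fun y => e x y && (cl x y == s))) => [y /andP[exy /eqP clxy]|no]; last first.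
    have nof y : e x y -> cl x y <> s.
      by move=> exy clxy; have := no y; rewrite exy clxy eqxx.
    by exists 1%N => -[//|k] _ /=; rewrite !chain_step_free.
  have [d0|d0] := boolP (\det (mat x y) == 0).
    by exists 1%N => -[//|k] _ /=; rewrite !(chain_step_edge _ _ exy clxy) d0.
  have [n hn] := IH y exy clxy d0.
  exists n.+1 => -[//|k] lnk /=; rewrite !(chain_step_edge _ _ exy clxy).
  by rewrite (negbTE d0) hn.
have {}st (z : T * bool) : exists n, `[< forall k, (n <= k)%N -> Gn k z.1 z.2 = Gn n z.1 z.2 >].
  by have [n hn] := st z.1 z.2; exists n; apply/asboolP.
pose N := (\max_z ex_minn (st z))%N.
exists (Gn N) => x s; rewrite -[RHS]/(Gn N.+1 x s).
have : (ex_minn (st (x, s)) <= N)%N by apply: (leq_bigmax (x, s)).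
case: ex_minnP => n /asboolP hn _ leN.
by rewrite (hn N) // (hn N.+1) // leqW.
Qed.

Lemma chain_fix_neq0 free G : (forall x s, G x s = chain_step free G x s) ->
  (forall x s, free x s != 0) -> forall x s, G x s != 0.
Proof.
move=> GE f0; apply: chain_ind => x s IH; rewrite GE.
case: (pickP (fun y => e x y && (cl x y == s))) => [y /andP[exy /eqP clxy]|no]; last first.
  rewrite chain_step_free // => y exy clxy.
  by have := no y; rewrite exy clxy eqxx.
rewrite (chain_step_edge _ _ exy clxy); case: ifP => [_|/negbT d0].
  by apply/left_ker_neq0/mat_neq0.
by apply: perp_neq0 => //; apply: IH.
Qed.

Hypothesis slots : forall U : T -> bool -> 'cV[F]_2,
  (forall x, det2 (U x true) (U x false) != 0) ->
  exists slot : T -> T -> bool,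
    (forall x y, e x y -> bilin (mat x y) (U x (slot x y)) (U y (slot y x)) != 0) /\
    (forall x y z, e x y -> e x z -> y <> z -> slot x y <> slot x z).

(* A label is computed by following the path that leaves the node along the edge of
   its sign, up to the kernel of the first rank-one edge.  A path without rank-one
   edge leaves the label free: it is chosen at the far end, different from the
   opposite label there, which [L0], [L1], [L2] do in turn. *)
Lemma labels_exist : exists L : T -> bool -> 'cV[F]_2,
  (forall x, det2 (L x true) (L x false) != 0) /\
  (forall x y, e x y ->
    bilin (mat x y) (L x (cl x y)) (L y (~~ cl x y)) = 0 /\
    (\det (mat x y) = 0 -> forall w, bilin (mat x y) (L x (cl x y)) w = 0)).
Proof.
have v0 : vec2 1 0 != 0 :> 'cV[F]_2.
  by apply/eqP => /colP/(_ 0); rewrite !mxE => /eqP; rewrite oner_eq0.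
have o0 (v : 'cV[F]_2) : v != 0 -> other v != 0.
  by move=> /otherP; rewrite det2C oppr_eq0 => /det2_neq0l.
have [L0 L0E] := chain_fix (fun _ _ => vec2 1 0).
have L00 := chain_fix_neq0 L0E (fun _ _ => v0).
have [L1 L1E] := chain_fix (fun x s => other (L0 x (~~ s))).
have L10 : forall x s, L1 x s != 0.
  by apply: chain_fix_neq0 L1E _ => x s; apply: o0.
have [L2 L2E] := chain_fix (fun x s => other (L1 x (~~ s))).
have L20 : forall x s, L2 x s != 0.
  by apply: chain_fix_neq0 L2E _ => x s; apply: o0.
(* The sign [f] alternates along edges, so the chain from [(x, f x)] stays among such pairs. These
   labels come from [L2], the opposite ones from [L1], and [bad x] says that the two are
   parallel. *)
pose f := side; pose bad x := det2 (L2 x (f x)) (L1 x (~~ f x)) = 0.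
have fE x y : e x y -> f y = ~~ f x by exact: e_side.
have bad_edge x y : e x y -> cl x y = f x -> \det (mat x y) != 0 -> bad x <-> bad y.
  move=> exy clxy d0.
  have e2 : L2 x (f x) = perp (mat x y) (L2 y (f y)).
    by rewrite L2E (chain_step_edge _ _ exy clxy) (negbTE d0) (fE _ _ exy).
  have e1 : L1 y (~~ f y) = perp (mat y x) (L1 x (~~ f x)).
    rewrite (fE _ _ exy) negbK L1E (@chain_step_edge _ _ _ x); rewrite 1?e_sym 1?cl_sym //.
    by rewrite mat_sym det_tr (negbTE d0).
  rewrite /bad e1 e2 (det2C (perp (mat y x) _)) !det2_perp mat_sym bilin_tr.
  by split=> [->|/eqP]; rewrite ?oppr0 // oppr_eq0 => /eqP.
(* A free end cannot be bad, since [L2] is chosen there independent of [L1]. So the chain of a bad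
   node ends at a rank-one edge, and its label does not depend on the free choices. *)
have fwd x s : s = f x -> bad x ->
    L2 x (f x) = L0 x (f x) /\ exists2 y, e x y & cl x y = f x.
  move: x s; apply: chain_ind => x s IH sx bx.
  case: (pickP (fun y => e x y && (cl x y == f x))) => [y /andP[exy /eqP clxy]|no]; last first.
    have nof y : e x y -> cl x y <> f x.
      by move=> exy clxy; have := no y; rewrite exy clxy eqxx.
    move/eqP: bx; rewrite L2E chain_step_free // det2C oppr_eq0.
    by rewrite (negbTE (otherP (L10 _ _))).
  split; last by exists y.
  rewrite L2E L0E !(chain_step_edge _ _ exy clxy); case: ifP => // /negbT d0.
  congr (perp _ _); rewrite -(fE _ _ exy).
  have [] // := IH y exy _ d0; rewrite ?sx ?(fE _ _ exy) //.
  exact/(bad_edge _ _ exy clxy d0).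
pose U x s := if s then L2 x (f x) else other (L2 x (f x)).
have [slot [slotP slot_inj]] := slots (fun x => otherP (L20 x (f x)) : det2 (U x true) (U x false) != 0).
have slot_neg x y : e x y -> (forall w, bilin (mat x y) (L2 x (f x)) w = 0) -> slot x y = false.
  move=> exy z; apply/negbTE/negP => st; have := slotP _ _ exy.
  by rewrite st /= z eqxx.
(* The opposite chain has no free end either, since [L1] would be chosen there independent of [L0],
   which agrees with [L2]. At its rank-one end the slot [true], the common label, lies in the
   kernel, so the other edge has to use it. Across a rank-two edge two slots [true] pair to zero,
   which pushes this use along the path. *)
have bwd x s : s = ~~ f x -> bad x ->
    exists y, [/\ e x y, cl x y = f x & slot x y = true].
  move: x s; apply: chain_ind => x s IH sx bx.
  have [eL [y exy clxy]] := fwd x _ erefl bx.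
  exists y; split=> //.
  suff [z [exz clxz sz]] : exists z, [/\ e x z, cl x z = ~~ f x & slot x z = false].
    have zy : z <> y by move=> zy; move: clxz; rewrite zy clxy; case: (f x).
    by have := slot_inj _ _ _ exz exy zy; rewrite sz; case: (slot x y).
  case: (pickP (fun z => e x z && (cl x z == ~~ f x))) => [z /andP[exz /eqP clxz]|no]; last first.
    have nof y' : e x y' -> cl x y' <> ~~ f x.
      by move=> exy' clxy'; have := no y'; rewrite exy' clxy' eqxx.
    move/eqP: bx; rewrite L1E chain_step_free // negbK -eL.
    by rewrite (negbTE (otherP (L20 _ _))).
  exists z; split=> //; have [d0|d0] := boolP (\det (mat x z) == 0).
    apply: slot_neg => // w.
    have [c ->] : exists c, L2 x (f x) = c *: L1 x (~~ f x).
      by apply: det2_eq0 => //; rewrite det2C bx oppr0.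
    rewrite L1E (chain_step_edge _ _ exz clxz) d0.
    have := bilinDl (mat x z) (left_ker (mat x z)) 0 w c 0.
    by rewrite scaler0 addr0 => ->; rewrite left_kerP ?(eqP d0) // mulr0 mul0r addr0.
  have ezx : e z x by rewrite e_sym.
  have clzx : cl z x = f z by rewrite cl_sym (fE _ _ exz).
  have dzx : \det (mat z x) != 0 by rewrite mat_sym det_tr.
  have bz : bad z by apply/(bad_edge _ _ ezx clzx dzx).
  have [|//|y' [ezy' clzy' sy']] := IH z exz (etrans clxz (esym sx)) d0.
    by rewrite sx (fE _ _ exz).
  have y'x : y' = x by apply: (cl_proper ezy' ezx); rewrite clzy' clzx.
  rewrite y'x in sy'; apply/negbTE/negP => sx'.
  have := slotP _ _ ezx; rewrite sy' sx' /= L2E (chain_step_edge _ _ ezx clzx).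
  by rewrite (negbTE dzx) (_ : ~~ f z = f x) ?bilin_perp ?eqxx // (fE _ _ exz) negbK.
(* At the forward end, the slot [true] would be used by a rank-one edge whose kernel contains it. *)
have nbad x s : s = f x -> ~ bad x.
  move: x s; apply: chain_ind => x s IH sx bx.
  have [y [exy clxy sxy]] := bwd x _ erefl bx.
  have [d0|d0] := boolP (\det (mat x y) == 0).
    have : slot x y = false.
      apply: slot_neg => // w.
      by rewrite L2E (chain_step_edge _ _ exy clxy) d0 left_kerP // (eqP d0).
    by rewrite sxy.
  apply: (IH y exy (etrans clxy (esym sx)) d0); first by rewrite sx (fE _ _ exy).
  by apply/(bad_edge _ _ exy clxy d0).
exists (fun x s => if s == f x then L2 x s else L1 x s); split=> [x|x y exy].
  have := nbad x _ erefl; rewrite /bad; case: (f x) => /= /eqP //.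
  by rewrite det2C oppr_eq0.
have E s : cl x y = s -> (if s == f x then L2 x s else L1 x s) =
    if \det (mat x y) == 0 then left_ker (mat x y)
    else perp (mat x y) (if (~~ s) == f y then L2 y (~~ s) else L1 y (~~ s)).
  move=> clxy; rewrite (fE _ _ exy) (_ : (~~ s == ~~ f x) = (s == f x)); last by case: (s); case: (f x).
  by case: ifP => _; rewrite [LHS](L2E, L1E) (chain_step_edge _ _ exy clxy).
rewrite (E _ erefl); split=> [|/eqP d0 w]; case: ifP => d0'.
- by rewrite left_kerP // (eqP d0').
- by rewrite bilin_perp.
- by rewrite left_kerP // (eqP d0').
- by rewrite d0 in d0'.
Qed.

End Labels.

(** * Proper 2-colourings of edges *)

Section EdgeColoring.
Variables (mu nu : nat) (M : {set edge mu nu}).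
Implicit Types (g h : node mu nu) (e : edge mu nu).

Lemma adj_sym : ssrbool.symmetric (adj M).
Proof. by case=> [a|b] [a'|b']. Qed.

Lemma degree_inl a : degree M (inl a) = (\sum_b ((a, b) \in M))%N.
Proof.
rewrite /degree -sum1_card big_mkcond /=.
transitivity (\sum_(e : 'I_mu * 'I_nu) (if (e \in M) && (e.1 == a) then 1 else 0))%N.
  by apply: eq_bigr => e _; rewrite inE.
transitivity (\sum_(a' : 'I_mu) \sum_b (if ((a', b) \in M) && (a' == a) then 1 else 0))%N.
  by rewrite pair_bigA; apply: eq_bigr => -[].
rewrite (bigD1 a) //= [X in (_ + X)%N]big1 ?addn0 => [|a' na]; last first.
  by rewrite big1 // => b _; rewrite (negbTE na) andbF.
by apply: eq_bigr => b _; rewrite eqxx andbT; case: ifP.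
Qed.

Lemma degree_inr b : degree M (inr b) = (\sum_a ((a, b) \in M))%N.
Proof.
rewrite /degree -sum1_card big_mkcond /=.
transitivity (\sum_(e : 'I_mu * 'I_nu) (if (e \in M) && (e.2 == b) then 1 else 0))%N.
  by apply: eq_bigr => e _; rewrite inE.
transitivity (\sum_(b' : 'I_nu) \sum_a (if ((a, b') \in M) && (b' == b) then 1 else 0))%N.
  by rewrite exchange_big pair_bigA; apply: eq_bigr => -[].
rewrite (bigD1 b) //= [X in (_ + X)%N]big1 ?addn0 => [|b' nb]; last first.
  by rewrite big1 // => a _; rewrite (negbTE nb) andbF.
by apply: eq_bigr => a _; rewrite eqxx andbT; case: ifP.
Qed.

Lemma sum_adj g : (\sum_h adj M g h)%N = degree M g.
Proof.
rewrite big_sumType /=; case: g => [a|b] /=.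
  by rewrite big1 ?add0n ?degree_inl.
by rewrite [X in (_ + X)%N]big1 ?addn0 ?degree_inr.
Qed.

Lemma degree_ge3 g e1 e2 e3 : e1 \in M -> e2 \in M -> e3 \in M ->
  incident g e1 -> incident g e2 -> incident g e3 ->
  e1 != e2 -> e1 != e3 -> e2 != e3 -> (2 < degree M g)%N.
Proof.
move=> m1 m2 m3 i1 i2 i3 n12 n13 n23.
have <- : #|[set e1; e2; e3]| = 3%N.
  by rewrite -finset.setUA cardsU1 cards2 !inE negb_or n12 n13 n23.
apply: subset_leq_card; apply/fintype.subsetP => e.
by rewrite !inE => /orP[/orP[]|] /eqP->; rewrite ?m1 ?m2 ?m3 ?i1 ?i2 ?i3.
Qed.

Lemma degree_ge2 g e1 e2 : e1 \in M -> e2 \in M ->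
  incident g e1 -> incident g e2 -> e1 != e2 -> (1 < degree M g)%N.
Proof.
move=> m1 m2 i1 i2 n12.
have <- : #|[set e1; e2]| = 2%N by rewrite cards2 n12.
apply: subset_leq_card; apply/fintype.subsetP => e.
by rewrite !inE => /orP[] /eqP->; rewrite ?m1 ?m2 ?i1 ?i2.
Qed.

Hypothesis deg2 : forall g, (degree M g <= 2)%N.

(* Adding [2 - degree] loops at every node makes the graph 2-regular; the edges
   that a perfect matching of its bipartite double cover uses from rows to columns
   cover every node of degree 2 exactly once, and form a colour class. *)
Lemma edge_coloring : exists sg, proper_coloring M sg.
Proof.
pose r g h := adj M g h || ((g == h) && (degree M g < 2)%N).
pose w g h : nat := (adj M g h + (if g == h then 2 - degree M g else 0))%N.
have wsum g : (\sum_h w g h)%N = 2%N.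
  by rewrite big_split /= sum_adj -big_mkcond /= (big_pred1 g) ?subnKC.
have w_sym g h : w h g = w g h.
  by rewrite /w adj_sym eq_sym; case: eqP => [->|].
have w0 g h : ~~ r g h -> w g h = 0%N.
  rewrite /r negb_or /w => /andP[/negbTE-> /=]; case: eqP => [->|] //=.
  by rewrite -leqNgt => h2; apply/eqP; rewrite subn_eq0.
have [S|pi [pi_inj piP]] := @marriage _ _ r.
  rewrite -(leq_pmul2r (isT : (0 < 2)%N)).
  have -> : (#|S| * 2 = \sum_(g in S) \sum_(h in neighbours r S) w g h)%N.
    rewrite -sum_nat_const; apply: eq_bigr => g gS; rewrite -(wsum g).
    rewrite (bigID (mem (neighbours r S))) /= [X in (_ + X)%N]big1 ?addn0 // => h.
    rewrite inE => /existsPn/(_ g); rewrite gS /=; exact: w0.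
  rewrite exchange_big /= -sum_nat_const; apply: leq_sum => h _.
  rewrite -(wsum h) [leqRHS](bigID (mem S)) /=.
  by rewrite (eq_bigr (fun g => w h g)) ?leq_addr // => g _; rewrite w_sym.
exists (fun e => pi (inl e.1) == inr e.2) => g e e' eM e'M ne ie ie'.
have d2 : (1 < degree M g)%N by apply: (degree_ge2 eM e'M).
case: e e' eM e'M ne ie ie' => [a b] [a' b'] /= eM e'M ne; case: g d2 => [a0|b0] d2 /= /eqP ea /eqP ea'.
  rewrite ea in eM ne *; rewrite ea' in e'M ne *.
  have nb : b != b' by apply: contraNneq ne => ->.
  case: (pi _ =P inr b) => [->|n1]; first by rewrite (inj_eq inr_inj) nb.
  case: (pi _ =P inr b') => // n2.
  have := piP (inl a0); rewrite /r ltnNge d2 andbF orbF /=.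
  case: (pi (inl a0)) n1 n2 => // b'' n1 n2 e''M.
  have := degree_ge3 (g := inl a0) eM e'M e''M.
  rewrite /= !eqxx !xpair_eqE !eqxx /= nb => /(_ isT isT isT isT).
  rewrite ltnNge deg2 => h; apply: h; apply/eqP => eb; [case: n1|case: n2]; by rewrite eb.
rewrite ea in eM ne *; rewrite ea' in e'M ne *.
have na : a != a' by apply: contraNneq ne => ->.
have pia x y : pi (inl x) = inr b0 -> pi (inl y) = inr b0 -> x = y.
  by move=> <- /pi_inj[->].
case: (pi (inl a) =P _) => [h1|n1]; case: (pi (inl a') =P _) => [h2|n2] //.
  by rewrite (pia _ _ h1 h2) eqxx in na.
have [pi' piK pi'K] := injF_bij pi_inj.
have := piP (pi' (inr b0)); rewrite pi'K /r.
case E : (pi' (inr b0)) => [a''|b''] /=; last first.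
  by case: eqP => // -[->]; rewrite ltnNge d2.
rewrite orbF => e''M; have pa'' : pi (inl a'') = inr b0 by rewrite -E pi'K.
have := degree_ge3 (g := inr b0) eM e'M e''M.
rewrite /= !eqxx !xpair_eqE !eqxx !andbT /= na => /(_ isT isT isT isT).
rewrite ltnNge deg2 => h; apply: h; apply/eqP => eb; [case: n1|case: n2]; by rewrite eb.
Qed.

End EdgeColoring.


Lemma bilin_det (F : fieldType) (B : 'M[F]_2) u u' v v' :
  bilin B u v * bilin B u' v' - bilin B u v' * bilin B u' v =
  \det B * (det2 u u' * det2 v v').
Proof. by rewrite !bilinE det_mx2 /det2; ring. Qed.

(** * Supports of good exponents and the doubling of cycles *)

Section GoodFacts.
Variables (F : fieldType) (mu nu : nat) (A : 'I_mu -> 'I_nu -> 'M[F]_2).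
Variables (m : 'I_mu -> 'I_nu -> nat).
Hypothesis good_m : good A m.

Definition msupport : {set edge mu nu} := [set e | (0 < m e.1 e.2)%N].

Lemma card_row_transversal (N : {set slot mu * slot nu}) a :
  (\sum_b #|[set p in N | (p.1.1, p.2.1) == (a, b)]| = #|[set p in N | p.1.1 == a]|)%N.
Proof.
rewrite -[RHS]sum1_card (partition_big (fun p => p.2.1) predT) //=.
apply: eq_bigr => b _; rewrite -sum1_card; apply: eq_bigl => p.
by rewrite !inE xpair_eqE andbA.
Qed.

Lemma card_col_transversal (N : {set slot mu * slot nu}) b :
  (\sum_a #|[set p in N | (p.1.1, p.2.1) == (a, b)]| = #|[set p in N | p.2.1 == b]|)%N.
Proof.
rewrite -[RHS]sum1_card (partition_big (fun p => p.1.1) predT) //=.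
apply: eq_bigr => a _; rewrite -sum1_card; apply: eq_bigl => p.
by rewrite !inE xpair_eqE -!andbA; congr (_ && _); rewrite andbC.
Qed.

Lemma good_row a : (\sum_b m a b <= 2)%N.
Proof.
have [N [i1 _ _ cN]] := good_m (@std_frameP F mu) (@std_frameP F nu).
rewrite (eq_bigr _ (fun b _ => esym (cN a b))) card_row_transversal.
have pi : {in [set p in N | p.1.1 == a] &, injective (fun p => p.1.2)}.
  move=> [[a1 s1] t1] [[a2 s2] t2]; rewrite !inE /=.
  by move=> /andP[h1 /eqP e1] /andP[h2 /eqP e2] e3; apply: i1; rewrite //= e1 e2 e3.
by rewrite -(card_in_imset pi) (leq_trans (max_card _)) ?card_bool.
Qed.

Lemma good_col b : (\sum_a m a b <= 2)%N.
Proof.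
have [N [_ i2 _ cN]] := good_m (@std_frameP F mu) (@std_frameP F nu).
rewrite (eq_bigr _ (fun a _ => esym (cN a b))) card_col_transversal.
have pi : {in [set p in N | p.2.1 == b] &, injective (fun p => p.2.2)}.
  move=> [t1 [b1 s1]] [t2 [b2 s2]]; rewrite !inE /=.
  by move=> /andP[h1 /eqP e1] /andP[h2 /eqP e2] e3; apply: i2; rewrite //= e1 e2 e3.
by rewrite -(card_in_imset pi) (leq_trans (max_card _)) ?card_bool.
Qed.

Lemma support_degree g : (degree msupport g <= 2)%N.
Proof.
case: g => [a|b]; rewrite ?degree_inl ?degree_inr.
  apply: leq_trans (good_row a); apply: leq_sum => b _; rewrite inE /=.
  by case: (m a b).
apply: leq_trans (good_col b); apply: leq_sum => a _; rewrite inE /=.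
by case: (m a b).
Qed.

Lemma transversal_pick U V N a b : slot_transversal A U V m N -> (a, b) \in msupport ->
  exists s t, ((a, s), (b, t)) \in N.
Proof.
case=> _ _ _ cN; rewrite inE /= -cN card_gt0 => /set0Pn[[[a' s] [b' t]]].
by rewrite inE /= => /andP[h /eqP[<- <-]]; exists s, t.
Qed.

Lemma support_neq0 a b : (a, b) \in msupport -> A a b != 0.
Proof.
have [N tN] := good_m (@std_frameP F mu) (@std_frameP F nu).
move=> /(transversal_pick tN)[s [t h]]; case: tN => _ _ nz _.
apply: contraNneq (nz _ h) => A0; rewrite /entry /= A0 bilinE !mxE.
by rewrite !mul0r !addr0 !mulr0 addr0.
Qed.

(** Multiplicity two uses both row slots of [a] inside the block. If the block is singular, one of
    them is zero in a basis that starts with its left kernel. *)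
Lemma good_double_det a b : m a b = 2%N -> \det (A a b) != 0.
Proof.
move=> m2; have ab : (a, b) \in msupport by rewrite inE m2.
apply/negP => /eqP d0.
have u0 := left_ker_neq0 (support_neq0 ab); set u := left_ker _ in u0.
pose U (a' : 'I_mu) s := if s then u else other u.
have fU : frame U by move=> a'; exact: otherP.
have [N [i1 _ nz cN]] := good_m fU (@std_frameP F nu).
have /eqP := cN a b; rewrite m2 => /cards2P[p [q [npq E]]].
have [hp hq] : p \in [set p in N | (p.1.1, p.2.1) == (a, b)] /\
               q \in [set p in N | (p.1.1, p.2.1) == (a, b)].
  by rewrite E !inE !eqxx orbT.
move: hp hq npq; case: p E => [[a1 s1] [b1 t1]]; case: q => [[a2 s2] [b2 t2]] _.
rewrite !inE /= => /andP[h1 /eqP[e1 e1']] /andP[h2 /eqP[e2 e2']] ne; subst.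
have ns : s1 <> s2.
  by move=> es; case/eqP: ne; apply: i1; rewrite //= es.
case: s1 s2 h1 h2 ns {ne} => [] [] // h1 h2 _.
  by have := nz _ h1; rewrite /entry /= /u left_kerP ?eqxx.
by have := nz _ h2; rewrite /entry /= /u left_kerP ?eqxx.
Qed.

Lemma good_slots (U : node mu nu -> bool -> 'cV[F]_2) :
  (forall x, det2 (U x true) (U x false) != 0) ->
  exists sl : 'I_mu -> 'I_nu -> bool * bool,
    [/\ forall a b, (a, b) \in msupport ->
          bilin (A a b) (U (inl a) (sl a b).1) (U (inr b) (sl a b).2) != 0,
        forall a b b', (a, b) \in msupport -> (a, b') \in msupport -> b <> b' ->
          (sl a b).1 <> (sl a b').1
      & forall a a' b, (a, b) \in msupport -> (a', b) \in msupport -> a <> a' ->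
          (sl a b).2 <> (sl a' b).2].
Proof.
move=> fU; have [N tN] := good_m
    ((fun a => fU (inl a)) : frame (fun a => U (inl a)))
    ((fun b => fU (inr b)) : frame (fun b => U (inr b))).
pose sl a b := odflt (true, true) [pick st : bool * bool | ((a, st.1), (b, st.2)) \in N].
have slP a b : (a, b) \in msupport -> ((a, (sl a b).1), (b, (sl a b).2)) \in N.
  move=> /(transversal_pick tN)[s [t h]]; rewrite /sl; case: pickP => [//|/(_ (s, t))].
  by rewrite h.
case: tN => i1 i2 nz _; exists sl; split.
- by move=> a b /slP/nz.
- by move=> a b b' /slP h /slP h' nb e; case: nb; have := i1 _ _ h h'; rewrite /= e => /(_ erefl)[].
- by move=> a a' b /slP h /slP h' na e; case: na; have := i2 _ _ h h'; rewrite /= e => /(_ erefl)[].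
Qed.

Definition block (x y : node mu nu) : 'M[F]_2 :=
  match x, y with
  | inl a, inr b => A a b | inr b, inl a => (A a b)^T | _, _ => 0
  end.

Definition edge_color (sg : edge mu nu -> bool) (x y : node mu nu) : bool :=
  match x, y with inl a, inr b | inr b, inl a => sg (a, b) | _, _ => true end.

Section Swap.
Variables (sg : edge mu nu -> bool) (Y : {set node mu nu}).
Hypothesis sgP : proper_coloring msupport sg.
Hypothesis Y_neq0 : Y != finset.set0.
Hypothesis Y_full : forall x s, x \in Y -> exists y,
  [/\ y \in Y, adj msupport x y, edge_color sg x y = s & \det (block x y) != 0].

Let inY a b := ((a, b) \in msupport) && (inl a \in Y).

Lemma row_color_inj a b b' : (a, b) \in msupport -> (a, b') \in msupport ->
  sg (a, b) = sg (a, b') -> b = b'.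
Proof.
move=> h h' e; apply/eqP/negPn/negP => ne.
have := sgP (g := inl a) h h'; rewrite /= !eqxx xpair_eqE eqxx /= ne.
by move=> /(_ isT isT isT); rewrite e eqxx.
Qed.

Lemma col_color_inj a a' b : (a, b) \in msupport -> (a', b) \in msupport ->
  sg (a, b) = sg (a', b) -> a = a'.
Proof.
move=> h h' e; apply/eqP/negPn/negP => ne.
have := sgP (g := inr b) h h'; rewrite /= !eqxx xpair_eqE eqxx /= andbT ne.
by move=> /(_ isT isT isT); rewrite e eqxx.
Qed.

Lemma inY_ex a s : inl a \in Y -> exists b, [/\ inY a b, inr b \in Y, sg (a, b) = s
   & \det (A a b) != 0].
Proof.
move=> aY; have [[a'|b] [//]] := Y_full s aY.
by move=> bY abM cs dA; exists b; rewrite /inY aY andbT.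
Qed.

Lemma sum_two_le (I : finType) (f : I -> nat) i j : i != j -> (0 < f i)%N -> (0 < f j)%N ->
  (\sum_x f x <= 2)%N -> [/\ f i = 1%N, f j = 1%N, (\sum_x f x = 2)%N
    & forall x, x != i -> x != j -> f x = 0%N].
Proof.
move=> ij fi fj; rewrite (bigD1 i) //= (bigD1 j) ?[j == i]eq_sym //=; set r := bigop _ _ _ => le.
have r0 : r = 0%N by move: le fi fj; move: (f i) (f j) r => x y z; lia.
split; try by move: le fi fj; rewrite r0; move: (f i) (f j) => x y; lia.
move=> x xi xj; apply/eqP; rewrite -leqn0 -r0 /r (bigD1 x) ?xi ?xj //=.
exact: leq_addr.
Qed.

Lemma inY_row a : inl a \in Y -> (\sum_b m a b = 2)%N /\
  forall b, (a, b) \in msupport -> [/\ inr b \in Y, m a b = 1%N & \det (A a b) != 0].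
Proof.
move=> aY; have [b1 [/andP[h1 _] y1 s1 d1]] := inY_ex true aY.
have [b2 [/andP[h2 _] y2 s2 d2]] := inY_ex false aY.
have nb : b1 != b2 by apply: contra_eqN s1 => /eqP->; rewrite s2.
have := h1; have := h2; rewrite !inE /= => p2 p1.
have [m1 m2 -> z] := sum_two_le nb p1 p2 (good_row a).
split=> // b hb; have [->//|n1] := eqVneq b b1; have [->//|n2] := eqVneq b b2.
by move: hb; rewrite inE /= z.
Qed.

Lemma inY_col a b : inr b \in Y -> (a, b) \in msupport -> inl a \in Y.
Proof.
move=> bY ab.
have [[a1|b1] [//]] := Y_full true bY => y1 h1 s1 _; rewrite /= in h1 s1.
have [[a2|b1] [//]] := Y_full false bY => y2 h2 s2 _; rewrite /= in h2 s2.
case E : (sg (a, b)).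
  by rewrite (col_color_inj ab h1) // E s1.
by rewrite (col_color_inj ab h2) // E s2.
Qed.

Section Double.
Variable s : bool.

(** On the cycles in [Y] the two colour classes are perfect matchings; the one of colour [s] is
    taken twice. *)
Definition doubled a b : nat :=
  if inY a b then (if sg (a, b) == s then 2 else 0) else m a b.

Lemma doubled_row a : (\sum_b doubled a b = \sum_b m a b)%N.
Proof.
have [aY|aY] := boolP (inl a \in Y); last first.
  by apply: eq_bigr => b _; rewrite /doubled /inY (negbTE aY) andbF.
have [-> _] := inY_row aY; have [b [hb _ sb _]] := inY_ex s aY.
rewrite (bigD1 b) //= /doubled hb sb eqxx big1 ?addn0 // => b' nb.
case: ifPn => [/andP[hb' _]|]; last first.
  by rewrite /inY aY andbT inE /= -eqn0Ngt => /eqP.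
case: eqP => // sb'; case/andP: hb => hb _.
by rewrite (row_color_inj hb' hb) ?eqxx ?sb // in nb.
Qed.

(** The measure by which the induction in [good_matching] terminates. *)
Lemma doubled_count : (#|[set e : edge mu nu | doubled e.1 e.2 == 1]| <
  #|[set e : edge mu nu | m e.1 e.2 == 1]|)%N.
Proof.
have [a aY] : exists a, inl a \in Y.
  have /set0Pn[[a|b] yY] := Y_neq0; first by exists a.
  by have [[a|b'] [//]] := Y_full true yY; exists a.
have [b [hb _ _ _]] := inY_ex s aY.
apply/proper_card/properP; split.
  apply/fintype.subsetP => e; rewrite !inE /doubled; case: ifP => // _.
  by case: ifP.
exists (a, b); rewrite !inE /doubled /= ?hb.
  by have [_ /(_ b)[]] := inY_row aY; [case/andP: hb|move=> _ ->].
by case: ifP.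
Qed.

Lemma doubled_good : good A doubled.
Proof.
move=> U V fU fV; have [N tN] := good_m fU fV.
(* A nonsingular 2 by 2 matrix has a nonzero diagonal or a nonzero antidiagonal; [eps] selects the
   latter when the former fails. Outside [Y] the transversal [N] is kept. *)
pose eps a b := ~~ ((entry A U V (a, true) (b, true) != 0) &&
                    (entry A U V (a, false) (b, false) != 0)).
have epsP a b t : \det (A a b) != 0 -> entry A U V (a, t) (b, t (+) eps a b) != 0.
  move=> dA; rewrite /eps; case: (boolP (_ && _)) => [/andP[h1 h2]|]; first by case: t.
  rewrite negb_and !negbK => h.
  have := bilin_det (A a b) (U a true) (U a false) (V b true) (V b false).
  move=> E; have : \det (A a b) * (det2 (U a true) (U a false) * det2 (V b true) (V b false)) != 0.
    by rewrite !mulf_neq0.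
  rewrite -E; have -> : bilin (A a b) (U a true) (V b true) * bilin (A a b) (U a false) (V b false) = 0.
    by case/orP: h => /eqP; rewrite /entry /= => ->; rewrite ?mul0r ?mulr0.
  rewrite sub0r oppr_eq0 mulf_eq0 negb_or => /andP[h1 h2].
  by case: t; rewrite /entry.
case: (tN) => i1 i2 nz cN.
pose Nd := [set p : slot mu * slot nu | [&& inY p.1.1 p.2.1, sg (p.1.1, p.2.1) == s
   & p.2.2 == p.1.2 (+) eps p.1.1 p.2.1]].
pose No := [set p in N | inl p.1.1 \notin Y].
have suppN p : p \in N -> (p.1.1, p.2.1) \in msupport.
  move=> pN; rewrite inE /= -cN card_gt0; apply/set0Pn; exists p.
  by rewrite inE pN eqxx.
exists (No :|: Nd); split.
- move=> [[a1 s1] [b1 t1]] [[a2 s2] [b2 t2]]; rewrite !inE /= => h1 h2 [e1 e2]; subst a2 s2.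
  case/orP: h1 => [/andP[h1 y1]|/and3P[/andP[h1 y1] /eqP c1 /eqP r1]];
  case/orP: h2 => [/andP[h2 y2]|/and3P[/andP[h2 y2] /eqP c2 /eqP r2]].
  + exact: i1.
  + by rewrite y2 in y1.
  + by rewrite y1 in y2.
  + by have eb := row_color_inj h1 h2 (etrans c1 (esym c2)); rewrite r1 r2 eb.
- move=> [[a1 s1] [b1 t1]] [[a2 s2] [b2 t2]]; rewrite !inE /= => h1 h2 [e1 e2]; subst b2 t2.
  case/orP: h1 => [/andP[h1 y1]|/and3P[/andP[h1 y1] /eqP c1 /eqP r1]];
  case/orP: h2 => [/andP[h2 y2]|/and3P[/andP[h2 y2] /eqP c2 /eqP r2]].
  + exact: i2.
  + case/negP: y1; apply: (@inY_col _ b1); last exact: suppN h1.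
    by have [_ /(_ _ h2)[]] := inY_row y2.
  + case/negP: y2; apply: (@inY_col _ b1); last exact: suppN h2.
    by have [_ /(_ _ h1)[]] := inY_row y1.
  + have ea := col_color_inj h1 h2 (etrans c1 (esym c2)); rewrite ea in r1 *.
    by rewrite (_ : s1 = s2) //; apply: (can_inj (addbK (eps a2 b1))); rewrite -r1 -r2.
- move=> [[a1 s1] [b1 t1]]; rewrite !inE /= => /orP[/andP[h1 y1]|].
    exact: nz h1.
  case/and3P => /andP[h1 y1] _ /eqP ->; apply: epsP.
  by have [_ /(_ _ h1)[]] := inY_row y1.
- move=> a b; rewrite /doubled; case: ifPn => [hY|nY]; last first.
    rewrite -cN; apply: eq_card => -[[a1 s1] [b1 t1]]; rewrite !inE /=.
    case: (boolP ((a1, b1) == (a, b))) => [/eqP[-> ->]|]; last by rewrite !andbF.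
    rewrite !andbT (negbTE nY) /= orbF; case: (boolP (_ \in N)) => //= h.
    by move: nY; rewrite /inY (suppN _ h).
  case: eqP => [cs|cs]; last first.
    apply: eq_card0 => -[[a1 s1] [b1 t1]]; rewrite !inE /=.
    case: (boolP ((a1, b1) == (a, b))) => [/eqP[-> ->]|]; last by rewrite !andbF.
    case/andP: hY => _ ->; rewrite andbF /=.
    by case: eqP cs; rewrite ?andbF.
  have -> : [set p in No :|: Nd | (p.1.1, p.2.1) == (a, b)] =
     [set ((a, t), (b, t (+) eps a b)) | t : bool].
    apply/setP => -[[a1 s1] [b1 t1]]; apply/idP/imsetP => [|[t _ [-> -> -> ->]]].
      rewrite !inE /= => /andP[+ /eqP[e1 e2]]; subst a1 b1.
      case/orP => [/andP[_]|/and3P[_ _ /eqP ->]]; last by exists s1.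
      by case/andP: hY => _ ->.
    by rewrite !inE /= hY cs !eqxx orbT.
  by rewrite card_imset ?card_bool // => t t' [].
Qed.

End Double.

(** The two doublings change the weight by opposite amounts, so one of them does not lower it. *)
Lemma swap_exists (d : 'I_mu -> 'I_nu -> int) : exists m' : 'I_mu -> 'I_nu -> nat,
  [/\ good A m', (\sum_a \sum_b m' a b = \sum_a \sum_b m a b)%N,
      \sum_a \sum_b d a b *+ m a b <= \sum_a \sum_b d a b *+ m' a b
    & (#|[set e : edge mu nu | m' e.1 e.2 == 1]| < #|[set e : edge mu nu | m e.1 e.2 == 1]|)%N].
Proof.
pose W s := \sum_a \sum_b (if inY a b && (sg (a, b) == s) then d a b else 0).
pose s := W false <= W true.
have leW : W (~~ s) <= W s.
  by rewrite /s; case: (boolP (W false <= W true)) => //=; rewrite -ltNge => /ltW.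
exists (doubled s); split.
- exact: doubled_good.
- by apply: eq_bigr => a _; apply: doubled_row.
- suff -> : \sum_a \sum_b d a b *+ doubled s a b =
      \sum_a \sum_b d a b *+ m a b + (W s - W (~~ s)) by rewrite lerDl subr_ge0.
  rewrite /W -sumrB -big_split /=; apply: eq_bigr => a _.
  rewrite -sumrB -big_split /=; apply: eq_bigr => b _; rewrite /doubled.
  case: (boolP (inY a b)) => [/andP[hab aY]|] /=; last by rewrite !subr0 ?addr0.
  have [_ /(_ _ hab)[_ -> _]] := inY_row aY; rewrite mulr1n.
  by case: (sg (a, b)); case: (s) => /=; rewrite ?subr0 ?sub0r ?addrN ?mulr2n.
- exact: doubled_count.
Qed.

End Swap.
End GoodFacts.

(** * Lines, kernels and ranks in the plane *)

Section Lines.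
Variable F : fieldType.
Implicit Types (u v w : 'cV[F]_2) (B : 'M[F]_2) (X Y : line F).

Lemma vec10_neq0 : vec2 1 0 != 0 :> 'cV[F]_2.
Proof. by apply/eqP => /colP/(_ 0); rewrite !mxE => /eqP; rewrite oner_eq0. Qed.

Definition nz_vec u : 'cV[F]_2 := if u == 0 then vec2 1 0 else u.

Lemma nz_vec_neq0 u : nz_vec u != 0.
Proof. by rewrite /nz_vec; case: ifPn => // _; apply: vec10_neq0. Qed.

Lemma line_of_subproof u : \dim <[nz_vec u]>%VS == 1%N.
Proof. by rewrite dim_vline nz_vec_neq0. Qed.

Definition line_of u : line F := 
  exist (fun X : {vspace 'cV[F]_2} => \dim X == 1%N) _ (line_of_subproof u).

Lemma val_line_of u : u != 0 -> val (line_of u) = <[u]>%VS.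
Proof. by rewrite /= /nz_vec => /negbTE ->. Qed.

Lemma line_of_neq u v : det2 u v != 0 -> line_of u != line_of v.
Proof.
move=> d; have u0 := det2_neq0l d.
have v0 : v != 0 by move: d; rewrite det2C oppr_eq0 => /det2_neq0l.
apply: contraNneq d => /(congr1 val); rewrite !val_line_of // => E.
have : v \in <[u]>%VS by rewrite E memv_line.
by case/vlineP => c ->; rewrite /det2 !mxE; apply/eqP; ring.
Qed.

Lemma line_gen X : exists2 u, u != 0 & val X = <[u]>%VS.
Proof.
case: X => X dX /=; exists (vpick X).
  by rewrite vpick0 -dimv_eq0 (eqP dX).
apply/eqP; rewrite eq_sym eqEdim -memvE memv_pick /= (eqP dX) dim_vline.
by rewrite vpick0 -dimv_eq0 (eqP dX).
Qed.

Lemma line_gen_det X Y u v : X != Y -> u != 0 -> v != 0 ->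
  val X = <[u]>%VS -> val Y = <[v]>%VS -> det2 u v != 0.
Proof.
move=> nXY u0 v0 hX hY; apply: contraNneq nXY => /(det2_eq0 u0)[c vE].
have c0 : c != 0 by apply: contraNneq v0 => c0; rewrite vE c0 scale0r.
apply/eqP/val_inj; rewrite hX hY; apply/eqP; rewrite eqEsubv -!memvE.
apply/andP; split; apply/vlineP; last by exists c.
by exists c^-1; rewrite vE scalerA mulVf // scale1r.
Qed.

Lemma bilinZ B u v a b : bilin B (a *: u) (b *: v) = a * b * bilin B u v.
Proof. by rewrite !bilinE !mxE; ring. Qed.

Lemma bilin_set_line B u v :
  bilin_set B <[u]>%VS <[v]>%VS = [set 0]%classic <-> bilin B u v = 0.
Proof.
split=> [E|z].
  have : bilin_set B <[u]>%VS <[v]>%VS (bilin B u v).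
    by exists u; [exact: memv_line|exists v; [exact: memv_line|]].
  by rewrite E.
apply/seteqP; split=> [_ [_ /vlineP[a ->] [_ /vlineP[b ->] <-]]|_ ->].
  by rewrite /= bilinZ z mulr0.
exists 0; [exact: mem0v|exists 0; [exact: mem0v|]].
by rewrite bilinE !mxE; ring.
Qed.

Lemma mem_kerL B u : (u \in kerL B) = (u^T *m B == 0).
Proof.
have lin : linear (fun u : 'cV[F]_2 => u^T *m B).
  by move=> a x y; rewrite linearP /= mulmxDl -scalemxAl.
pose f : {linear 'cV[F]_2 -> 'rV[F]_2} :=
  HB.pack (fun u : 'cV[F]_2 => u^T *m B) (GRing.isLinear.Build F _ _ _ _ lin).
by rewrite memv_ker (lfunE f).
Qed.

Lemma mem_kerR B v : (v \in kerR B) = (B *m v == 0).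
Proof.
have lin : linear (fun v : 'cV[F]_2 => B *m v).
  by move=> a x y; rewrite mulmxDr -scalemxAr.
pose f : {linear 'cV[F]_2 -> 'cV[F]_2} :=
  HB.pack (fun v : 'cV[F]_2 => B *m v) (GRing.isLinear.Build F _ _ _ _ lin).
by rewrite memv_ker (lfunE f).
Qed.

Lemma kerLP B u : reflect (forall w, bilin B u w = 0) (u \in kerL B).
Proof.
rewrite mem_kerL; apply: (iffP eqP) => [E w|z]; first by rewrite /bilin E mul0mx mxE.
by apply/rowP => j; rewrite [RHS]mxE -[RHS](z (delta_mx j 0)) /bilin -colE [RHS]mxE.
Qed.

Lemma kerRP B v : reflect (forall w, bilin B w v = 0) (v \in kerR B).
Proof.
rewrite mem_kerR; apply: (iffP eqP) => [E w|z]; first by rewrite /bilin -mulmxA E mulmx0 mxE.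
apply/colP => i; rewrite [RHS]mxE -[RHS](z (delta_mx i 0)) /bilin trmx_delta -rowE -row_mul.
by rewrite [RHS]mxE.
Qed.

Lemma kerL_line B u : B != 0 -> u != 0 -> (forall w, bilin B u w = 0) -> kerL B = <[u]>%VS.
Proof.
move=> nB u0 z; apply/vspaceP => w; apply/kerLP/vlineP => [zw|[c ->] v]; last first.
  by have := bilinZ B u v c 1; rewrite scale1r => ->; rewrite z mulr0.
have [d0|d] := eqVneq (det2 u w) 0; first exact: det2_eq0 u0 d0.
case/eqP: nB; apply: (bilin_eq0 (v := vec2 1 0) (v' := vec2 0 1) d) => //.
by rewrite /det2 !vec2E mulr1 mulr0 subr0 oner_neq0.
Qed.

Lemma kerR_line B v : B != 0 -> v != 0 -> (forall w, bilin B w v = 0) -> kerR B = <[v]>%VS.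
Proof.
move=> nB v0 z; apply/vspaceP => w; apply/kerRP/vlineP => [zw|[c ->] u]; last first.
  by have := bilinZ B u v 1 c; rewrite scale1r => ->; rewrite z mulr0.
have [d0|d] := eqVneq (det2 v w) 0; first exact: det2_eq0 v0 d0.
case/eqP: nB; apply: (bilin_eq0 (u := vec2 1 0) (u' := vec2 0 1) _ d) => //.
by rewrite /det2 !vec2E mulr1 mulr0 subr0 oner_neq0.
Qed.

Lemma rank1_det B : B != 0 -> (\rank B == 1%N) = (\det B == 0).
Proof.
move=> nB; have := rank_leq_row B; have : (0 < \rank B)%N by rewrite lt0n mxrank_eq0.
have : (\rank B == 2%N) = (\det B != 0) by rewrite -unitfE -[RHS]/(B \in unitmx) -row_free_unit.
by case: (\rank B) => [|[|[|]]] //= /esym; case: (\det B == 0).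
Qed.

Lemma rank2_det B : (\rank B == 2%N) = (\det B != 0).
Proof. by rewrite -unitfE -[RHS]/(B \in unitmx) -row_free_unit. Qed.

End Lines.

Lemma ucycle_neighbours (T : finType) (e : rel T) s x :
  ssrbool.symmetric e -> ucycle e s -> (2 < size s)%N -> x \in s ->
  exists y z, [/\ y \in s, z \in s, e x y, e x z & y != z].
Proof.
move=> e_sym /andP[cs us] ss xs; exists (next s x), (prev s x); split.
- by rewrite mem_next.
- by rewrite mem_prev.
- exact: next_cycle.
- by rewrite e_sym prev_cycle.
have [i s' E] := rot_to xs.
rewrite -(next_rot i us) -(prev_rot i us) E.
move: ss us; rewrite -(size_rot i) -(rot_uniq i) E; case: s' {E} => [|y [|z s']] //= _.
rewrite eqxx !inE !negb_or => /and3P[/and3P[xy xz xs'] /andP[yz ys'] _].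
rewrite (negbTE xy) (negbTE xz).
have prevE w l : x \notin l -> prev_at x x w l = last w l.
  by elim: l w => [|w' l IH] w /=; rewrite ?eqxx // inE negb_or => /andP[/negbTE ->]; apply: IH.
rewrite prevE //; apply: contraNneq ys' => yE.
have := mem_last z s'; rewrite -yE inE eq_sym => /orP[/eqP zy|//].
by rewrite zy eqxx in yz.
Qed.

Section GoodMatching.
Variables (F : fieldType) (mu nu : nat) (A : 'I_mu -> 'I_nu -> 'M[F]_2).
Variable (d : 'I_mu -> 'I_nu -> int).

Lemma sum_edge_set (T : zmodType) (w : 'I_mu -> 'I_nu -> T) (P : 'I_mu -> 'I_nu -> bool) :
  \sum_(e in [set e : edge mu nu | P e.1 e.2]) w e.1 e.2 =
  \sum_a \sum_b w a b *+ P a b.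
Proof.
rewrite big_mkcond pair_bigA /=; apply: eq_bigr => e _; rewrite inE.
by case: ifP.
Qed.

Lemma card_edge_set (P : 'I_mu -> 'I_nu -> bool) :
  #|[set e : edge mu nu | P e.1 e.2]| = (\sum_a \sum_b P a b)%N.
Proof.
rewrite -sum1_card big_mkcond pair_bigA /=; apply: eq_bigr => e _; rewrite inE.
by case: ifP.
Qed.

Lemma good_le2 m a b : good A m -> (m a b <= 2)%N.
Proof.
move=> gm; apply: leq_trans (good_row gm a).
by rewrite (bigD1 b) //= leq_addr.
Qed.

Lemma good_degree1 m a b : good A m -> m a b = 2%N ->
  Defs.isolated (msupport m) (a, b).
Proof.
move=> gm m2; rewrite /Defs.isolated inE /= m2 /= degree_inl degree_inr.
apply/andP; split.
  rewrite (bigD1 b) //= inE /= m2 big1 // => b' nb; rewrite inE /=.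
  have := good_row gm a; rewrite (bigD1 b) //= m2 (bigD1 b') //=.
  by case: (m a b').
rewrite (bigD1 a) //= inE /= m2 big1 // => a' na; rewrite inE /=.
have := good_col gm b; rewrite (bigD1 a) //= m2 (bigD1 a') //=.
by case: (m a' b).
Qed.

Lemma good_pseudo_matching m sg : good A m -> proper_coloring (msupport m) sg ->
  (forall Y : {set node mu nu}, Y != finset.set0 ->
    ~ (forall x s, x \in Y -> exists y, [/\ y \in Y, adj (msupport m) x y,
        edge_color sg x y = s & \det (block A x y) != 0])) ->
  pseudo_matching A (msupport m).
Proof.
move=> gm sgP noY.
pose M := msupport m.
have nA a b : (a, b) \in M -> A a b != 0 by exact: support_neq0.
split.
- by apply/fintype.subsetP => -[a b] /nA h; rewrite inE.
- exact: support_degree gm.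
(* Without a rank-one edge the nodes of the cycle form a full set: the two neighbours of a node
   along the cycle are joined to it by edges of different colours. *)
- move=> s [us ss cs]; apply/not_notP => noR.
  apply: (noY [set x in s]).
    by apply/set0Pn; case: s us ss {cs noR} => // x s _ _; exists x; rewrite !inE eqxx.
  have rk a b : (a, b) \in M -> inl a \in s -> \det (A a b) != 0.
    move=> h hs; rewrite -rank1_det ?nA //; apply/eqP => r1.
    by apply: noR; exists (a, b).
  move=> x c; rewrite inE => xs.
  have [y [z [ys zs exy exz yz]]] := ucycle_neighbours (@adj_sym _ _ M) us ss xs.
  have dd w : w \in s -> adj M x w -> \det (block A x w) != 0.
    move=> ws; case: x w xs ws {exy exz} => [a|b] [a'|b'] //= xs ws h; first exact: rk.
    by rewrite det_tr rk.
  have : edge_color sg x y != edge_color sg x z.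
    case: x y z xs exy exz yz {ys zs dd} => [a|b] [a1|b1] [a2|b2] //= xs h1 h2 n12.
      apply: (sgP (inl a)); rewrite /= ?eqxx //.
      by rewrite xpair_eqE eqxx /=.
    apply: (sgP (inr b)); rewrite /= ?eqxx //.
    by rewrite xpair_eqE eqxx andbT.
  have [cy _|ny nyz] := eqVneq (edge_color sg x y) c.
    by exists y; rewrite inE ys exy cy dd.
  exists z; rewrite inE zs exz dd //; split=> //.
  by case: (edge_color sg x z) (edge_color sg x y) c ny nyz => [] [] [].
- exists sg => //.
  have [||||||||L [fL LP]] := @labels_exist F (node mu nu) (adj M)
      (fun x => if x is inl _ then true else false) (block A) (edge_color sg).
  + exact: adj_sym.
  + by move=> [a|b] [a'|b'].
  + by move=> [a|b] [a'|b'] /=; rewrite ?trmxK ?trmx0.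
  + by move=> [a|b] [a'|b'] //= h; rewrite ?trmx_eq0 nA.
  + by move=> [a|b] [a'|b'].
  + move=> [a|b] [a1|b1] [a2|b2] //= h1 h2 e.
      by rewrite (row_color_inj sgP h1 h2 e).
    by rewrite (col_color_inj sgP h1 h2 e).
  + exact: noY.
  + move=> U fU; have [sl [sl1 sl2 sl3]] := good_slots gm fU.
    exists (fun x y => match x, y with
      | inl a, inr b => (sl a b).1 | inr b, inl a => (sl a b).2 | _, _ => true end).
    split.
      by move=> [a|b] [a'|b'] //= h; rewrite ?bilin_tr sl1.
    move=> [a|b] [a1|b1] [a2|b2] //= h1 h2 n12.
      by apply: sl2 => // e; apply: n12; rewrite e.
    by apply: sl3 => // e; apply: n12; rewrite e.
  have L0 x s : L x s != 0.
    case: s; first exact: det2_neq0l (fL x).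
    by have := fL x; rewrite det2C oppr_eq0 => /det2_neq0l.
  exists (@Labeling F mu nu (fun x => line_of (L x true)) (fun x => line_of (L x false))
    (fun x => line_of_neq (fL x))) => a b h /=.
  have nzE x s : nz_vec (L x s) = L x s by rewrite /nz_vec (negbTE (L0 x s)).
  rewrite !nzE.
  have [h1 h2] := LP (inl a) (inr b) h; have [h3 h4] := LP (inr b) (inl a) h.
  rewrite /= !bilin_tr in h1 h2 h3 h4.
  split.
  + by apply/bilin_set_line; move: h1 h3; case: (sg (a, b)).
  + by apply/bilin_set_line; move: h1 h3; case: (sg (a, b)).
  + move=> /eqP; rewrite rank1_det ?nA // => /eqP d0.
    have k1 := h2 d0; have k2 : forall w, bilin (A a b) w (L (inr b) (sg (a, b))) = 0.
      by move=> w; rewrite -bilin_tr h4 // det_tr.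
    rewrite (kerL_line (nA _ _ h) (L0 _ _) k1) (kerR_line (nA _ _ h) (L0 _ _) k2).
    by case: (sg (a, b)).
Qed.

Theorem good_matching m : good A m -> exists M I, [/\ matching_pair A M I,
  (#|M| + #|I| = \sum_a \sum_b m a b)%N & \sum_a \sum_b d a b *+ m a b <= weight d M I].
Proof.
have [n] := ubnP #|[set e : edge mu nu | m e.1 e.2 == 1%N]|.
elim: n m => // n IHn m ltn gm.
have [sg sgP] := edge_coloring (support_degree gm).
have [[Y [Y0 Yf]]|noY] := pselect (exists Y : {set node mu nu}, Y != finset.set0 /\
    (forall x s, x \in Y -> exists y, [/\ y \in Y, adj (msupport m) x y,
        edge_color sg x y = s & \det (block A x y) != 0])).
  have [m' [gm' sm' wm' lt']] := swap_exists gm sgP Y0 Yf d.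
  have [|M [I [mp sz wt]]] := IHn m' _ gm'.
    by rewrite -ltnS (leq_trans _ ltn) // ltnS.
  by exists M, I; split; [|rewrite sz|exact: le_trans wt].
(* With all full sets gone, an exponent one is an edge counted in [M] only, and an exponent two an
   isolated rank-two edge counted in both [M] and [I]. *)
exists (msupport m), [set e | m e.1 e.2 == 2%N]; split.
- split; first by apply: (good_pseudo_matching gm sgP) => Y Y0 Yf; apply: noY; exists Y.
  move=> [a b]; rewrite inE /= => /eqP m2; split; first exact: good_degree1.
  by apply/eqP; rewrite rank2_det (good_double_det gm).
- rewrite (card_edge_set (fun a b => 0 < m a b)%N) (card_edge_set (fun a b => m a b == 2%N)).
  rewrite -big_split /=; apply: eq_bigr => a _; rewrite -big_split /=; apply: eq_bigr => b _.
  by have := good_le2 a b gm; case: (m a b) => [|[|[|]]].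
- rewrite /weight (sum_edge_set d (fun a b => 0 < m a b)%N) (sum_edge_set d (fun a b => m a b == 2%N)).
  rewrite -big_split /= ler_sum // => a _; rewrite -big_split /= ler_sum // => b _.
  by have := good_le2 a b gm; case: (m a b) => [|[|[|]]] //= _;
     rewrite ?mulr0n ?mulr1n ?addr0 ?mulr2n.
Qed.

End GoodMatching.

(** * From matching-pairs to monomials *)

Section CycleComponent.
Variables (mu nu : nat) (M : {set edge mu nu}) (sg : edge mu nu -> bool).
Hypothesis sgP : proper_coloring M sg.
Variable Y : {set node mu nu}.
Hypothesis Y_neq0 : Y != finset.set0.
Hypothesis Y_full : forall x c, x \in Y -> exists y,
  [/\ y \in Y, adj M x y & edge_color sg x y = c].

Let is_row (x : node mu nu) := if x is inl _ then true else false.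

Lemma adj_is_row x y : adj M x y -> is_row y = ~~ is_row x.
Proof. by case: x y => [a|b] [a'|b']. Qed.

Lemma edge_color_sym x y : edge_color sg y x = edge_color sg x y.
Proof. by case: x y => [a|b] [a'|b']. Qed.

Lemma edge_color_inj x y z : adj M x y -> adj M x z ->
  edge_color sg x y = edge_color sg x z -> y = z.
Proof.
move=> h1 h2 e; apply/eqP/negPn/negP => yz.
have := sgP; case: x y z h1 h2 e yz => [a|b] [a1|b1] [a2|b2] //= h1 h2 e yz sgP'.
  have := sgP' (inl a) _ _ h1 h2; rewrite /= eqxx xpair_eqE eqxx /= yz e eqxx.
  by move=> /(_ isT isT isT).
have := sgP' (inr b) _ _ h1 h2; rewrite /= eqxx xpair_eqE eqxx andbT yz e eqxx.
by move=> /(_ isT isT isT).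
Qed.

(** Rows are left along colour [true] and columns along colour [false]. As edges change sides, this
    walks around each cycle in one direction. *)
Let turn x := if x \in Y then
  odflt x [pick y in Y | adj M x y && (edge_color sg x y == is_row x)] else x.

Lemma turnP x : x \in Y ->
  [/\ turn x \in Y, adj M x (turn x) & edge_color sg x (turn x) = is_row x].
Proof.
move=> xY; rewrite /turn xY; case: pickP => [y /and3P[? ? /eqP ?] //|].
have [y [yY xy cy]] := Y_full (is_row x) xY.
by move=> /(_ y); rewrite yY xy cy eqxx.
Qed.

Lemma turn_inj : injective turn.
Proof.
move=> x x' e; have [xY|xY] := boolP (x \in Y); have [x'Y|x'Y] := boolP (x' \in Y).
- have [_ h1 h2] := turnP xY; have [_ h1' h2'] := turnP x'Y; rewrite -e in h1' h2'.
  apply: (@edge_color_inj (turn x)); rewrite 1?adj_sym //.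
  rewrite edge_color_sym h2 edge_color_sym h2'.
  by apply: negb_inj; rewrite -(adj_is_row h1) -(adj_is_row h1').
- by have [+ _ _] := turnP xY; rewrite e /turn (negbTE x'Y) (negbTE x'Y).
- by have [+ _ _] := turnP x'Y; rewrite -e /turn (negbTE xY) (negbTE xY).
- by move: e; rewrite /turn (negbTE xY) (negbTE x'Y).
Qed.

Lemma exists_cycle_component : exists2 s, cycle_component M s & {subset s <= Y}.
Proof.
have [x0 x0Y] : exists x, x \in Y by apply/set0Pn.
have iterY x n : x \in Y -> iter n turn x \in Y.
  by move=> xY; elim: n => //= n /turnP[].
have orbY x y : x \in Y -> fconnect turn x y -> y \in Y.
  by move=> xY /iter_findex <-; apply: iterY.
have sY : {subset fingraph.orbit turn x0 <= Y}.
  by move=> y; rewrite -fconnect_orbit; apply: orbY.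
exists (fingraph.orbit turn x0) => //; split.
- rewrite /ucycle orbit_uniq andbT.
  have := cycle_orbit turn_inj x0; apply: (@sub_in_cycle _ (mem Y)).
    by move=> x y xY yY /eqP <-; have [] := turnP xY.
  by apply/allP => y /sY.
(* An orbit of length one contradicts the change of sides; one of length two would give a single
   edge both colours. *)
- rewrite size_orbit; have := fingraph.order_gt0 turn x0; have := iter_order turn_inj x0.
  have [t1 a1 c1] := turnP x0Y; have [t2 a2 c2] := turnP t1.
  case: (fingraph.order turn x0) => [|[|[|n]]] //= e.
    by have := adj_is_row a1; rewrite e; case: (is_row x0).
  rewrite e edge_color_sym c1 in c2.
  by move: (adj_is_row a1); rewrite -c2; case: (is_row x0).
move=> g gs y.
have gY := sY _ gs.
(* The neighbours of a node are its images under [turn] and its inverse, so the orbit is closed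
   under adjacency. *)
have step z w : z \in fingraph.orbit turn x0 -> adj M z w -> w \in fingraph.orbit turn x0.
  move=> zs zw; have zY := sY _ zs; have [t1 a1 c1] := turnP zY.
  have [ec|nec] := eqVneq (edge_color sg z w) (is_row z).
    rewrite (edge_color_inj zw a1) ?ec ?c1 //.
    by rewrite -fconnect_orbit (connect_trans _ (fconnect1 _ _)) // fconnect_orbit.
  have fz : finv turn z \in fingraph.orbit turn x0.
    by rewrite -fconnect_orbit (connect_trans _ (fconnect_finv _ _)) // fconnect_orbit.
  have [] := turnP (sY _ fz); rewrite f_finv; last exact: turn_inj.
  move=> _ a2 c2; rewrite (@edge_color_inj z w (finv turn z)) // 1?adj_sym //.
  rewrite (edge_color_sym (finv turn z) z) c2.
  move: nec; rewrite (adj_is_row a2).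
  by case: (edge_color sg z w) (is_row (finv turn z)) => [] [].
apply/idP/idP => [/connectP[p]|ys].
  elim: p g gs {gY} => [|z p IH] g gs /=; first by move=> _ ->.
  by move=> /andP[gz pz]; apply: (IH z (step _ _ gs gz) pz).
have gy : fconnect turn g y.
  apply: (@connect_trans _ _ x0); last by rewrite fconnect_orbit.
  by rewrite fconnect_sym ?fconnect_orbit //; exact: turn_inj.
rewrite -(iter_findex gy); elim: (findex _ _ _) => [|n IH] /=; first exact: connect0.
apply: connect_trans IH _; apply: connect1.
by have [] := turnP (iterY g n gY).
Qed.

End CycleComponent.

Section MatchingMinor.
Variables (F : fieldType) (mu nu : nat) (A : 'I_mu -> 'I_nu -> 'M[F]_2).
Variables (d : 'I_mu -> 'I_nu -> int) (M I : {set edge mu nu}).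
Variables (sg : edge mu nu -> bool) (U : 'I_mu -> bool -> 'cV[F]_2) (W : 'I_nu -> bool -> 'cV[F]_2).
Hypothesis sgP : proper_coloring M sg.
Hypothesis M_cycle : forall s, cycle_component M s ->
  exists2 e, e \in M & inl e.1 \in s /\ \det (A e.1 e.2) = 0.
Hypothesis I_isolated : forall e, e \in I -> Defs.isolated M e /\ \det (A e.1 e.2) != 0.
Hypothesis M_diag : forall a b s t, (a, b) \in M ->
  bilin (A a b) (U a s) (W b t) != 0 -> s = t.
Hypothesis M_used : forall a b, (a, b) \in M ->
  bilin (A a b) (U a (~~ sg (a, b))) (W b (~~ sg (a, b))) != 0.
Hypothesis M_rank1 : forall a b, (a, b) \in M -> \det (A a b) = 0 ->
  bilin (A a b) (U a (sg (a, b))) (W b (sg (a, b))) = 0.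
Hypothesis M_rank2 : forall a b, (a, b) \in M -> \det (A a b) != 0 ->
  bilin (A a b) (U a (sg (a, b))) (W b (sg (a, b))) != 0.

(** The intended transversal. An edge is used in the slots of the sign opposite to its colour, since
    a rank-one edge vanishes in those of its own sign; edges of [I] are used in both. Proper colours
    keep the slots at a node distinct. *)
Let N : {set slot mu * slot nu} := [set p | [&& (p.1.1, p.2.1) \in M, p.1.2 == p.2.2
  & (p.1.2 == ~~ sg (p.1.1, p.2.1)) || ((p.1.1, p.2.1) \in I)]].

Lemma notin_isolated g e e' : e \in M -> e' \in M -> e != e' ->
  incident g e -> incident g e' -> e \notin I.
Proof.
move=> eM e'M ne ig ig'; apply/negP => /I_isolated[/and3P[_ d1 d2] _].
have := degree_ge2 eM e'M ig ig' ne.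
by case: g ig {ig'} => [a|b] /= /eqP <-; rewrite ?(eqP d1) ?(eqP d2).
Qed.

Lemma N_fst : {in N &, injective fst}.
Proof.
move=> [[a s] [b t]] [[a' s'] [b' t']]; rewrite !inE /= => /and3P[h /eqP <- c].
move=> /and3P[h' /eqP <- c'] [ea es]; subst a' s'.
have [<-//|nb] := eqVneq b b'.
have ne : (a, b) != (a, b') by rewrite xpair_eqE eqxx.
have := sgP (g := inl a) h h' ne; rewrite /= eqxx => /(_ isT isT).
move: c c'; rewrite (negbTE (notin_isolated (g := inl a) h h' ne _ _)) //=.
rewrite eq_sym in ne.
rewrite (negbTE (notin_isolated (g := inl a) h' h ne _ _)) //= !orbF.
by move=> /eqP -> /eqP /negb_inj ->; rewrite eqxx.
Qed.

Lemma N_snd : {in N &, injective snd}.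
Proof.
move=> [[a s] [b t]] [[a' s'] [b' t']]; rewrite !inE /= => /and3P[h /eqP -> c].
move=> /and3P[h' /eqP -> c'] [ea es]; subst b' t'.
have [<-//|na] := eqVneq a a'.
have ne : (a, b) != (a', b) by rewrite xpair_eqE eqxx andbT.
have := sgP (g := inr b) h h' ne; rewrite /= eqxx => /(_ isT isT).
move: c c'; rewrite (negbTE (notin_isolated (g := inr b) h h' ne _ _)) //=.
rewrite eq_sym in ne.
rewrite (negbTE (notin_isolated (g := inr b) h' h ne _ _)) //= !orbF.
by move=> /eqP -> /eqP /negb_inj ->; rewrite eqxx.
Qed.

Lemma I_sub e : e \in I -> e \in M.
Proof. by case/I_isolated => /and3P[]. Qed.

Lemma N_edge a b : (a, b) \in M -> ((a, ~~ sg (a, b)), (b, ~~ sg (a, b))) \in N.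
Proof. by move=> h; rewrite inE /= h !eqxx. Qed.

Lemma sum_N (T : nmodType) (w : 'I_mu -> 'I_nu -> T) :
  \sum_(p in N) w p.1.1 p.2.1 = \sum_(e in M) w e.1 e.2 + \sum_(e in I) w e.1 e.2.
Proof.
rewrite (bigID (fun p : slot mu * slot nu => p.1.2 == ~~ sg (p.1.1, p.2.1))) /=.
congr (_ + _).
  pose h (e : edge mu nu) := ((e.1, ~~ sg e), (e.2, ~~ sg e)).
  have hi : {in M &, injective h} by move=> [a b] [a' b'] _ _ [-> _ ->].
  rewrite -(big_imset (fun p : slot mu * slot nu => w p.1.1 p.2.1) hi) /=.
  apply: eq_bigl => -[[a s] [b t]]; rewrite inE /=; apply/andP/imsetP => /=.
    by case=> /and3P[hM /eqP <- _] /eqP ->; exists (a, b).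
  by case=> -[a' b'] hM [-> -> -> ->]; rewrite hM !eqxx.
pose h (e : edge mu nu) := ((e.1, sg e), (e.2, sg e)).
have hi : {in I &, injective h} by move=> [a b] [a' b'] _ _ [-> _ ->].
rewrite -(big_imset (fun p : slot mu * slot nu => w p.1.1 p.2.1) hi) /=.
apply: eq_bigl => -[[a s] [b t]]; rewrite inE /=; apply/andP/imsetP => /=.
  case=> /and3P[hM /eqP <-]; case: eqP => //= ns hI _; exists (a, b) => //.
  by rewrite /h /= (_ : s = sg (a, b)) //; case: s (sg _) ns => [] [].
case=> -[a' b'] hI [-> -> -> ->] /=; rewrite (I_sub hI) hI !eqxx orbT.
by case: (sg _).
Qed.

Section Unique.
Variables (k : nat) (h : 'I_k -> slot mu * slot nu).
Hypotheses (h_inj : injective h) (h_im : [set h i | i in 'I_k] = N).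
Local Notation f := (fun i => (h i).1).
Local Notation g := (fun i => (h i).2).

Lemma mem_enum_N i : h i \in N. Proof. by rewrite -h_im imset_f. Qed.

Lemma enum_N_row_inj : injective f.
Proof. by move=> i j e; apply: h_inj; apply: N_fst => //; apply: mem_enum_N. Qed.

Lemma enum_N_col_inj : injective g.
Proof. by move=> i j e; apply: h_inj; apply: N_snd => //; apply: mem_enum_N. Qed.

(** Call an edge outside [I] flipped if it is used in the slots of its own sign. In [N] these slots
    belong to the other edges at its two ends. The monomial forces those edges to be used as well,
    so they are flipped in turn. The flipped edges thus contain a cycle component, but the rank-one
    edge of that cycle vanishes in its own sign. *)
Lemma perm_one (s : {perm 'I_k}) :
  perm_mon f g s = perm_mon f g 1 ->
  (forall i, entry A U W (f i) (g (s i)) != 0) -> s = 1%g.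
Proof.
move=> ms nz.
have cnt e : #|[set i | ((h i).1.1, (h (s i)).2.1) == e]| =
             #|[set i | ((h i).1.1, (h i).2.1) == e]|.
  case: e => a b; have := congr1 (fun m : multinom _ => m (mxvec_index a b)) ms.
  rewrite !perm_monE => ->; apply: eq_card => i; rewrite !inE perm1 //.
have usedM i : ((h i).1.1, (h (s i)).2.1) \in M.
  have : (0 < #|[set j | ((h j).1.1, (h (s j)).2.1) == ((h i).1.1, (h (s i)).2.1)]|)%N.
    by rewrite card_gt0; apply/set0Pn; exists i; rewrite inE.
  rewrite cnt card_gt0 => /set0Pn[j]; rewrite inE => /eqP <-.
  by have := mem_enum_N j; rewrite inE => /and3P[].
have Mused e : e \in M -> exists i, ((h i).1.1, (h (s i)).2.1) = e.
  move=> eM; have : (0 < #|[set j | ((h j).1.1, (h (s j)).2.1) == e]|)%N.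
    rewrite cnt card_gt0; apply/set0Pn; case: e eM => a b /N_edge.
    by rewrite -h_im => /imsetP[j _ hj]; exists j; rewrite inE -hj.
  by rewrite card_gt0 => /set0Pn[i]; rewrite inE => /eqP <-; exists i.
have diag i : (h i).1.2 = (h (s i)).2.2.
  by apply: (M_diag (usedM i)); have := nz i; rewrite /entry.
pose flip e := (e \notin I) && [exists i, (((h i).1.1, (h (s i)).2.1) == e) && ((h i).1.2 == sg e)].
have flipP a b : flip (a, b) -> (a, b) \notin I /\ exists i,
    [/\ (h i).1 = (a, sg (a, b)), (h (s i)).2 = (b, sg (a, b)) & (a, b) \in M].
  case/andP => nI /existsP[i /andP[/eqP e /eqP es]]; split=> //; exists i.
  have := usedM i; rewrite e => abM; split=> //.
    by rewrite [LHS]surjective_pairing es; case: e => ->.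
  by rewrite [LHS]surjective_pairing -diag es; case: e => _ ->.
have flip_det a b : flip (a, b) -> \det (A a b) != 0.
  case/flipP => _ [i [h1 h2 abM]]; apply/negP => /eqP d0.
  by have := nz i; rewrite /entry h1 h2 /= M_rank1 ?eqxx.
have flip_row a b : flip (a, b) -> exists2 b', flip (a, b') & sg (a, b') = ~~ sg (a, b).
  move=> fl; have [nI [i [h1 h2 abM]]] := flipP _ _ fl.
  have := mem_enum_N i; rewrite inE [h i]surjective_pairing h1 /=.
  case E : (h i).2 => [b2 t2] /= /and3P[a2M /eqP et c2].
  have ne : (a, b) != (a, b2).
    apply: contraNneq nI => -[eb]; rewrite eb; move: c2; rewrite eb.
    by case: (sg (a, b2)).
  have nsg : sg (a, b2) = ~~ sg (a, b).
    have := sgP (g := inl a) abM a2M ne; rewrite /= eqxx => /(_ isT isT).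
    by case: (sg (a, b)) (sg (a, b2)) => [] [].
  exists b2 => //; apply/andP; split.
    by apply: (notin_isolated (g := inl a) a2M abM _ (eqxx a) (eqxx a)); rewrite eq_sym.
  have [j ej] := Mused _ a2M; apply/existsP; exists j; rewrite ej eqxx /= nsg.
  apply/eqP; have : (h j).1.2 <> sg (a, b).
    move=> ejs; have hj : (h j).1 = (h i).1.
      by rewrite h1 [LHS]surjective_pairing ejs; case: ej => ->.
    move/enum_N_row_inj: hj => eji; case/eqP: ne; rewrite -ej eji h1 h2 //.
  by case: ((h j).1.2) (sg (a, b)) => [] [].
have flip_col a b : flip (a, b) -> exists2 a', flip (a', b) & sg (a', b) = ~~ sg (a, b).
  move=> fl; have [nI [i [h1 h2 abM]]] := flipP _ _ fl.
  have := mem_enum_N (s i); rewrite inE [h (s i)]surjective_pairing h2 /=.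
  case E : (h (s i)).1 => [a2 t2] /= /and3P[a2M /eqP et c2].
  have ne : (a, b) != (a2, b).
    apply: contraNneq nI => -[eb]; rewrite eb; move: c2; rewrite et eb.
    by case: (sg (a2, b)).
  have nsg : sg (a2, b) = ~~ sg (a, b).
    have := sgP (g := inr b) abM a2M ne; rewrite /= eqxx => /(_ isT isT).
    by case: (sg (a, b)) (sg (a2, b)) => [] [].
  exists a2 => //; apply/andP; split.
    by apply: (notin_isolated (g := inr b) a2M abM _ (eqxx b) (eqxx b)); rewrite eq_sym.
  have [j ej] := Mused _ a2M; apply/existsP; exists j; rewrite ej eqxx /= nsg.
  apply/eqP; have : (h j).1.2 <> sg (a, b).
    move=> ejs; have hj : (h (s j)).2 = (h (s i)).2.
      by rewrite h2 [LHS]surjective_pairing -diag ejs; case: ej => _ ->.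
    move/enum_N_col_inj/perm_inj: hj => eji; case/eqP: ne; rewrite -ej eji h1 h2 //.
  by case: ((h j).1.2) (sg (a, b)) => [] [].
apply/permP => i; rewrite perm1; apply/eqP/negPn/negP => si.
(* Where [s] moves [i], the row slot of [h i] is used by a different edge of the same node. That
   edge has the other colour, so this slot has its own sign. *)
have [e0 fl0] : exists e, flip e.
  exists ((h i).1.1, (h (s i)).2.1).
  have := mem_enum_N i; rewrite inE => /and3P[hM /eqP ht hc].
  have ne : ((h i).1.1, (h (s i)).2.1) != ((h i).1.1, (h i).2.1).
    rewrite xpair_eqE eqxx /=; apply: contraNneq si => e2; apply/eqP/enum_N_col_inj.
    by rewrite [LHS]surjective_pairing [RHS]surjective_pairing e2 -diag ht.
  have nI' := notin_isolated (g := inl (h i).1.1) (usedM i) hM ne (eqxx _) (eqxx _).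
  rewrite /flip nI' /=; apply/existsP; exists i; rewrite eqxx /=.
  have := sgP (g := inl (h i).1.1) (usedM i) hM ne (eqxx _) (eqxx _).
  rewrite eq_sym in ne.
  have nI := notin_isolated (g := inl (h i).1.1) hM (usedM i) ne (eqxx _) (eqxx _).
  move: hc; rewrite (negbTE nI) orbF => /eqP ->.
  by case: (sg _) (sg _) => [] [].
pose Y := [set x : node mu nu | [exists e, flip e && incident x e]].
have Y0 : Y != finset.set0.
  by apply/set0Pn; exists (inl e0.1); rewrite inE; apply/existsP; exists e0; rewrite fl0 /= eqxx.
have flipM e : flip e -> e \in M by case: e => a b /flipP[_ [j [_ _]]].
have YP x c : x \in Y -> exists y, [/\ y \in Y, adj M x y, edge_color sg x y = c
    & forall a b, (a, b) = match x, y with inl a, inr b | inr b, inl a => (a, b) | _, _ => (a, b) end -> flip (a, b)].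
  rewrite inE => /existsP[[a b] /andP[fl]]; case: x => [a0|b0] /= /eqP e; rewrite e in fl.
    have [b' fl' sg'] : exists2 b', flip (a0, b') & sg (a0, b') = c.
      have [<-|nc] := eqVneq (sg (a0, b)) c; first by exists b.
      have [b' fl' sg'] := flip_row _ _ fl; exists b' => //.
      by rewrite sg'; case: (sg _) c nc => [] [].
    exists (inr b'); split=> //; [|exact: flipM|by move=> ? ? [-> ->]].
    by rewrite inE; apply/existsP; exists (a0, b'); rewrite fl' /= eqxx.
  have [a' fl' sg'] : exists2 a', flip (a', b0) & sg (a', b0) = c.
    have [<-|nc] := eqVneq (sg (a, b0)) c; first by exists a.
    have [a' fl' sg'] := flip_col _ _ fl; exists a' => //.
    by rewrite sg'; case: (sg _) c nc => [] [].
  exists (inl a'); split=> //; [|exact: flipM|by move=> ? ? [-> ->]].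
  by rewrite inE; apply/existsP; exists (a', b0); rewrite fl' /= eqxx.
have [|l lcc lY] := exists_cycle_component sgP Y0.
  by move=> x c /(YP x c)[y [? ? ? _]]; exists y.
have [[a b] /= abM [al d0]] := M_cycle lcc.
have [[a'|b'] [//]] := YP _ (sg (a, b)) (lY _ al) => _ h1 h2 /(_ a b') /(_ erefl) fl.
have bb' : inr b' = inr b :> node mu nu.
  exact: (edge_color_inj sgP (x := inl a) (y := inr b') (z := inr b) h1 abM h2).
case: bb' fl => -> /flip_det; by rewrite d0 eqxx.
Qed.

End Unique.

Lemma matching_in_minor : exists2 m, in_minor A U W (#|M| + #|I|)%N m & mon_weight d m = weight d M I.
Proof.
have cN : #|N| = (#|M| + #|I|)%N.
  by rewrite -!sum1_card (sum_N (fun _ _ => 1%N)).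
rewrite -cN; pose h (i : 'I_#|N|) := enum_val i.
have h_inj : injective h by exact: enum_val_inj.
have h_im : [set h i | i in 'I_#|N|] = N.
  apply/setP => x; apply/imsetP/idP => [[i _ ->]|xN]; first exact: enum_valP.
  by exists (enum_rank_in xN x); rewrite // /h enum_rankK_in.
pose f i := (h i).1; pose g i := (h i).2.
exists (perm_mon f g 1).
  exists f, g; rewrite mcoeff_msupp mcoeff_minor (bigD1 1%g) //= [X in _ + X]big1 ?addr0 => [|s s1].
    rewrite eqxx mulr1 odd_perm1 expr0 mul1r; apply/prodf_neq0 => i _.
    have := mem_enum_N h_im i; rewrite perm1 inE /entry /f /g => /and3P[hM /eqP ht hc].
    rewrite -ht; have [es|ns] := eqVneq (h i).1.2 (~~ sg ((h i).1.1, (h i).2.1)).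
      by rewrite es; apply: M_used.
    rewrite (negbTE ns) /= in hc; have [_ d0] := I_isolated hc.
    rewrite (_ : (h i).1.2 = sg ((h i).1.1, (h i).2.1)); first exact: M_rank2.
    by move: ns; case: ((h i).1.2) (sg _) => [] [].
  have [em|_] := eqVneq (perm_mon f g s) (perm_mon f g 1); last by rewrite mulr0.
  have [/existsP[i /eqP z]|/existsPn nz] :=
      boolP [exists i, entry A U W (f i) (g (s i)) == 0].
    by rewrite (bigD1 i) //= z mul0r mulr0 mul0r.
  by case/eqP: s1; apply: (perm_one h_inj h_im em nz).
rewrite /mon_weight perm_mon_sum /weight -sum_N.
transitivity (\sum_(p in [set h i | i in 'I_#|N|]) d p.1.1 p.2.1).
  by rewrite big_imset /=; [apply: eq_bigr => i _; rewrite perm1|exact: in2W].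
by apply: eq_bigl => p; rewrite h_im.
Qed.

End MatchingMinor.

Lemma labeling_frame (F : fieldType) mu nu (V : labeling F mu nu) : exists w : node mu nu -> bool -> 'cV[F]_2,
  [/\ forall x, det2 (w x true) (w x false) != 0,
      forall x s, w x s != 0
    & forall x s, val (if s then lpos V x else lneg V x) = <[w x s]>%VS].
Proof.
have nL : forall x, lpos V x != lneg V x by case: (V).
have /choice[u uP] : forall xs : node mu nu * bool, exists v : 'cV[F]_2,
    v != 0 /\ val (if xs.2 then lpos V xs.1 else lneg V xs.1) = <[v]>%VS.
  by move=> [x s] /=; have [v v0 vE] := line_gen (if s then lpos V x else lneg V x); exists v.
exists (fun x s => u (x, s)); split=> [x|x s|x s].
- have [t0 tE] := uP (x, true); have [f0 fE] := uP (x, false).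
  exact: (line_gen_det (nL x)).
- by have [] := uP (x, s).
- by have [] := uP (x, s).
Qed.

Theorem matching_pair_in_minor (F : fieldType) mu nu (A : 'I_mu -> 'I_nu -> 'M[F]_2)
    (d : 'I_mu -> 'I_nu -> int) M I : matching_pair A M I ->
  exists U V m, [/\ frame U, frame V, in_minor A U V (#|M| + #|I|)%N m
    & mon_weight d m = weight d M I].
Proof.
case=> -[sM deg cyc [sg sgP [L vL]]] IP.
have nA a b : (a, b) \in M -> A a b != 0.
  by move=> /(fintype.subsetP sM); rewrite inE.
have [w [fu w0 wE]] := labeling_frame L.
have uT x : val (lpos L x) = <[w x true]>%VS := wE x true.
have uF x : val (lneg L x) = <[w x false]>%VS := wE x false.
pose U a s := w (inl a) s; pose W b s := w (inr b) s.
have z a b s : (a, b) \in M -> bilin (A a b) (U a s) (W b (~~ s)) = 0.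
  move=> /vL[h1 h2 _]; rewrite !uT !uF in h1 h2.
  by case: s; apply/bilin_set_line.
have rk a b : (a, b) \in M -> \det (A a b) = 0 ->
    bilin (A a b) (U a (sg (a, b))) (W b (sg (a, b))) = 0.
  move=> abM d0; have [_ _ h3] := vL _ _ abM.
  have r1 : \rank (A a b) = 1%N by apply/eqP; rewrite rank1_det ?nA // d0.
  have kL : kerL (A a b) = <[U a (sg (a, b))]>%VS.
    by apply: etrans (congr1 fst (h3 r1)) _; rewrite /U; case: (sg (a, b)); rewrite /fst ?uT ?uF.
  by apply/kerLP; rewrite kL memv_line.
(* In the basis of the labeling the off-diagonal entries vanish, so the product of the diagonal ones
   is the determinant up to a nonzero factor. *)
have dE a b : (a, b) \in M -> bilin (A a b) (U a true) (W b true) *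
    bilin (A a b) (U a false) (W b false) =
    \det (A a b) * (det2 (U a true) (U a false) * det2 (W b true) (W b false)).
  by move=> abM; rewrite -bilin_det (z _ _ true abM) mul0r subr0.
exists U, W; have [||||||m im wm] := @matching_in_minor F mu nu A d M I sg U W sgP.
- move=> s /cyc[[a b] abM [h1 r1]]; exists (a, b) => //; split=> //.
  by apply/eqP; rewrite -rank1_det ?nA // r1.
- by move=> e /IP[? r2]; split=> //; rewrite -rank2_det r2.
- move=> a b s t abM; case: s t => [] [] //.
    by rewrite (z _ _ true abM) eqxx.
  by rewrite (z _ _ false abM) eqxx.
- move=> a b abM; apply/negP => /eqP nz.
  have [d0|d0] := eqVneq (\det (A a b)) 0.
    have /eqP[] := nA _ _ abM; apply: (bilin_eq0 (fu (inl a)) (fu (inr b))).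
    + by move: nz (rk _ _ abM d0); case: (sg (a, b)).
    + exact: (z _ _ true abM).
    + exact: (z _ _ false abM).
    + by move: nz (rk _ _ abM d0); case: (sg (a, b)).
  have := dE _ _ abM; move/eqP; rewrite eq_sym.
  have -> : bilin (A a b) (U a true) (W b true) * bilin (A a b) (U a false) (W b false) = 0.
    by move: nz; case: (sg (a, b)) => /= ->; rewrite ?mulr0 ?mul0r.
  by rewrite !mulf_eq0 (negbTE d0) (negbTE (fu (inl a))) (negbTE (fu (inr b))).
- exact: rk.
- move=> a b abM d0; apply/negP => /eqP nz.
  have := dE _ _ abM; move/eqP; rewrite eq_sym.
  have -> : bilin (A a b) (U a true) (W b true) * bilin (A a b) (U a false) (W b false) = 0.
    by move: nz; case: (sg (a, b)) => /= ->; rewrite ?mulr0 ?mul0r.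
  by rewrite !mulf_eq0 (negbTE d0) (negbTE (fu (inl a))) (negbTE (fu (inr b))).
by exists m; split=> // x; [exact: (fu (inl x))|exact: (fu (inr x))].
Qed.

(** * The degree of a minor *)

(** [delta] ranges over increasing selections and [in_minor] over arbitrary ones; sorting changes a
    minor only by a sign. *)
Lemma sort_injective k n (f : 'I_k -> 'I_n) : injective f ->
  exists (f0 : 'I_k -> 'I_n) (s : {perm 'I_k}),
    {homo f0 : i j / (i < j)%N} /\ forall i, f i = f0 (s i).
Proof.
move=> fi; pose J := [set f i | i in 'I_k].
have cJ : #|J| = k by rewrite card_imset ?card_ord.
pose f0 i : 'I_n := Order.EnumVal.enum_val (cast_ord (esym cJ) i).
have fJ i : f i \in J by exact: imset_f.
pose t i := cast_ord cJ (Order.EnumVal.enum_rank_in (fJ i) (f i)).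
have tK i : f0 (t i) = f i.
  by rewrite /f0 /t cast_ord_comp cast_ord_id Order.EnumVal.enum_rankK_in.
have ti : injective t by move=> i j e; apply: fi; rewrite -!tK e.
exists f0, (perm ti); split=> [i j ij|i]; last by rewrite permE tK.
have le : (f0 j <= f0 i)%O = (cast_ord (esym cJ) j <= cast_ord (esym cJ) i)%O.
  by rewrite /f0 Order.EnumVal.le_enum_val //; apply: le_total.
have {}le : (f0 j <= f0 i)%N = (j <= i)%N := le.
by rewrite ltnNge le -ltnNge.
Qed.

Section MinorPerm.
Variables (F : fieldType) (mu nu : nat) (h : slot mu -> slot nu -> F) (k : nat).

Lemma minor_perm (f : 'I_k -> slot mu) (g : 'I_k -> slot nu) (s t : {perm 'I_k}) m :
  m \in msupp (minor h (f \o s) (g \o t)) -> m \in msupp (minor h f g).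
Proof.
rewrite /minor; set P := \matrix_(i, j) poly_entry h (f i) (g j).
rewrite (_ : \matrix_(_, _) _ = row_perm s (col_perm t P)); last first.
  by apply/matrixP => i j; rewrite !mxE.
rewrite row_permE col_permE !det_mulmx !det_perm mulrC -mulrA -signr_addb.
rewrite !mcoeff_msupp; case: (_ (+) _); last by rewrite expr0 mulr1.
by rewrite expr1 mulrN1 mcoeffN oppr_eq0.
Qed.

End MinorPerm.

Section Degree.
Variables (F : fieldType) (R : realType) (mu nu : nat).
Variables (A : 'I_mu -> 'I_nu -> 'M[F]_2) (d : 'I_mu -> 'I_nu -> int).

Local Notation K := (ratx F mu nu).
Local Notation pol := (mpoly (mu * nu) F).

Let shift : nat := (\sum_a \sum_b absz (d a b))%N.
Let deg a b : nat := absz (d a b + shift%:Z).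

Lemma degE a b : d a b = (deg a b)%:Z - shift%:Z.
Proof.
have : (absz (d a b) <= shift)%N.
  by rewrite /shift (bigD1 a) //= (bigD1 b) //= -addnA leq_addr.
rewrite /deg; lia.
Qed.

Let scalar : {rmorphism F -> {poly K}} :=
  (@polyC K \o @FracField.tofrac pol \o @mpolyC (mu * nu) F : {rmorphism F -> {poly K}}).

(* The substitution [x_ab |-> x_ab t^(d_ab + shift)], which makes all exponents of
   [t] nonnegative. *)
Let subst : {rmorphism pol -> {poly K}} :=
  mmap scalar (fun i => ((@FracField.tofrac pol (mpolyX F (mnm1 i)))%:P *
     'X^(deg (mxvec_unindex i).1 (mxvec_unindex i).2))).

Let wdeg (m : multinom (mu * nu)) : nat :=
  (\sum_a \sum_b deg a b * m (mxvec_index a b))%N.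

Lemma sum_mxvec (G : 'I_mu -> 'I_nu -> nat) :
  (\sum_i G (mxvec_unindex i).1 (mxvec_unindex i).2 = \sum_a \sum_b G a b)%N.
Proof.
rewrite pair_bigA (reindex (fun p : 'I_mu * 'I_nu => mxvec_index p.1 p.2)) /=.
  by apply: eq_bigr => -[a b] _; rewrite mxvec_indexK.
apply: onW_bij; exists (@mxvec_unindex mu nu) => [[a b]|i]; first exact: mxvec_indexK.
rewrite /mxvec_unindex /mxvec_index -surjective_pairing enum_valK.
by rewrite cast_ord_comp cast_ord_id.
Qed.

Lemma substX m : subst (mpolyX F m) = (@FracField.tofrac pol (mpolyX F m))%:P * 'X^(wdeg m).
Proof.
rewrite /= mmapX /mmap1.
under eq_bigr => i _ do rewrite exprMn -exprM.
rewrite big_split /=; congr (_ * _).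
  under eq_bigr => i _ do rewrite -rmorphXn -rmorphXn.
  rewrite -!rmorph_prod /=; congr (_ _)%:P.
  by rewrite [in RHS]mpolyXE_id.
rewrite prodrXr; congr ('X^_).
apply: etrans (sum_mxvec (fun a b => deg a b * m (mxvec_index a b))%N).
apply: eq_bigr => i _; congr (_ * m _)%N.
by rewrite /mxvec_index -surjective_pairing /mxvec_unindex enum_valK cast_ord_comp cast_ord_id.
Qed.

(** Distinct monomials in the [x_ab] cannot cancel, so the degree in [t] is the largest [wdeg] of a
    monomial in the support. *)
Lemma subst_coef p j : (subst p)`_j =
  @FracField.tofrac pol (\sum_(m <- msupp p | wdeg m == j) mcoeff m p *: mpolyX F m).
Proof.
rewrite {1}(mpolyE p) rmorph_sum coef_sum rmorph_sum [RHS]big_mkcond /=.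
apply: eq_bigr => m _.
rewrite -mul_mpolyC rmorphM substX /= mmapC /= mulrA -polyCM coefCM coefXn.
by rewrite eq_sym -rmorphM; case: eqP; rewrite ?mulr1 ?mulr0.
Qed.

Lemma mcoeff_wdeg p j m : m \in msupp p -> wdeg m = j ->
  mcoeff m (\sum_(m <- msupp p | wdeg m == j) mcoeff m p *: mpolyX F m) = mcoeff m p.
Proof.
move=> mp wm; rewrite raddf_sum big_mkcond (bigD1_seq m) ?msupp_uniq //=.
rewrite wm eqxx mcoeffZ mcoeffX eqxx mulr1 big1 ?addr0 // => m' ne.
by case: eqP => // _; rewrite mcoeffZ mcoeffX (negbTE ne) mulr0.
Qed.

Lemma subst_size_gt p m : m \in msupp p -> (wdeg m < size (subst p))%N.
Proof.
move=> mp; rewrite ltnNge; apply/negP => le.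
have := subst_coef p (wdeg m); rewrite nth_default // => /esym/eqP.
rewrite tofrac_eq0 => /eqP z; have := mcoeff_wdeg mp erefl; rewrite z mcoeff0.
by move/esym/eqP; rewrite mcoeff_eq0 mp.
Qed.

Lemma subst_size_eq p : p != 0 -> exists2 m, m \in msupp p & size (subst p) = (wdeg m).+1.
Proof.
move=> p0; have s0 := subst_size_gt (mlead_supp p0).
case E : (size (subst p)) s0 => [//|n] _.
have : (subst p)`_n != 0.
  by have := lead_coef_eq0 (subst p); rewrite lead_coefE E /= => ->; rewrite -size_poly_eq0 E.
rewrite subst_coef tofrac_eq0.
have [/hasP[m mp /eqP <-] _|/hasPn no] := boolP (has (fun m => wdeg m == n) (msupp p)).
  by exists m.
by rewrite big_seq_cond big1 ?eqxx // => m /andP[/no/negbTE ->].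
Qed.

Definition slot_of N (r : 'I_(\sum_(a < N) 2)) : slot N := (tagnat.sig1 r, tagnat.sig2 r == 0).
Definition index_of N (x : slot N) : 'I_(\sum_(a < N) 2) :=
  @tagnat.Rank N (fun=> 2%N) x.1 (if x.2 then 0 else 1).

Lemma index_ofK N : cancel (@index_of N) (@slot_of N).
Proof.
move=> [a s]; rewrite /slot_of /index_of /tagnat.sig1 /tagnat.sig2 /tagnat.Rank.
by rewrite tagnat.rankK /=; case: s.
Qed.

Local Notation std := (entry A (@std_frame F mu) (@std_frame F nu)).

Lemma bilin_std (B : 'M[F]_2) (i j : 'I_2) :
  bilin B (delta_mx (if i == 0 then 0 else 1) 0) (delta_mx (if j == 0 then 0 else 1) 0) = B i j.
Proof.
have E (l : 'I_2) : (if l == 0 then 0 else 1) = l :> 'I_2.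
  by case: (unliftP 0 l) => [l' ->|->] //; rewrite [l']ord1; apply: val_inj.
by rewrite !E /bilin trmx_delta -rowE -colE !mxE.
Qed.

Let tF (q : {poly K}) : ratxt F mu nu := @FracField.tofrac _ q.

Lemma gpmatrixE r c : gpmatrix A d r c =
  (tF 'X ^+ shift)^-1 * tF (subst (poly_entry std (slot_of r) (slot_of c))).
Proof.
rewrite /gpmatrix mxE; set a := tagnat.sig1 r; set b := tagnat.sig1 c.
rewrite [LHS]mxE [X in _ * X]mxE /poly_entry rmorphM substX /= mmapC /=.
have -> : wdeg (xmon a b) = deg a b.
  rewrite /wdeg (bigD1 a) //= (bigD1 b) //= /xmon mnm1E eqxx muln1.
  rewrite [X in (_ + X + _)%N]big1 ?addn0 => [|b' nb]; last first.
    rewrite mnm1E; case: eqP => [/cast_ord_inj/enum_rank_inj[e]|]; last by rewrite muln0.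
    by rewrite e eqxx in nb.
  rewrite big1 ?addn0 // => a' na; rewrite big1 // => b' _; rewrite mnm1E.
  case: eqP => [/cast_ord_inj/enum_rank_inj[e _]|]; last by rewrite muln0.
  by rewrite e eqxx in na.
rewrite /entry /std_frame /= bilin_std.
rewrite /tF !rmorphM /= rmorphXn /=.
have t0 : tF 'X != 0 by rewrite /tF tofrac_eq0 polyX_eq0.
rewrite degE expfzDr // -exprnP -exprz_inv -exprnP exprVn /tvar /ratxt_of /xvar /ratx_const.
have shuffle (D : comUnitRingType) (x y z w : D) : x * (y / z) * w = z^-1 * (w * (x * y)).
  by rewrite mulrA mulrAC mulrC [x * y * w]mulrC.
by rewrite shuffle /a /b /xmon.
Qed.


Lemma mon_weight_wdeg (m : multinom (mu * nu)) k : (\sum_a \sum_b m (mxvec_index a b) = k)%N ->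
  mon_weight d m = (wdeg m)%:Z - (shift * k)%:Z.
Proof.
move=> <-; rewrite /mon_weight /wdeg -[Posz (\sum_a _)%N]natz -[Posz (_ * _)%N]natz.
rewrite big_distrr /= !natr_sum -sumrB; apply: eq_bigr => a _.
rewrite big_distrr /= !natr_sum -sumrB; apply: eq_bigr => b _.
by rewrite -[d a b *+ _]mulr_natr degE !natz !PoszM mulrBl.
Qed.

Section Minors.
Variables (k : nat) (f : 'I_k -> 'I_(\sum_(a < mu) 2)) (g : 'I_k -> 'I_(\sum_(b < nu) 2)).

Let mi := minor std (@slot_of mu \o f) (@slot_of nu \o g).

Lemma det_gpmatrix : \det (mxsub f g (gpmatrix A d)) =
  tF (subst mi) / tF ('X^(shift * k)).
Proof.
have -> : mxsub f g (gpmatrix A d) = (tF 'X ^+ shift)^-1 *: map_mx (@FracField.tofrac {poly K})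
    (map_mx subst (\matrix_(i, j) poly_entry std (slot_of (f i)) (slot_of (g j)))).
  by apply/matrixP => i j; rewrite mxE gpmatrixE !mxE.
rewrite detZ !det_map_mx mulrC exprVn -exprM; congr (_ / _).
by rewrite /tF rmorphXn.
Qed.

Lemma tdeg_det0 : mi = 0 -> tdeg R (\det (mxsub f g (gpmatrix A d))) = -oo%E.
Proof. by move=> m0; rewrite det_gpmatrix m0 rmorph0 /tF tofrac0 mul0r /tdeg eqxx. Qed.

Lemma tdeg_det n : mi != 0 -> size (subst mi) = n.+1 ->
  tdeg R (\det (mxsub f g (gpmatrix A d))) = ((n%:Z - (shift * k)%:Z)%:~R)%:E.
Proof.
move=> m0 sz; have s0 : subst mi != 0 by rewrite -size_poly_eq0 sz.
have X0 : 'X^(shift * k) != 0 :> {poly K} by rewrite -size_poly_eq0 size_polyXn.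
rewrite det_gpmatrix /tdeg ifN; last first.
  by rewrite mulf_eq0 invr_eq0 /tF !tofrac_eq0 negb_or s0.
by rewrite fracdeg_div // sz size_polyXn; congr (_%:~R)%:E; lia.
Qed.

Lemma tdeg_det_ge m : m \in msupp mi ->
  (((mon_weight d m)%:~R)%:E <= tdeg R (\det (mxsub f g (gpmatrix A d))))%E.
Proof.
move=> mp.
have im : in_minor A (@std_frame F mu) (@std_frame F nu) k m.
  by exists (@slot_of mu \o f), (@slot_of nu \o g).
have [_ cm] := in_minor_good (@std_frameP F mu) (@std_frameP F nu) im.
have m0 : mi != 0 by apply: contraTneq mp => ->; rewrite mcoeff_msupp mcoeff0 eqxx.
have lt := subst_size_gt mp; case E : (size (subst mi)) lt => [//|n] lt.
by rewrite (tdeg_det m0 E) (mon_weight_wdeg cm) lee_fin ler_int lerD2r lez_nat.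
Qed.

Lemma tdeg_det_eq : tdeg R (\det (mxsub f g (gpmatrix A d))) = -oo%E \/
  exists2 m, in_minor A (@std_frame F mu) (@std_frame F nu) k m &
    tdeg R (\det (mxsub f g (gpmatrix A d))) = ((mon_weight d m)%:~R)%:E.
Proof.
have [m0|m0] := eqVneq mi 0; first by left; apply: tdeg_det0.
right; have [m mp E] := subst_size_eq m0.
have im : in_minor A (@std_frame F mu) (@std_frame F nu) k m.
  by exists (@slot_of mu \o f), (@slot_of nu \o g).
have [_ cm] := in_minor_good (@std_frameP F mu) (@std_frameP F nu) im.
by exists m; rewrite // (tdeg_det m0 E) (mon_weight_wdeg cm).
Qed.

End Minors.

Lemma delta_in_minor k : delta R k (gpmatrix A d) =
  ereal_sup [set r | exists2 m, in_minor A (@std_frame F mu) (@std_frame F nu) k m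
    & r = ((mon_weight d m)%:~R)%:E]%classic.
Proof.
apply/eqP; rewrite eq_le; apply/andP; split.
  case: k => [|k]; last first.
    apply: ge_ereal_sup => _ [f [g [_ _ ->]]].
    case: (tdeg_det_eq f g) => [->|[m im ->]]; first exact: leNye.
    by apply: ereal_sup_ubound; exists m.
  (* [delta] is 0 by definition for [k = 0]; the empty determinant is 1, whose only monomial has
     weight 0. *)
  have w0 : mon_weight d (@mnm0 (mu * nu)) = 0.
    by rewrite /mon_weight big1 // => a _; rewrite big1 // => b _; rewrite mnm0E mulr0n.
  apply: ereal_sup_ubound; exists (@mnm0 (mu * nu)); last by rewrite w0.
  have fF (T : Type) (i : 'I_0) : T by case: i.
  exists (fF _), (fF _); rewrite /minor det_mx00 mcoeff_msupp mcoeff1 eqxx oner_neq0 //.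
apply: ge_ereal_sup => _ [m im ->].
case: k im => [|k] im.
  have [_ cm] := in_minor_good (@std_frameP F mu) (@std_frameP F nu) im.
  rewrite (mon_weight_wdeg cm) muln0 subr0 lee_fin /=.
  rewrite (_ : wdeg m = 0%N) //; apply/eqP; rewrite -leqn0 /wdeg.
  rewrite big1 // => a _; rewrite big1 // => b _.
  move/eqP: cm; rewrite sum_nat_eq0 => /forallP/(_ a).
  by rewrite sum_nat_eq0 => /forallP/(_ b) /= /eqP ->; rewrite muln0.
have [f [g mp]] := im.
have [fi gi] : injective f /\ injective g.
  apply: (@minor_inj F mu nu std).
  by apply: contraTneq mp => ->; rewrite mcoeff_msupp mcoeff0 eqxx.
have f'i : injective (@index_of mu \o f) by apply: inj_comp fi; apply: can_inj (@index_ofK mu).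
have g'i : injective (@index_of nu \o g) by apply: inj_comp gi; apply: can_inj (@index_ofK nu).
have [f0 [s [f0h f0E]]] := sort_injective f'i.
have [g0 [t [g0h g0E]]] := sort_injective g'i.
have mp0 : m \in msupp (minor std (@slot_of mu \o f0) (@slot_of nu \o g0)).
  apply: (minor_perm (s := s) (t := t)).
  rewrite (_ : minor _ _ _ = minor std f g) //; congr (\det _).
  apply/matrixP => i j; rewrite !mxE /= -f0E -g0E /=.
  by rewrite !index_ofK.
apply: le_trans (tdeg_det_ge mp0) _.
by apply: ereal_sup_ubound; exists f0, g0.
Qed.

End Degree.

(** * Potentials *)

Lemma sum_slot (V : nmodType) n (w : slot n -> V) :
  \sum_s w s = \sum_a (w (a, true) + w (a, false)).
Proof.
transitivity (\sum_(a : 'I_n) \sum_(s : bool) w (a, s)).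
  by rewrite pair_bigA; apply: eq_bigr => -[].
by apply: eq_bigr => a _; rewrite big_bool.
Qed.

Section LinePotential.
Variables (F : fieldType) (R : realType) (u v : 'cV[F]_2) (p1 p2 : R).
Hypothesis duv : det2 u v != 0.

(* A potential given on two lines extends to all lines by the maximum: this is the
   smallest extension, as a generic line meets whatever either of the two meets. *)
Definition line_potential (Z : line F) : R :=
  if Z == line_of u then p1 else if Z == line_of v then p2 else Num.max p1 p2.

Lemma line_potential_u : line_potential (line_of u) = p1.
Proof. by rewrite /line_potential eqxx. Qed.

Lemma line_potential_v : line_potential (line_of v) = p2.
Proof. by rewrite /line_potential eq_sym (negbTE (line_of_neq duv)) eqxx. Qed.

Lemma line_potential_ge0 Z : 0 <= p1 -> 0 <= p2 -> 0 <= line_potential Z.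
Proof. by rewrite /line_potential => h1 h2; do 2?case: ifP => // _; rewrite le_max h1. Qed.

Lemma line_potential_geu Z z : val Z = <[z]>%VS -> det2 z v != 0 -> p1 <= line_potential Z.
Proof.
move=> hZ d; rewrite /line_potential; case: ifP => // _; case: eqP => [ZE|_].
  have v0 : v != 0 by move: duv; rewrite det2C oppr_eq0 => /det2_neq0l.
  have : z \in <[v]>%VS by rewrite -(val_line_of v0) -ZE hZ memv_line.
  by case/vlineP => c zE; move: d; rewrite zE /det2 !mxE => /eqP[]; ring.
by rewrite le_max lexx.
Qed.

Lemma line_potential_gev Z z : val Z = <[z]>%VS -> det2 u z != 0 -> p2 <= line_potential Z.
Proof.
move=> hZ d; rewrite /line_potential; case: eqP => [ZE|_].
  have u0 := det2_neq0l duv.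
  have : z \in <[u]>%VS by rewrite -(val_line_of u0) -ZE hZ memv_line.
  case/vlineP => c zE; move: d; rewrite zE /det2 !mxE => /eqP[].
  by ring.
by case: ifP => // _; rewrite le_max lexx orbT.
Qed.

End LinePotential.

Section Potentials.
Variables (F : fieldType) (R : realType) (mu nu : nat) (A : 'I_mu -> 'I_nu -> 'M[F]_2).
Variables (d : 'I_mu -> 'I_nu -> int) (k : nat).

(** The generators of the lines of a labeling form a frame, so weak duality applies to the
    transversal found in that frame. *)
Lemma good_potential (V : labeling F mu nu) (c : R) (p : node mu nu -> line F -> R) m :
  potential A d c p -> good A m -> (\sum_a \sum_b m a b)%N = k ->
  (\sum_a \sum_b d a b *+ m a b)%:~R <= labeling_value p V + k%:R * c.
Proof.
move=> [p0 dp] gm cm; have [w [fw w0 wE]] := labeling_frame V.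
have [N tN] := gm _ _ ((fun a => fw (inl a)) : frame (fun a => w (inl a)))
  ((fun b => fw (inr b)) : frame (fun b => w (inr b))).
pose L x s := if s then lpos V x else lneg V x.
have := transversal_weight (d := fun a b => (d a b)%:~R : R) (c := c)
  (p := fun i => p (inl i.1) (L (inl i.1) i.2)) (q := fun j => p (inr j.1) (L (inr j.1) j.2)) tN.
rewrite !sum_slot cm /labeling_value /= => h.
apply: le_trans (h _ _ _) => //.
  rewrite rmorph_sum; apply: ler_sum => a _; rewrite rmorph_sum; apply: ler_sum => b _.
  by rewrite rmorphMn.
move=> [a s] [b t]; rewrite /entry /= => nz; apply: dp.
  rewrite inE /=; apply: contraNneq nz => ->.
  by rewrite bilinE !mxE !mul0r !addr0 !mulr0 addr0.
by rewrite (wE (inl a) s) (wE (inr b) t) => /bilin_set_line z; rewrite z eqxx in nz.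
Qed.

Lemma feasible_potential U V p q c : feasible A d U V p q c ->
  exists (W : labeling F mu nu) (P : node mu nu -> line F -> R),
  potential A d (c%:~R) P /\ labeling_value P W + k%:R * c%:~R = (dual_value k p q c)%:~R.
Proof.
move=> [fU fV p0 q0 dpq].
pose w (x : node mu nu) s := match x with inl a => U a s | inr b => V b s end.
pose r (x : node mu nu) s : R := match x with inl a => p (a, s) | inr b => q (b, s) end%:~R.
have fw x : det2 (w x true) (w x false) != 0 by case: x => [a|b]; [exact: fU|exact: fV].
have r0 x s : 0 <= r x s by case: x => [a|b]; rewrite /r ler0z ?p0 ?q0.
pose P x Z := line_potential (w x true) (w x false) (r x true) (r x false) Z.
exists (@Labeling F mu nu (fun x => line_of (w x true)) (fun x => line_of (w x false))
    (fun x => line_of_neq (fw x))), P; split.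
  split=> [x Z|a b X Y _]; first exact: line_potential_ge0.
  have [x x0 hX] := line_gen X; have [y y0 hY] := line_gen Y.
  rewrite hX hY => nz; have {}nz : bilin (A a b) x y != 0.
    by apply/eqP => z; apply: nz; apply/bilin_set_line.
  have Pge (g : node mu nu) Z z s : val Z = <[z]>%VS ->
      det2 (if s then z else w g true) (if s then w g false else z) != 0 -> r g s <= P g Z.
    by case: s => hZ; [exact: line_potential_geu|exact: line_potential_gev].
  (* Up to the determinants of the frames, [cx] and [cy] are the coordinates of [x] and [y]. By
     bilinearity some pair of basis vectors with nonzero coordinates pairs to a nonzero value, and
     its dual constraint implies the one for [X] and [Y]. *)
  pose cx s := det2 (if s then x else U a true) (if s then U a false else x).
  pose cy s := det2 (if s then y else V b true) (if s then V b false else y).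
  have [s [t [nx ny nst]]] : exists s t, [/\ cx s != 0, cy t != 0 & bilin (A a b) (U a s) (V b t) != 0].
    apply: contra_notP (negP nz) => no.
    rewrite (det2_expand x (fU a)) (det2_expand y (fV b)) bilinDl !bilinDr.
    have z s t : cx s * (cy t * bilin (A a b) (U a s) (V b t)) = 0.
      apply/eqP; apply: contra_notT no; rewrite !mulf_eq0 !negb_or => /and3P[h1 h2 h3].
      by exists s, t.
    apply/eqP; move: (z true true) (z true false) (z false true) (z false false).
    rewrite /cx /cy /= => z1 z2 z3 z4.
    have E (x1 y1 e f g : F) : x1 * (y1 * g) = 0 -> x1 / e * (y1 / f * g) = 0.
      move: (e^-1) (f^-1) => e' f' h.
      have -> : x1 * e' * (y1 * f' * g) = x1 * (y1 * g) * (e' * f') by ring.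
      by rewrite h mul0r.
    by rewrite !mulrDr !E // !addr0.
  have le := dpq (a, s) (b, t) nst; rewrite /= in le.
  apply: le_trans (_ : (p (a, s) + q (b, t) + c)%:~R <= _); first by rewrite ler_int.
  rewrite !rmorphD /= lerD2r; apply: lerD.
    exact: (Pge (inl a) X x s).
  exact: (Pge (inr b) Y y t).
rewrite /labeling_value /dual_value /= !rmorphD /= !rmorph_sum rmorphM /= !sum_slot.
congr (_ + _ + _).
- by apply: eq_bigr => a _; rewrite /P line_potential_u line_potential_v //; apply: fw (inl a).
- by apply: eq_bigr => b _; rewrite /P line_potential_u line_potential_v //; apply: fw (inr b).
Qed.

End Potentials.

Theorem theorem2p2 (F : fieldType) (R : realType) (mu nu : nat)
    (hmu : (0 < mu)%N) (hnu : (0 < nu)%N)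
    (A : 'I_mu -> 'I_nu -> 'M[F]_2) (d : 'I_mu -> 'I_nu -> int) (k : nat) :
  delta R k (gpmatrix A d) = matching_sup A d R k /\
  matching_sup A d R k = potential_inf A d R k.
Proof.
rewrite delta_in_minor; set S := ereal_sup _.
have fmu := @std_frameP F mu; have fnu := @std_frameP F nu.
have S_le_M : (S <= matching_sup A d R k)%E.
  apply: ge_ereal_sup => _ [m im ->].
  have [gm cm] := in_minor_good fmu fnu im.
  have [M [I [mp sz wt]]] := good_matching d gm.
  apply: le_trans (_ : (((weight d M I)%:~R)%:E <= _)%E); first by rewrite lee_fin ler_int.
  by apply: ereal_sup_ubound; exists M, I; rewrite sz cm.
have M_le_S : (matching_sup A d R k <= S)%E.
  apply: ge_ereal_sup => _ [M [I [mp sz ->]]].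
  have [U [V [m [fU fV im wm]]]] := matching_pair_in_minor d mp.
  rewrite -wm; apply: ereal_sup_ubound; exists m => //.
  by rewrite -sz; apply: in_minor_change im.
have S_le_P : (S <= potential_inf A d R k)%E.
  apply: ge_ereal_sup => _ [m im ->].
  have [gm cm] := in_minor_good fmu fnu im.
  apply: le_ereal_inf_tmp => _ [V [c [p [pot ->]]]].
  by rewrite lee_fin; exact: (good_potential V pot gm cm).
have P_le_S : (potential_inf A d R k <= S)%E.
  have ub U V p q c : feasible A d U V p q c ->
      (potential_inf A d R k <= ((dual_value k p q c)%:~R)%:E)%E.
    move=> fe; have [W [P [pot <-]]] := feasible_potential R k fe.
    by apply: ereal_inf_lbound; exists W, c%:~R, P.
  have [[L lb]|nlb] := pselect (exists L, forall U V p q c,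
      feasible A d U V p q c -> L <= dual_value k p q c).
    have [U [V [p [q [c [m [fe im wm]]]]]]] := strong_duality lb.
    apply: le_trans (ub _ _ _ _ _ fe) _; rewrite -wm.
    apply: ereal_sup_ubound; exists m => //.
    by have [fU fV _ _ _] := fe; apply: in_minor_change im.
  (* A finite infimum [r] would give the integral lower bound [floor r], and an infimum [+oo]
     contradicts any feasible solution. *)
  rewrite (_ : potential_inf A d R k = -oo%E) ?leNye //.
  case E : (potential_inf A d R k) => [r| |] //; exfalso; apply: nlb.
    exists (Num.floor r) => U V p q c fe; have := ub _ _ _ _ _ fe.
    by rewrite E lee_fin -(ler_int R); apply/le_trans/floor_le.
  exists 0 => U V p q c fe; have := ub _ _ _ _ _ fe.
  by rewrite E leye_eq.
split; first by apply/eqP; rewrite eq_le S_le_M M_le_S.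
by apply/eqP; rewrite eq_le (le_trans M_le_S S_le_P) (le_trans P_le_S S_le_M).
Qed.
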